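(* Suppose that assumptions (A1)–(A5) listed in the context hold, with mean $\mu=\mu_n$ satisfying the local alternative condition $$\mu^\top\left[\Gamma(h)\Gamma(-h)\right]^{1/2}\mu=o\left((M+1)^{-1}n^{-1}\,\mathrm{tr}(\Omega_n^2)\right)\quad\text{uniformly over } h\in\{-M,\ldots,M\}.$$ Fix a significance level $\alpha\in(0,1)$, let $\Phi$ be the standard normal distribution function and $z_\alpha=\Phi^{-1}(1-\alpha)$. Then the power $\beta_n(\mu)=P(\mathcal{T}_n>z_\alpha)$ of the test of $\mathcal{H}_0:\mu=0$ against $\mathcal{H}_A:\mu\ne0$ that rejects when $\mathcal{T}_n>z_\alpha$ satisfies $$\beta_n(\mu)-\Phi\left(-z_\alpha+\frac{n\,\mu^\top\mu}{\sqrt{2\,\mathrm{tr}(\Omega_n^2)}}\right)\longrightarrow0\qquad\text{as }n\to\infty,$$ where $\mathcal{T}_n$ is the test statistic defined in the context.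
   Context: The setting is a triangular array: the dimension $p$, the dependence order $M\ge0$, the mean $\mu$ and the autocovariances $\Gamma(h)$ may depend on the sample size $n$, and all limits are as $n\to\infty$. Write $\mathcal{M}=\{-M,\ldots,M\}$ and $\mathcal{M}_+=\{0,\ldots,M\}$. For a positive semidefinite matrix $A$, $A^{1/2}$ is its positive semidefinite square root. Assumptions: (A1) $X_1,\ldots,X_n\in\mathbb{R}^p$ follow an $M$-dependent strictly stationary Gaussian process with mean $\mu$ and autocovariances $\mathrm{Cov}(X_t,X_{t+h})=\Gamma(h)$ for $h\in\mathcal{M}$ (so $X_s$ and $X_t$ are independent if $|s-t|>M$, and $\Gamma(-h)=\Gamma(h)^\top$). (A2) $p=O(n)$ and $p\to\infty$. (A3) $M=O(n^{1/8})$. (A4) With $\bar X_n=\frac1n\sum_{t=1}^nX_t$ and $\Omega_n=n\,\mathrm{Cov}(\bar X_n)=\sum_{h\in\mathcal{M}}(1-\frac{|h|}{n})\Gamma(h)$, one has $\Omega_n\to F(0)$, where $F(0)=\sum_{h\in\mathcal{M}}\Gamma(h)$ is the spectral matrix at frequency zero; the convergence means that the largest absolute entry of $\Omega_n-F(0)$ tends to $0$. (A5) $\mathrm{tr}(\Gamma(a)\Gamma(b)\Gamma(c)\Gamma(d))=o\big((M+1)^{-4}\,\mathrm{tr}^2(\Omega_n^2)\big)$, uniformly over $a,b,c,d\in\mathcal{M}$. Here $\mathrm{tr}^2(A)=(\mathrm{tr}A)^2$. Test statistic: for $h\in\mathcal{M}_+$ let $\widehat\Gamma(h)=\frac1n\sum_{t=1}^{n-h}(X_t-\bar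 X_n)(X_{t+h}-\bar X_n)^\top$, $\gamma=(\mathrm{tr}\,\Gamma(0),\ldots,\mathrm{tr}\,\Gamma(M))^\top$, $\widehat\gamma_n=(\mathrm{tr}\,\widehat\Gamma(0),\ldots,\mathrm{tr}\,\widehat\Gamma(M))^\top$. Let $\Theta_n$ be the $(M+1)\times(M+1)$ matrix, depending only on $n$ and $M$, such that $\mathrm{E}(\widehat\gamma_n)=\Theta_n\gamma$. Let $b_n\in\mathbb{R}^{M+1}$ have entries $b_n(0)=1$, $b_n(h)=2(1-\frac hn)$ for $1\le h\le M$, so that $\mathrm{tr}(\Omega_n)=b_n^\top\gamma$, and let $\beta_n=\Theta_n^{-1}b_n$ (a vector, distinct from the power function $\beta_n(\mu)$). Then $\widehat{\mathrm{tr}(\Omega_n)}=\beta_n^\top\widehat\gamma_n$ is an unbiased estimator of $\mathrm{tr}(\Omega_n)$. Define the scalar $$\mathcal{M}_n=\bar X_n^\top\bar X_n-\frac1n\widehat{\mathrm{tr}(\Omega_n)},\qquad \mathcal{T}_n=\frac{\mathcal{M}_n}{\sqrt{\widehat{\mathrm{var}(\mathcal{M}_n)}}},$$ where $\widehat{\mathrm{var}(\mathcal{M}_n)}$ is a ratio-consistent estimator of $\mathrm{var}(\mathcal{M}_n)$, i.e. $\widehat{\mathrm{var}(\mathcal{M}_n)}/\mathrm{var}(\mathcal{M}_n)\to1$ in probability (under the local alternative considered). *)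

(* Defs.v *)
From HB Require Import structures.
From mathcomp Require Import all_boot all_order all_algebra.
From mathcomp Require Import all_classical all_reals all_analysis.
From mathcomp Require Import measurable_realfun zify ring lra.

Set Implicit Arguments.
Unset Strict Implicit.
Unset Printing Implicit Defensive.

Import Order.TTheory GRing.Theory Num.Theory.
Import numFieldNormedType.Exports.

Local Open Scope classical_set_scope.
Local Open Scope ring_scope.

(* [normal_prob m 0] is not the point mass at [m], hence the case split; *)
(* [s] is the standard deviation. *)
Definition gaussian_law {R : realType} (m s : R) : set R -> \bar R :=
  if s == 0 then \d_m else normal_prob m s.

Definition Phi {R : realType} (x : R) : R :=
  fine (normal_prob (0 : R) 1 `]-oo, x]).

Section matrices.
Context {R : realType}.

Definition is_psd (p : nat) (A : 'M[R]_p) : Prop :=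
  A^T = A /\ forall v : 'cV[R]_p, 0 <= (v^T *m A *m v) 0 0.

(* The square root is unique and exists as soon as [A] is positive *)
(* semidefinite; otherwise the value is irrelevant. *)
Definition psd_sqrt (p : nat) (A : 'M[R]_p) : 'M[R]_p :=
  xget 0 [set S : 'M[R]_p | is_psd S /\ S *m S = A].

Definition qform (p : nat) (A : 'M[R]_p) (v : 'cV[R]_p) : R :=
  (v^T *m A *m v) 0 0.

Definition max_entry (p : nat) (A : 'M[R]_p) : R :=
  \big[Num.max/0]_(ij : 'I_p * 'I_p) `|A ij.1 ij.2|.

Definition spectral0 (p M : nat) (Gam : int -> 'M[R]_p) : 'M[R]_p :=
  \sum_(i < M.*2.+1) Gam (i%:Z - M%:Z).

End matrices.

(* Processes are indexed by [nat]; the sample of size [n] is X 1, ..., X n. *)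
Section process.
Context {R : realType} {d : measure_display} {T : measurableType d}.
Context (P : probability T R) {p : nat} (X : nat -> {RV P >-> p.-tuple R}).

Definition vec (t : nat) (w : T) : 'cV[R]_p := \col_i tnth (X t w) i.

Definition strictly_stationary : Prop :=
  forall (k : nat) (t : 'I_k -> nat) (h : nat) (B : set (k.-tuple (p.-tuple R))),
    measurable B ->
    P [set w | B (mktuple (fun j => X (t j + h)%N w))] =
    P [set w | B (mktuple (fun j => X (t j) w))].

Definition gaussian_process : Prop :=
  forall (N : nat) (a : 'I_N -> 'cV[R]_p), exists m s : R,
    forall B : set R, measurable B ->
      P [set w | B (\sum_(t < N) ((a t)^T *m vec t w) 0 0)] =
      gaussian_law m s B.

Definition sigma_of (S : set nat) : set (set T) :=
  <<s [set A | exists t (B : set (p.-tuple R)),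
        [/\ S t, measurable B & A = X t @^-1` B]] >>.

Definition m_dependent (M : nat) : Prop :=
  forall (s : nat) (A B : set T),
    sigma_of [set t | (t <= s)%N] A -> sigma_of [set t | (s + M < t)%N] B ->
    P (A `&` B) = (P A * P B)%E.

Definition has_mean (mu : 'cV[R]_p) : Prop :=
  forall t i, expectation P (fun w => vec t w i 0) = (mu i 0)%:E.

Definition has_autocov (M : nat) (Gam : int -> 'M[R]_p) : Prop :=
  forall (s t : nat) (i j : 'I_p), (`|t%:Z - s%:Z| <= M)%N ->
    covariance P (fun w => vec s w i 0) (fun w => vec t w j 0) =
    (Gam (t%:Z - s%:Z) i j)%:E.

Variable n : nat.

Definition Xbar (w : T) : 'cV[R]_p :=
  n%:R^-1 *: \sum_(1 <= t < n.+1) vec t w.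

Definition Omega : 'M[R]_p :=
  \matrix_(i, j) (n%:R *
    fine (covariance P (fun w => Xbar w i 0) (fun w => Xbar w j 0))).

Definition Gamma_hat (h : nat) (w : T) : 'M[R]_p :=
  n%:R^-1 *: \sum_(1 <= t < (n - h).+1)
    ((vec t w - Xbar w) *m (vec (t + h) w - Xbar w)^T).

Definition gamma_hat (M : nat) (w : T) : 'cV[R]_M.+1 :=
  \col_(h < M.+1) \tr (Gamma_hat h w).

End process.

Definition gamma_vec {R : realType} (p M : nat) (Gam : int -> 'M[R]_p) :
  'cV[R]_M.+1 := \col_(h < M.+1) \tr (Gam h%:Z).

(* [ctr n t s] is the coefficient of X_s in X_t - Xbar; column [k] of       *)
(* [Theta] collects the coefficients of the lag-[k] terms of                *)
(* E tr(Gamma_hat h). Correctness is [mean_gamma_hat].                      *)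
Definition ctr {R : realType} (n t s : nat) : R := (s == t)%:R - n%:R^-1.

Definition Theta {R : realType} (n M : nat) : 'M[R]_M.+1 :=
  \matrix_(h < M.+1, k < M.+1)
    (n%:R^-1 * \sum_(1 <= t < (n - h).+1)
       \sum_(1 <= s < n.+1) \sum_(1 <= u < n.+1)
         ctr n t s * ctr n (t + h) u * (`|s%:Z - u%:Z|%N == k)%:R).

(* Theta_n is the matrix with E(gamma_hat_n) = Theta_n gamma; only second   *)
(* moments matter, so M-dependence is used only through the vanishing of    *)
(* the autocovariances beyond lag M.                                        *)
Section mean_gamma_hat.
Context {R : realType} {d : measure_display} {T : measurableType d}.
Context (P : probability T R) {p : nat} (X : nat -> {RV P >-> p.-tuple R}).
Variables (n M : nat) (mu : 'cV[R]_p) (Gam : int -> 'M[R]_p).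

Let has_exp (f : T -> R) (v : R) : Prop :=
  P.-integrable setT (EFin \o f) /\ expectation P f = v%:E.

Let has_expZ a f v : has_exp f v -> has_exp (fun w => a * f w) (a * v).
Proof.
move=> [If Ef]; split.
  have := @integrableZl _ _ _ P setT measurableT a _ If.
  by apply: eq_integrable => // w _ /=; rewrite EFinM.
move: Ef; rewrite unlock => Ef.
under eq_integral do rewrite EFinM.
by rewrite integralZl// Ef EFinM.
Qed.

Let has_exp_sum (I : Type) (r : seq I) (f : I -> T -> R) (v : I -> R) :
  (forall i, has_exp (f i) (v i)) ->
  has_exp (fun w => \sum_(i <- r) f i w) (\sum_(i <- r) v i).
Proof.
move=> fv; elim: r => [|i r [IHi IHe]].
  split.
    apply: (@eq_integrable _ _ _ P setT measurableT (cst 0%E)).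
      by move=> w _ /=; rewrite big_nil.
    exact: integrable0.
  rewrite unlock big_nil (eq_integral (cst 0%E)) ?integral0//.
  by move=> w _; rewrite big_nil.
have [Ifi Efi] := fv i; split.
  apply: (@eq_integrable _ _ _ P setT measurableT
     ((EFin \o f i) \+ (EFin \o (fun w => (\sum_(j <- r) f j w)%R)))%E).
    by move=> w _ /=; rewrite big_cons EFinD.
  exact: integrableD.
move: IHe Efi; rewrite unlock => IHe Efi.
rewrite big_cons EFinD -Efi -IHe -integralD//.
by apply: eq_integral => w _; rewrite /= big_cons EFinD.
Qed.

Hypothesis mean_mu : has_mean X mu.
Hypothesis autocov_Gam : has_autocov X M Gam.
Hypothesis uncorrelated : forall (s t : nat) (i j : 'I_p),
  (M < `|t%:Z - s%:Z|)%N ->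
  covariance P (fun w => vec X s w i 0) (fun w => vec X t w j 0) = 0%E.

Let Y (s : nat) (i : 'I_p) (w : T) : R := vec X s w i 0 - mu i 0.

Let covY s u i j :
  covariance P (fun w => vec X s w i 0) (fun w => vec X u w j 0) =
  expectation P (fun w => Y s i w * Y u j w).
Proof. by rewrite covariance.unlock !mean_mu. Qed.

Let mY s i : measurable_fun setT (Y s i).
Proof.
apply: measurable_funB; last exact: measurable_cst.
rewrite (_ : (fun w => _) = (@tnth _ _ ^~ i) \o X s); last first.
  by apply/funext => w; rewrite /vec mxE.
by apply: measurableT_comp; [exact: measurable_tnth|exact: measurable_funP].
Qed.

Let IY2 s i : P.-integrable setT (EFin \o (fun w => Y s i w * Y s i w)).
Proof.
have := covY s s i i; rewrite autocov_Gam ?subrr//.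
rewrite unlock => E.
apply/integrableP; split.
  by apply/measurable_EFinP; apply: measurable_funM.
rewrite (eq_integral (fun w => (Y s i w * Y s i w)%:E)) -?E ?ltry//.
by move=> w _ /=; rewrite ger0_norm// -expr2 sqr_ge0.
Qed.

Let IYY s u i j : P.-integrable setT (EFin \o (fun w => Y s i w * Y u j w)).
Proof.
have := integrableD measurableT (IY2 s i) (IY2 u j).
apply: le_integrable => //.
  by apply/measurable_EFinP; apply: measurable_funM.
move=> w _ /=; rewrite lee_fin normrM [leRHS]ger0_norm; last first.
  by rewrite addr_ge0// -expr2 sqr_ge0.
rewrite -[Y s i w * _]expr2 -[Y u j w * _]expr2 -(real_normK (num_real (Y s i w))).
rewrite -(real_normK (num_real (Y u j w))).
have := normr_ge0 (Y s i w); have := normr_ge0 (Y u j w); nra.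
Qed.

Let acov (s u : nat) : R :=
  \sum_(k < M.+1) (`|s%:Z - u%:Z|%N == k)%:R * \tr (Gam k%:Z).

Let exp_dotY s u : has_exp (fun w => \sum_(i < p) Y s i w * Y u i w) (acov s u).
Proof.
have -> : acov s u =
    \sum_(i < p) fine (expectation P (fun w => Y s i w * Y u i w)).
  have [le_M | gt_M] := leqP `|u%:Z - s%:Z|%N M.
    have ltM : (`|s%:Z - u%:Z| < M.+1)%N by lia.
    rewrite /acov (bigD1 (Ordinal ltM)) //= eqxx mul1r big1 ?addr0; last first.
      move=> k; rewrite -val_eqE /= eq_sym => /negbTE ->; exact: mul0r.
    apply: eq_bigr => i _; rewrite -covY.
    have [le_us|lt_su] := leqP u s.
      rewrite covarianceC autocov_Gam; last by lia.
      by congr (Gam _ i i); lia.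
    by rewrite autocov_Gam//; congr (Gam _ i i); lia.
  rewrite /acov big1 => [|k _]; last first.
    case: eqP => [e|_]; last exact: mul0r.
    by have := ltn_ord k; lia.
  by rewrite big1// => i _; rewrite -covY uncorrelated.
apply: has_exp_sum => i; split; first exact: IYY.
rewrite fineK// unlock; exact: (integrable_fin_num _ (IYY s u i i)).
Qed.

Let centerE t i w : (0 < t <= n)%N ->
  (vec X t w - Xbar X n w) i 0 =
  \sum_(1 <= s < n.+1) ctr n t s * Y s i w.
Proof.
move=> /andP[t0 tn].
have n0 : n%:R != 0 :> R by rewrite pnatr_eq0; lia.
under eq_bigr do rewrite mulrBl.
rewrite big_split/= sumrN.
rewrite (bigD1_seq t) ?iota_uniq ?mem_index_iota ?t0//= eqxx mul1r.
rewrite [X in _ + X - _]big1 => [|s /negbTE ->]; last exact: mul0r.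
rewrite addr0 -mulr_sumr sumrB sumr_const_nat subn1/= -[mu i 0 *+ n]mulr_natl.
rewrite mulrBr mulKf// /Xbar !mxE summxE /Y mxE.
by under [in RHS]eq_bigr do rewrite mxE; under [in LHS]eq_bigr do rewrite mxE; ring.
Qed.

Let tr_outer (a b : 'cV[R]_p) :
  \tr (a *m b^T) = \sum_(i < p) a i 0 * b i 0.
Proof. by apply: eq_bigr => i _; rewrite mxE big_ord1 mxE. Qed.

Lemma mean_gamma_hat (h : 'I_M.+1) :
  expectation P (fun w => gamma_hat X n M w h 0) =
  ((Theta n M *m gamma_vec M Gam) h 0)%:E.
Proof.
have -> : (fun w => gamma_hat X n M w h 0) = (fun w =>
    n%:R^-1 * \sum_(1 <= t < (n - h).+1)
      \sum_(1 <= s < n.+1) \sum_(1 <= u < n.+1)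
        ctr n t s * ctr n (t + h) u * \sum_(i < p) Y s i w * Y u i w).
  apply/funext => w; rewrite /gamma_hat mxE /Gamma_hat mxtraceZ raddf_sum/=.
  congr (_ * _); apply: eq_big_nat => t tn.
  rewrite tr_outer.
  transitivity (\sum_(i < p) \sum_(1 <= s < n.+1) \sum_(1 <= u < n.+1)
      (ctr n t s * Y s i w) * (ctr n (t + h) u * Y u i w)).
    by apply: eq_bigr => i _; rewrite !centerE ?big_distrlr//; lia.
  rewrite exchange_big/=; apply: eq_bigr => s _.
  rewrite exchange_big/=; apply: eq_bigr => u _.
  by rewrite mulr_sumr; apply: eq_bigr => i _; rewrite mulrACA.
have [_ ->] : has_exp (fun w =>
    n%:R^-1 * \sum_(1 <= t < (n - h).+1)
      \sum_(1 <= s < n.+1) \sum_(1 <= u < n.+1)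
        ctr n t s * ctr n (t + h) u * \sum_(i < p) Y s i w * Y u i w)
    (n%:R^-1 * \sum_(1 <= t < (n - h).+1)
      \sum_(1 <= s < n.+1) \sum_(1 <= u < n.+1)
        ctr n t s * ctr n (t + h) u * acov s u).
  apply: has_expZ; apply: has_exp_sum => t; apply: has_exp_sum => s.
  by apply: has_exp_sum => u; apply: has_expZ; exact: exp_dotY.
congr EFin; rewrite mxE.
under [RHS]eq_bigr => k _ do rewrite !mxE -mulrA.
rewrite -mulr_sumr; congr (_ * _).
under [RHS]eq_bigr do rewrite mulr_suml.
rewrite [RHS]exchange_big/=; apply: eq_bigr => t _.
under [RHS]eq_bigr do rewrite mulr_suml.
rewrite [RHS]exchange_big/=; apply: eq_bigr => s _.
under [RHS]eq_bigr do rewrite mulr_suml.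
rewrite [RHS]exchange_big/=; apply: eq_bigr => u _.
by rewrite mulr_sumr; apply: eq_bigr => k _; rewrite mulrA.
Qed.

End mean_gamma_hat.

Definition b_vec {R : realType} (n M : nat) : 'cV[R]_M.+1 :=
  \col_(h < M.+1) (if h == 0%N :> nat then 1 else 2 * (1 - h%:R / n%:R)).

Definition beta_vec {R : realType} (n M : nat) : 'cV[R]_M.+1 :=
  invmx (Theta n M) *m b_vec n M.

Section statistic.
Context {R : realType} {d : measure_display} {T : measurableType d}.
Context (P : probability T R) {p : nat} (X : nat -> {RV P >-> p.-tuple R}).
Variables (n M : nat).

Definition tr_Omega_hat (w : T) : R :=
  ((beta_vec n M)^T *m gamma_hat X n M w) 0 0.

Definition Mstat (w : T) : R :=
  ((Xbar X n w)^T *m Xbar X n w) 0 0 - n%:R^-1 * tr_Omega_hat w.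

Definition var_Mstat : R := fine ('V_P[Mstat])%E.

Definition Tstat (Vhat : {RV P >-> R}) (w : T) : R :=
  Mstat w / Num.sqrt (Vhat w).

End statistic.

(* Since [x / 0 = 0], this forces var(M_n) <> 0 for all large n. *)
Definition ratio_consistent {R : realType} (d : nat -> measure_display)
    (T : forall n, measurableType (d n)) (P : forall n, probability (T n) R)
    (Vhat : forall n, {RV (P n) >-> R}) (v : nat -> R) : Prop :=
  forall e : R, 0 < e ->
    (fun n => P n [set w | e <= `|Vhat n w / v n - 1|]) @ \oo --> 0%E.

(* Main.v *)
Require Import Defs.
From HB Require Import structures.
From mathcomp Require Import all_boot all_order all_algebra.
From mathcomp Require Import complex spectral.
From mathcomp Require Import all_classical all_reals all_analysis.
From mathcomp Require Import measurable_realfun zify ring lra.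
Set Implicit Arguments.
Unset Strict Implicit.
Unset Printing Implicit Defensive.
Import Order.TTheory GRing.Theory Num.Theory.
Import numFieldNormedType.Exports.
Local Open Scope classical_set_scope.
Local Open Scope ring_scope.

(** Let [Z] be the centered sample mean, with covariance matrix [n^-1 Omega].
The statistic is [|mu|^2 + sqdev + remainder] ([MstatE]), where [sqdev] is
[|Z|^2 - tr Omega / n], of variance [2 tr (Omega^2) / n^2] ([sqdev_moments]),
and where the remainder consists of [2 mu^T Z] and of the error of the trace
estimator. Divided by the standard deviation of [sqdev], the term [|mu|^2] is
the noncentrality of the limiting power. It remains to show that the
standardized [sqdev] is asymptotically normal and that the remainder is
negligible: the variance of the statistic is then equivalent to that of [sqdev]
([variance_perturbation]), so that ratio consistency makes the studentization
asymptotically exact, and Slutsky's argument applies ([power_close],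
[power_at]). The noncentrality is an arbitrary sequence, so the normal
approximation has to be uniform in the argument.

Asymptotic normality. Diagonalizing [Omega] ([real_spectral]) writes the
standardized [sqdev] as a sum of centered squares of independent Gaussian
variables of variances [lam_i], with [sum lam_i^2 = 1/2] and with
[sum lam_i^4] a multiple of [tr (Omega^4) / (tr (Omega^2))^2], which tends to
zero by the condition on the traces ([tr_Omega4_le]). Its characteristic
function is computed by integrating out one square at a time
([sqsum_charfun]) and approaches that of the normal law. Smoothing by a narrow
normal kernel, whose density is an average of cosines, turns this into a lower
bound on the distribution function that is uniform in its argument
([charfun_close_cdf]).

The remainder. The variance of [2 mu^T Z] is [4 mu^T Omega mu / n]; the local
alternative controls it because
[2 |v^T A v| <= v^T (A A^T)^(1/2) v + v^T (A^T A)^(1/2) v]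
([bilinear_le_psd_sqrt]). The trace estimator is a quadratic form in the
sample. By Isserlis' formula its variance is of order [M^4 K / n] if [K] bounds
the squared Frobenius norms of the autocovariances ([quadratic_variance_le]),
and its bias is small because the matrix [Theta] is close to the identity
([beta_bias]). The condition on the traces allows
[K = sqrt p tr (Omega^2) / (M + 1)^2] ([frob_Gam_le]), so the relative size of
this error is of order [M^2 sqrt p / n], which tends to zero
([near_rates]). *)

(** * The real spectral theorem *)

Section spectral_theorem.
Variable R : rcfType.

(** A complex eigenvalue exists because [R[i]] is algebraically closed, and it
is real because it equals [v A v^* / v v^*], a quotient of hermitian values. *)
Lemma symmetric_eigenvector (n : nat) (A : 'M[R]_n.+1) : A^T = A ->
  exists a (v : 'rV_n.+1), v *m A = a *: v /\ v != 0.
Proof.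
move=> sA.
pose f : {rmorphism R -> R[i]} := @real_complex R.
have [z /eigenvalueP[v vA v0]] := eigenvalue_closed (map_mx f A) isT.
pose w : 'cV[R[i]]_n.+1 := (map_mx Num.conj v)^T.
have fconj x : Num.conj (f x) = f x.
  by apply/CrealP; rewrite complex_real.
have Aw : map_mx f A *m w = z^* *: w.
  have -> : map_mx f A = (map_mx f A)^T by rewrite map_trmx sA.
  rewrite /w -trmx_mul -[RHS]linearZ /=; congr trmx.
  have := congr1 (map_mx Num.conj) vA; rewrite map_mxM map_mxZ /= => <-.
  by congr (_ *m _); apply/matrixP => i j; rewrite !mxE fconj.
have vw0 : (v *m w) 0 0 != 0.
  rewrite mxE; apply: contraNneq v0 => /psumr_eq0P s0.
  apply/eqP/matrixP => i j; rewrite ord1 mxE; apply/eqP.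
  rewrite -normr_eq0 -sqrf_eq0 normCK; apply/eqP.
  have := s0 _ j isT; rewrite !mxE; apply => k _.
  by rewrite !mxE mul_conjC_ge0.
have zr : z^* = z.
  have : z *: (v *m w) = z^* *: (v *m w).
    by rewrite scalemxAl -vA -mulmxA Aw scalemxAr.
  move/matrixP/(_ 0 0); rewrite [LHS]mxE [RHS]mxE => e.
  by apply/esym; apply: (mulIf vw0).
have /complex_realP[a za] : z \is Num.real by apply/CrealP.
have : eigenvalue A a.
  rewrite eigenvalue_root_char -(fmorph_root f) map_char_poly.
  by rewrite -eigenvalue_root_char; apply/eigenvalueP; exists v; rewrite ?[f a]/= -?za.
by case/eigenvalueP => u uA u0; exists a, u.
Qed.

Definition dotr n (u v : 'rV[R]_n) : R := (u *m v^T) 0 0.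

Lemma dotrE n (u v : 'rV[R]_n) : dotr u v = \sum_j u 0 j * v 0 j.
Proof. by rewrite /dotr mxE; apply: eq_bigr => j _; rewrite mxE. Qed.

Lemma dotr_eq0 n (u : 'rV[R]_n) : (dotr u u == 0) = (u == 0).
Proof.
apply/eqP/eqP => [|->]; last by rewrite /dotr mul0mx mxE.
rewrite dotrE => /psumr_eq0P s0; apply/matrixP => i j; rewrite ord1 mxE.
by apply/eqP; rewrite -sqrf_eq0 expr2 s0// => k _; rewrite -expr2 sqr_ge0.
Qed.

Lemma dotr_ge0 n (u : 'rV[R]_n) : 0 <= dotr u u.
Proof. by rewrite dotrE sumr_ge0// => j _; rewrite -expr2 sqr_ge0. Qed.

(** The reflection in the hyperplane orthogonal to [e - q]. *)
Lemma householder n (e q : 'rV[R]_n) : dotr e e = dotr q q ->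
  exists H : 'M[R]_n, [/\ H^T = H, H *m H = 1%:M & e *m H = q].
Proof.
move=> eq_len; have [->|neq] := eqVneq e q.
  by exists 1%:M; rewrite trmx1 !mulmx1.
have [w wE] : exists w, w = e - q by exists (e - q).
have w0 : dotr w w != 0 by rewrite dotr_eq0 wE subr_eq0.
pose c := dotr w w.
have ww : w *m w^T = c%:M by rewrite [LHS]mx11_scalar.
exists (1%:M - (2 / c) *: (w^T *m w)); split.
- by rewrite linearB linearZ /= trmx1 trmx_mul trmxK.
- have WW : (w^T *m w) *m (w^T *m w) = c *: (w^T *m w).
    by rewrite mulmxA -(mulmxA w^T) ww mul_mx_scalar -scalemxAl.
  rewrite mulmxBl mul1mx mulmxBr mulmx1 -scalemxAl -scalemxAr WW !scalerA.
  rewrite -addrA -opprD -scalerBl -scalerDl.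
  suff -> : 2 / c + (2 / c - 2 / c * (2 / c) * c) = 0 by rewrite scale0r subr0.
  by field.
- rewrite mulmxBr mulmx1 -scalemxAr mulmxA.
  have -> : e *m w^T = (c / 2)%:M.
    rewrite [LHS]mx11_scalar; congr (_%:M); rewrite /c.
    have -> : dotr w w = dotr e e + dotr q q - 2 * dotr e q.
      rewrite !dotrE mulr_sumr -big_split -sumrB /=; apply: eq_bigr => j _.
      by rewrite wE !mxE; ring.
    rewrite -eq_len -/(dotr e w).
    have -> : dotr e w = dotr e e - dotr e q.
      by rewrite !dotrE -sumrB; apply: eq_bigr => j _; rewrite wE !mxE; ring.
    by field.
  rewrite mul_scalar_mx scalerA.
  have -> : 2 / c * (c / 2) = 1 by rewrite /c; field.
  by rewrite scale1r wE opprB addrC subrK.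
Qed.

(** Conjugating by a reflection that sends the first basis vector to a unit
eigenvector splits off a block of size one; the rest is an induction. *)
Theorem real_spectral (n : nat) (A : 'M[R]_n) : A^T = A ->
  exists (O : 'M[R]_n) (D : 'rV[R]_n),
    O *m O^T = 1%:M /\ A = O^T *m diag_mx D *m O.
Proof.
elim: n A => [|n IH] A sA.
  by exists 1%:M, 0; rewrite trmx1 mulmx1; split=> //; apply/matrixP => -[].
have [a [v [vA v0]]] := symmetric_eigenvector sA.
pose l := Num.sqrt (dotr v v).
have l2 : l ^+ 2 = dotr v v by rewrite sqr_sqrtr ?dotr_ge0.
have l0 : l != 0 by rewrite -sqrf_eq0 l2 dotr_eq0.
pose q := l^-1 *: v.
have qq : dotr q q = 1.
  have -> : dotr q q = l^-1 ^+ 2 * dotr v v.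
    by rewrite !dotrE mulr_sumr; apply: eq_bigr => j _; rewrite !mxE; ring.
  by rewrite -l2; field.
pose e : 'rV[R]_(1 + n) := row_mx 1%:M 0.
have ee : dotr e e = dotr q q.
  by rewrite qq /dotr tr_row_mx mul_row_col trmx1 mulmx1 mul0mx addr0 mxE eqxx.
have [H [sH HH eH]] := householder ee.
have qA : q *m A = a *: q.
  by rewrite /q -scalemxAl vA !scalerA mulrC.
have qH : q *m H = e by rewrite -eH -mulmxA HH mulmx1.
pose B : 'M[R]_(1 + n) := H *m A *m H.
have sB : B^T = B by rewrite /B !trmx_mul sA sH mulmxA.
have eB : e *m B = a *: e.
  by rewrite /B !mulmxA eH qA -scalemxAl qH.
have BE : B = block_mx a%:M 0 0 (drsubmx B).
  rewrite -{1}(submxK B); move: eB; rewrite -{1}(submxK B) /e.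
  rewrite mul_row_block !mul0mx !addr0 !mul1mx scale_row_mx scaler0.
  case/eq_row_mx => -> ur0.
  have dl0 : dlsubmx B = 0 by rewrite -sB -trmx_ursub ur0 trmx0.
  by rewrite ur0 dl0 scale_scalar_mx mulr1.
have sB' : (drsubmx B)^T = drsubmx B by rewrite trmx_drsub sB.
have [Q2 [D2 [QQ2 B'E]]] := IH _ sB'.
pose O1 : 'M[R]_(1 + n) := block_mx 1%:M 0 0 Q2.
have O1T : O1^T = block_mx 1%:M 0 0 Q2^T.
  by rewrite /O1 tr_block_mx trmx1 !trmx0.
have OO1 : O1 *m O1^T = 1%:M.
  rewrite O1T mulmx_block !mulmx0 !mul0mx !addr0 !add0r mulmx1 QQ2.
  by rewrite -scalar_mx_block.
pose D1 : 'rV[R]_(1 + n) := row_mx a%:M D2.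
have BD : B = O1^T *m diag_mx D1 *m O1.
  have -> : diag_mx D1 = block_mx a%:M 0 0 (diag_mx D2).
    rewrite diag_mx_row; congr block_mx.
    by apply/matrixP => i j; rewrite !ord1 !mxE eqxx.
  rewrite O1T BE B'E /O1 !mulmx_block !mulmx0 !mul0mx !addr0 !add0r.
  by rewrite !mul1mx !mulmx1 mul0mx.
have AB : A = H *m B *m H.
  by rewrite /B !mulmxA HH mul1mx -mulmxA HH mulmx1.
exists (O1 *m H), D1; split.
  by rewrite trmx_mul sH mulmxA -(mulmxA O1) HH mulmx1.
by rewrite AB BD trmx_mul sH !mulmxA.
Qed.

End spectral_theorem.

(** * Positive semidefinite square roots and Frobenius norms *)

Section psd.
Variable R : realType.
Implicit Types p : nat.

(** The square of the Frobenius norm. *)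
Definition frob p (A : 'M[R]_p) : R := \tr (A *m A^T).

Lemma frobE p (A : 'M[R]_p) : frob A = \sum_i \sum_j A i j ^+ 2.
Proof.
apply: eq_bigr => i _; rewrite mxE; apply: eq_bigr => j _.
by rewrite mxE expr2.
Qed.

Lemma frob_ge0 p (A : 'M[R]_p) : 0 <= frob A.
Proof. by rewrite frobE; do 2!apply: sumr_ge0 => ? _; rewrite sqr_ge0. Qed.

Lemma frob_eq0 p (A : 'M[R]_p) : frob A = 0 -> A = 0.
Proof.
rewrite frobE => A0; apply/matrixP => i j; rewrite mxE.
have {}A0 := psumr_eq0P (fun i _ => sumr_ge0 _ (fun j _ => sqr_ge0 (A i j))) A0.
have := psumr_eq0P (fun j _ => sqr_ge0 (A i j)) (A0 i isT).
by move=> /(_ j isT)/eqP; rewrite sqrf_eq0 => /eqP.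
Qed.

Lemma qformE p (A : 'M[R]_p) v :
  qform A v = \sum_i \sum_j v i 0 * A i j * v j 0.
Proof.
rewrite /qform mxE exchange_big; apply: eq_bigr => j _; rewrite mxE mulr_suml.
by apply: eq_bigr => i _; rewrite mxE.
Qed.

Lemma qform_conj p (A B : 'M[R]_p) (v : 'cV[R]_p) :
  qform (B^T *m A *m B) v = qform A (B *m v).
Proof. by rewrite /qform trmx_mul !mulmxA. Qed.

Lemma qform_diag p (D : 'rV[R]_p) v :
  qform (diag_mx D) v = \sum_i D 0 i * v i 0 ^+ 2.
Proof.
rewrite /qform mxE; apply: eq_bigr => i _.
by rewrite mul_mx_diag !mxE; ring.
Qed.

(** A vector of vanishing quadratic form lies in the kernel: otherwise moving
along [S v] would make the form negative. *)
Lemma psd_kernel p (S : 'M[R]_p) v : is_psd S -> qform S v = 0 -> S *m v = 0.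
Proof.
move=> [sS S0] v0.
have q t : qform S (S *m v + t *: v) =
    qform S (S *m v) + 2 * t * qform 1%:M (S *m v).
  have qD (A : 'M[R]_p) (x y : 'cV[R]_p) : qform A (x + y) =
      qform A x + qform A y + (x^T *m A *m y) 0 0 + (y^T *m A *m x) 0 0.
    rewrite /qform [(x + y)^T]linearD /= !mulmxDl !mulmxDr !mxE; ring.
  rewrite qD.
  have -> : qform S (t *: v) = t ^+ 2 * qform S v.
    by rewrite /qform [(t *: v)^T]linearZ /= -!scalemxAl -scalemxAr scalerA mxE expr2.
  rewrite v0 mulr0 addr0 [(t *: v)^T]linearZ /= -!scalemxAl -scalemxAr.
  have e1 : (S *m v)^T *m S *m v = (S *m v)^T *m 1%:M *m (S *m v).
    by rewrite mulmx1 mulmxA.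
  have e2 : v^T *m S *m (S *m v) = (S *m v)^T *m 1%:M *m (S *m v).
    by rewrite mulmx1 trmx_mul sS !mulmxA.
  by rewrite e1 e2 /qform [X in _ + X + _]mxE [X in _ + _ + X]mxE; ring.
have n0 : qform 1%:M (S *m v) = dotr (S *m v)^T (S *m v)^T.
  by rewrite /qform mulmx1 /dotr trmxK.
have : qform 1%:M (S *m v) = 0.
  apply/eqP; rewrite eq_le {2}n0 dotr_ge0 andbT leNgt; apply/negP => pos.
  pose t := - (qform S (S *m v) + 1) / (2 * qform 1%:M (S *m v)).
  have : 0 <= qform S (S *m v + t *: v) by apply: S0.
  rewrite q /t.
  have -> : 2 * (- (qform S (S *m v) + 1) / (2 * qform 1%:M (S *m v))) *
     qform 1%:M (S *m v) = - (qform S (S *m v) + 1) by field; rewrite gt_eqF.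
  lra.
by rewrite n0 => /eqP; rewrite dotr_eq0 trmx_eq0 => /eqP.
Qed.

Lemma psd_sandwich_eq0 p (S D : 'M[R]_p) : is_psd S ->
  \tr (D^T *m S *m D) <= 0 -> S *m D = 0.
Proof.
move=> pS; have E i : (D^T *m S *m D) i i = qform S (col i D).
  rewrite qformE mxE exchange_big /=; apply: eq_bigr => j _.
  by rewrite !mxE mulr_suml; apply: eq_bigr => k _; rewrite !mxE.
move=> tr0; apply/matrixP => j i; rewrite [RHS]mxE.
have q0 k : 0 <= (D^T *m S *m D) k k by rewrite E; apply: pS.2.
have {tr0} : \tr (D^T *m S *m D) = 0.
  by apply/eqP; rewrite eq_le tr0 sumr_ge0.
move=> /(psumr_eq0P (fun k _ => q0 k)) /(_ i isT); rewrite E => qi.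
by have /matrixP/(_ j 0) := psd_kernel pS qi; rewrite colE mulmxA -colE !mxE.
Qed.

(** With [D = S - S'], the equality [S^2 = S'^2] reads [D(S+S') + (S+S')D = 0];
multiplying by [D] and taking traces forces [SD = S'D = 0], hence [D^2 = 0]. *)
Lemma psd_sqrt_unique p (S1 S2 : 'M[R]_p) : is_psd S1 -> is_psd S2 ->
  S1 *m S1 = S2 *m S2 -> S1 = S2.
Proof.
move=> p1 p2 e; have [D DE] : exists D, D = S1 - S2 by exists (S1 - S2).
have sD : D^T = D by rewrite DE linearB /= p1.1 p2.1.
have anti : D *m (S1 + S2) + (S1 + S2) *m D = 0.
  rewrite DE !mulmxBl !mulmxBr !mulmxDl !mulmxDr e.
  by rewrite opprD !addrA; apply/matrixP => i j; rewrite !mxE; ring.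
have tr0 : \tr (D *m S1 *m D) + \tr (D *m S2 *m D) = 0.
  have : \tr (D *m (D *m (S1 + S2) + (S1 + S2) *m D)) = 0.
    by rewrite anti mulmx0 mxtrace0.
  have t S : \tr (D *m (D *m S)) = \tr (D *m S *m D) by rewrite mxtrace_mulC.
  rewrite mulmxDr mxtraceD t mulmxA (mulmxDr D S1) mulmxDl !mxtraceD; lra.
have ge0 S : is_psd S -> 0 <= \tr (D *m S *m D).
  move=> pS; apply: sumr_ge0 => i _.
  have -> : (D *m S *m D) i i = qform S (col i D); last exact: pS.2.
  rewrite qformE mxE exchange_big /=; apply: eq_bigr => j _.
  rewrite !mxE mulr_suml; apply: eq_bigr => k _; rewrite !mxE.
  by rewrite -{1}sD mxE.
have D1 : S1 *m D = 0.
  apply: psd_sandwich_eq0 => //; rewrite sD.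
  by have := ge0 _ p2; move: tr0; lra.
have D2 : S2 *m D = 0.
  apply: psd_sandwich_eq0 => //; rewrite sD.
  by have := ge0 _ p1; move: tr0; lra.
apply/eqP; rewrite -subr_eq0; apply/eqP; apply: frob_eq0.
by rewrite -DE /frob sD {1}DE mulmxBl D1 D2 subr0 mxtrace0.
Qed.

Lemma psd_sqrtE p (S A : 'M[R]_p) : is_psd S -> S *m S = A -> psd_sqrt A = S.
Proof.
move=> pS SA; rewrite /psd_sqrt.
have [|p1 e] := @xgetPex _ 0 [set S0 : 'M[R]_p | is_psd S0 /\ S0 *m S0 = A].
  by exists S.
by apply: psd_sqrt_unique => //; rewrite e SA.
Qed.

Lemma is_psd_gram p (A : 'M[R]_p) (D : 'rV[R]_p) : (forall i, 0 <= D 0 i) ->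
  is_psd (A^T *m diag_mx D *m A).
Proof.
move=> D0; split; first by rewrite !trmx_mul trmxK tr_diag_mx mulmxA.
move=> v; rewrite -/(qform _ v) qform_conj qform_diag.
by apply: sumr_ge0 => i _; rewrite mulr_ge0 ?sqr_ge0.
Qed.

(** With [A^T A = O^T diag(s^2) O], the two square roots are
[O^T diag(s) O] and [A O^T diag(1/s) O A^T], and [v^T A v] is the sum of
[(O A^T v)_i (O v)_i]; each term is bounded by the arithmetic-geometric mean
of the corresponding terms of the two quadratic forms. *)
Lemma bilinear_le_psd_sqrt p (A : 'M[R]_p) v :
  2 * `|qform A v| <=
  qform (psd_sqrt (A *m A^T)) v + qform (psd_sqrt (A^T *m A)) v.
Proof.
have sG : (A^T *m A)^T = A^T *m A by rewrite trmx_mul trmxK.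
have [Q [D [QQ GE]]] := real_spectral sG.
have QtQ : Q^T *m Q = 1%:M by apply: mulmx1C.
have D0 i : 0 <= D 0 i /\ D 0 i = \sum_j (Q *m A^T) i j ^+ 2.
  have -> : D 0 i = (Q *m (A^T *m A) *m Q^T) i i.
    by rewrite GE !mulmxA QQ mul1mx -mulmxA QQ mulmx1 !mxE eqxx.
  have -> : (Q *m (A^T *m A) *m Q^T) i i = \sum_j (Q *m A^T) i j ^+ 2.
    rewrite mulmxA -mulmxA mxE; apply: eq_bigr => j _.
    by rewrite -[A *m Q^T]trmxK trmx_mul trmxK [X in _ * X]mxE expr2.
  by split=> //; apply: sumr_ge0 => j _; rewrite sqr_ge0.
have [s [s0 s2]] : exists s : 'rV[R]_p,
    (forall i, 0 <= s 0 i) /\ (forall i, s 0 i ^+ 2 = D 0 i).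
  exists (\row_i Num.sqrt (D 0 i)); split=> i; rewrite mxE ?sqrtr_ge0//.
  by rewrite sqr_sqrtr//; case: (D0 i).
pose t := \row_i (s 0 i)^-1.
have S1E : psd_sqrt (A^T *m A) = Q^T *m diag_mx s *m Q.
  apply: psd_sqrtE; first exact: is_psd_gram.
  rewrite GE !mulmxA; congr (_ *m _); rewrite -(mulmxA (Q^T *m _)) QQ mulmx1.
  rewrite -mulmxA mulmx_diag; congr (_ *m diag_mx _).
  by apply/matrixP => i j; rewrite ord1 [LHS]mxE -expr2 s2.
have [B BE] : exists B, B = Q *m A^T by exists (Q *m A^T).
have B0 i : s 0 i = 0 -> forall j, B i j = 0.
  move=> si j; have [_ De] := D0 i.
  have : \sum_j (Q *m A^T) i j ^+ 2 = 0 by rewrite -De -s2 si expr0n.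
  rewrite -BE.
  move=> /(psumr_eq0P (fun k _ => sqr_ge0 _)) /(_ j isT) /eqP.
  by rewrite sqrf_eq0 => /eqP.
have BB : B *m B^T = diag_mx D.
  rewrite BE trmx_mul trmxK mulmxA -(mulmxA Q) GE !mulmxA QQ mul1mx.
  by rewrite -mulmxA QQ mulmx1.
have S2E : psd_sqrt (A *m A^T) = B^T *m diag_mx t *m B.
  apply: psd_sqrtE; first by apply: is_psd_gram => i; rewrite mxE invr_ge0.
  have -> : B^T *m diag_mx t *m B *m (B^T *m diag_mx t *m B) =
     B^T *m (diag_mx t *m (B *m B^T) *m diag_mx t *m B) by rewrite !mulmxA.
  rewrite BB !mulmx_diag.
  have -> : A *m A^T = B^T *m B.
    by rewrite BE trmx_mul trmxK mulmxA -(mulmxA A) QtQ mulmx1.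
  congr (_ *m _); apply/matrixP => i j; rewrite mul_diag_mx !mxE.
  have [si|si] := eqVneq (s 0 i) 0; first by rewrite B0 ?mulr0.
  by rewrite -s2; field.
have AE : qform A v = \sum_i (B *m v) i 0 * (Q *m v) i 0.
  have -> : A = B^T *m Q by rewrite BE trmx_mul trmxK -mulmxA QtQ mulmx1.
  rewrite /qform mulmxA -trmx_mul -mulmxA mxE.
  by apply: eq_bigr => i _; rewrite mxE.
rewrite S1E S2E !qform_conj !qform_diag AE.
apply: le_trans (_ : 2 * (\sum_i `|(B *m v) i 0 * (Q *m v) i 0|) <= _).
  by rewrite ler_wpM2l// ler_norm_sum.
rewrite mulr_sumr -big_split /=; apply: ler_sum => i _.
set x := (B *m v) i 0; set y := (Q *m v) i 0.
have -> : t 0 i = (s 0 i)^-1 by rewrite mxE.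
have [si|si] := eqVneq (s 0 i) 0.
  have -> : x = 0 by rewrite /x mxE big1// => j _; rewrite B0// mul0r.
  by rewrite si mul0r normr0 mulr0 mul0r expr0n mulr0 addr0.
have {}si : 0 < s 0 i by rewrite lt_def si s0.
have -> : (s 0 i)^-1 * x ^+ 2 + s 0 i * y ^+ 2 =
  2 * `|x * y| + (s 0 i)^-1 * (`|x| - s 0 i * `|y|) ^+ 2.
  rewrite -(real_normK (num_real x)) -(real_normK (num_real y)) normrM.
  by field; rewrite gt_eqF.
by rewrite lerDl mulr_ge0 ?sqr_ge0// invr_ge0 ltW.
Qed.

(** The difference of the two sides is half the sum of all
[(f i - f j) ^+ 2]. *)
Lemma sqr_sum_le p (f : 'I_p -> R) :
  (\sum_i f i) ^+ 2 <= p%:R * \sum_i f i ^+ 2.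
Proof.
have : 0 <= \sum_(i < p) \sum_(j < p) (f i - f j) ^+ 2.
  by do 2!apply: sumr_ge0 => ? _; rewrite sqr_ge0.
have -> : \sum_(i < p) \sum_(j < p) (f i - f j) ^+ 2 =
   2 * (p%:R * (\sum_i f i ^+ 2) - (\sum_i f i) ^+ 2).
  transitivity (\sum_(i < p) (p%:R * f i ^+ 2 + \sum_j f j ^+ 2
      - 2 * (f i * \sum_j f j))).
    apply: eq_bigr => i _.
    transitivity (\sum_(j < p) (f i ^+ 2 + f j ^+ 2 - 2 * (f i * f j))).
      by apply: eq_bigr => j _; ring.
    rewrite !big_split /= sumrN -!mulr_sumr sumr_const card_ord.
    by rewrite -[f i *+ p]mulr_natl; ring.

  rewrite !big_split /= sumrN -!mulr_sumr -mulr_suml sumr_const card_ord.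
  by rewrite -mulr_natl; ring.
by rewrite pmulr_rge0// subr_ge0.
Qed.

Lemma tr_sqr_le p (S : 'M[R]_p) : (\tr S) ^+ 2 <= p%:R * frob S.
Proof.
apply: le_trans (sqr_sum_le _) _; rewrite ler_wpM2l// frobE.
apply: ler_sum => i _; rewrite (bigD1 i)//= lerDl.
by apply: sumr_ge0 => j _; rewrite sqr_ge0.
Qed.

(** This is how a bound on the trace of a product of four autocovariances
becomes a bound on each autocovariance, at the price of the dimension. *)
Lemma frob_sqr_le p (A : 'M[R]_p) :
  frob A ^+ 2 <= p%:R * \tr (A *m A^T *m A *m A^T).
Proof.
apply: le_trans (tr_sqr_le _) _.
by rewrite /frob trmx_mul trmxK !mulmxA.
Qed.

Lemma tr_mul_le p (A B : 'M[R]_p) : `|\tr (A *m B^T)| <= (frob A + frob B) / 2.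
Proof.
rewrite ler_pdivlMr// mulrC -[2]ger0_norm// -normrM ler_norml !frobE.
have -> : \tr (A *m B^T) = \sum_i \sum_j A i j * B i j.
  apply: eq_bigr => i _; rewrite mxE; apply: eq_bigr => j _.
  by rewrite mxE.
rewrite mulr_sumr -big_split -sumrN /=; apply/andP; split.
  apply: ler_sum => i _; rewrite mulr_sumr -big_split -sumrN /=.
  apply: ler_sum => j _; have := sqr_ge0 (A i j + B i j); lra.
apply: ler_sum => i _; rewrite mulr_sumr -big_split /=.
apply: ler_sum => j _; have := sqr_ge0 (A i j - B i j); lra.
Qed.

End psd.

(** * Expectations *)

Section expectation.
Context {R : realType} {d : measure_display} {T : measurableType d}.
Variable P : probability T R.
Implicit Types (f g : T -> R) (u v : R).

(** Integrability and the value of the expectation in one statement, so that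
linear combinations of expectations carry no side conditions. *)
Definition hasE f v : Prop :=
  P.-integrable setT (EFin \o f) /\ (\int[P]_w f w)%R = v.

Definition L1 f := P.-integrable setT (EFin \o f).
Definition Ex f : R := (\int[P]_w f w)%R.

Lemma hasE_Ex f : L1 f -> hasE f (Ex f). Proof. by []. Qed.
Lemma hasE_eq f v : hasE f v -> Ex f = v. Proof. by case. Qed.
Lemma hasE_L1 f v : hasE f v -> L1 f. Proof. by case. Qed.

Lemma hasE_ext f g v : f =1 g -> hasE f v -> hasE g v.
Proof. by move=> /funext <-. Qed.

Lemma L1_meas f : L1 f -> measurable_fun setT f.
Proof. by case/integrableP => /measurable_EFinP. Qed.

Lemma hasE_integral f v : hasE f v -> (\int[P]_w (f w)%:E)%E = v%:E.
Proof.
case=> fL <-; rewrite /Rintegral fineK//.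
exact: (integrable_fin_num measurableT fL).
Qed.

Lemma hasED f g u v : hasE f u -> hasE g v -> hasE (fun w => f w + g w) (u + v).
Proof.
move=> [fL <-] [gL <-]; split; last by rewrite RintegralD.
have := integrableD measurableT fL gL.
by apply: eq_integrable => // w _ /=; rewrite EFinD.
Qed.

Lemma hasEZ a f v : hasE f v -> hasE (fun w => a * f w) (a * v).
Proof.
move=> [fL <-]; split; last by rewrite RintegralZl.
have := integrableZl measurableT a fL.
by apply: eq_integrable => // w _ /=; rewrite EFinM.
Qed.

Lemma hasEN f v : hasE f v -> hasE (fun w => - f w) (- v).
Proof.
by move=> /(hasEZ (-1)); rewrite mulN1r; apply: hasE_ext => w; rewrite mulN1r.
Qed.

Lemma hasEB f g u v : hasE f u -> hasE g v -> hasE (fun w => f w - g w) (u - v).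
Proof. by move=> fu /hasEN; apply: hasED. Qed.

Lemma hasE_cst v : hasE (fun=> v) v.
Proof.
split; first exact: finite_measure_integrable_cst.
by rewrite Rintegral_cst//= probability_setT mulr1.
Qed.

Lemma hasE_sum (I : Type) (r : seq I) (f : I -> T -> R) (v : I -> R) :
  (forall i, hasE (f i) (v i)) ->
  hasE (fun w => \sum_(i <- r) f i w) (\sum_(i <- r) v i).
Proof.
move=> fv; elim: r => [|i r IH].
  by rewrite big_nil; apply: hasE_ext (hasE_cst 0) => w; rewrite big_nil.
rewrite big_cons; apply: hasE_ext (hasED (fv i) IH) => w.
by rewrite big_cons.
Qed.

Lemma hasE_le f g u v : hasE f u -> hasE g v -> (forall w, f w <= g w) -> u <= v.
Proof. by move=> [fL <-] [gL <-] fg; apply: le_Rintegral. Qed.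

Lemma hasE_ge0 f v : hasE f v -> (forall w, 0 <= f w) -> 0 <= v.
Proof. by move=> [_ <-] f0; apply: Rintegral_ge0. Qed.

Lemma hasE_uniq f u v : hasE f u -> hasE f v -> u = v.
Proof. by move=> [_ <-] [_ <-]. Qed.

Lemma L1_le f g : measurable_fun setT f -> L1 g -> (forall w, `|f w| <= g w) ->
  L1 f.
Proof.
move=> mf gL fg; apply: le_integrable gL => //; first exact/measurable_EFinP.
by move=> w _ /=; rewrite lee_fin (le_trans (fg w))// ler_norm.
Qed.

Lemma L1_bounded C f : measurable_fun setT f -> (forall w, `|f w| <= C) -> L1 f.
Proof. by move=> mf; apply: L1_le => //; exact: (hasE_L1 (hasE_cst C)). Qed.

Lemma hasE_norm_le f g u v : hasE f u -> hasE g v -> (forall w, `|f w| <= g w) ->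
  `|u| <= v.
Proof.
move=> fu gv fg; rewrite ler_norml; apply/andP; split.
  by apply: hasE_le (hasEN gv) fu _ => w; have := fg w; rewrite ler_norml => /andP[].
by apply: hasE_le fu gv _ => w; have := fg w; rewrite ler_norml => /andP[].
Qed.

Lemma L1D f g : L1 f -> L1 g -> L1 (fun w => f w + g w).
Proof. by move=> fL gL; exact: hasE_L1 (hasED (hasE_Ex fL) (hasE_Ex gL)). Qed.

Lemma hasE_of_integral f v : L1 f -> (\int[P]_w (f w)%:E)%E = v%:E -> hasE f v.
Proof. by move=> fL e; split=> //; rewrite /Rintegral e. Qed.

Lemma hasE_indic A : measurable A -> hasE \1_A (fine (P A)).
Proof.
move=> mA; apply: hasE_of_integral.
  by apply: (@L1_bounded 1) => // w; rewrite indicE; case: (_ \in _); rewrite ?normr0 ?normr1.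
rewrite integral_indic// setIT fineK//; exact: fin_num_measure.
Qed.

Lemma hasE_le_prob f v A : hasE f v -> measurable A ->
  (forall w, f w <= \1_A w) -> v <= fine (P A).
Proof. by move=> fv mA; apply: hasE_le fv (hasE_indic mA). Qed.

Lemma prob_le_hasE f v A : hasE f v -> measurable A ->
  (forall w, \1_A w <= f w) -> fine (P A) <= v.
Proof. by move=> fv mA; apply: hasE_le (hasE_indic mA) fv. Qed.

End expectation.

(** * Integration against a normal law *)

Section normal_integral.
Context {R : realType}.
Variables (m s : R).
Hypothesis s0 : s != 0.
Local Notation mu := (@lebesgue_measure R).
Local Notation N := (normal_prob m s).

Lemma ge0_integral_normal_prob (f : R -> R) : (forall x, 0 <= f x) ->
  measurable_fun setT f ->
  (\int[N]_x (f x)%:E = \int[mu]_x (f x * normal_pdf m s x)%:E)%E.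
Proof.
move=> f0 mf.
have dom := normal_prob_dominates m s.
have mfE : measurable_fun setT (EFin \o f) by exact/measurable_EFinP.
have mpdf := measurable_normal_pdf m s.
have mRN := measurable_int _ (Radon_Nikodym_SigmaFinite.f_integrable dom).
rewrite -(Radon_Nikodym_SigmaFinite.change_of_variables dom (f := EFin \o f))//.
apply: ae_eq_integral => //.
- exact: emeasurable_funM.
- by apply/measurable_EFinP; exact: measurable_funM.
rewrite [X in ae_eq _ _ _ X](_ : _ =
    (fun x => (f x)%:E * (normal_pdf m s x)%:E)%E); last first.
  by apply/funext => x; rewrite EFinM.
apply: ae_eqe_mul2l.
apply: integral_ae_eq => //=.
- exact: Radon_Nikodym_SigmaFinite.f_integrable.
- exact/measurable_EFinP.
- by move=> E _ mE; rewrite -Radon_Nikodym_SigmaFinite.f_integral.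
Qed.

Lemma L1_normalP (f : R -> R) : measurable_fun setT f ->
  L1 N f <-> mu.-integrable setT (EFin \o (fun x => f x * normal_pdf m s x)).
Proof.
move=> mf.
have mg : measurable_fun setT (fun x => f x * normal_pdf m s x).
  by apply: measurable_funM => //; exact: measurable_normal_pdf.
have E : (\int[N]_x `|(EFin \o f) x| =
  \int[mu]_x `|(EFin \o (fun x => f x * normal_pdf m s x)%R) x|)%E.
  have := ge0_integral_normal_prob (fun x => normr_ge0 (f x)) _.
  move=> /(_ (measurableT_comp _ mf)) => -> //.
  apply: eq_integral => x _ /=; congr EFin.
  by rewrite normrM [`|normal_pdf _ _ _|]ger0_norm ?normal_pdf_ge0.
split=> /integrableP[_ fin]; apply/integrableP; split;
  by [exact/measurable_EFinP | rewrite ?E// -E].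
Qed.

(** The nonnegative case applies to [f + |f|] and to [|f|]. *)
Lemma hasE_normal (f : R -> R) :
  measurable_fun setT f ->
  mu.-integrable setT (EFin \o (fun x => f x * normal_pdf m s x)) ->
  hasE N f (\int[mu]_x (f x * normal_pdf m s x))%R.
Proof.
move=> mf fL; have fN := (L1_normalP mf).2 fL.
have L (g : R -> R) : measurable_fun setT g -> (forall x, 0 <= g x) -> L1 N g ->
    hasE N g (\int[mu]_x (g x * normal_pdf m s x))%R.
  move=> mg g0 gN; split=> //; rewrite /Rintegral.
  by rewrite ge0_integral_normal_prob.
have mn : measurable_fun setT (fun x => `|f x|) by exact: measurableT_comp.
have nN : L1 N (fun x => `|f x|) by exact: integrable_norm.
have sN : L1 N (fun x => f x + `|f x|) by exact: L1D.
have En := L _ mn (fun x => normr_ge0 _) nN.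
have Es : hasE N (fun x => f x + `|f x|)
    (\int[mu]_x ((f x + `|f x|) * normal_pdf m s x))%R.
  apply: L => //; first exact: measurable_funD.
  by move=> x; have := ler_norm (- f x); rewrite normrN -lerBlDl sub0r.
have := hasEB Es En; set v := (X in hasE _ _ X).
suff -> : v = (\int[mu]_x (f x * normal_pdf m s x))%R.
  by apply: hasE_ext => x; rewrite addrK.
have nL := (L1_normalP mn).1 nN.
have sL := (L1_normalP (L1_meas sN)).1 sN.
rewrite /v -RintegralB//; apply: eq_Rintegral => x _.
by rewrite -mulrBl addrK.
Qed.

End normal_integral.

Section ibp.
Context {R : realType}.
Variables (m s : R).
Hypothesis s0 : s != 0.
Local Notation mu := (@lebesgue_measure R).
Local Notation N := (normal_prob m s).

Lemma is_derive_normal_pdf (x : R) :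
  is_derive x 1 (normal_pdf m s) (- ((x - m) / s ^+ 2) * normal_pdf m s x).
Proof.
rewrite normal_pdfE// /normal_fun.
have D1 : is_derive x 1 (fun y : R => - (y - m) ^+ 2 / (s ^+ 2 *+ 2))
    (- ((x - m) / s ^+ 2)).
  apply: is_derive_eq.
  rewrite !scaler0 /GRing.scale /=; field.
  by rewrite s0.
have D2 := @is_derive1_comp _ expR _ x _ _ (is_derive_expR _) D1.
have D3 := is_deriveZ (normal_peak s) D2.
apply: is_derive_eq D3 _.
by rewrite /GRing.scale /=; ring.
Qed.

(** Polynomial weights are absorbed by doubling the standard deviation. *)
Lemma weight_normal_pdf_le k : exists C, forall x,
  (1 + (x - m) ^+ 2) ^+ k * normal_pdf m s x <= C * normal_pdf m (2 * s) x.
Proof.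
have s20 : 2 * s != 0 by rewrite mulf_neq0.
have ss : 0 < s ^+ 2 by rewrite exprn_even_gt0.
pose b := (1 + 4 * s ^+ 2 * k%:R)^-1.
have k0 : 0 <= 4 * s ^+ 2 * k%:R by apply: mulr_ge0 => //; apply: mulr_ge0 => //; exact: ltW.
have d0 : 0 < 1 + 4 * s ^+ 2 * k%:R by rewrite ltr_wpDr.
have b0 : 0 < b by rewrite invr_gt0.
have b1 : b <= 1 by rewrite invf_le1// lerDl.
exists (b^-1 ^+ k * (normal_peak s / normal_peak (2 * s))) => x.
rewrite !normal_pdfE// /normal_fun; set y := x - m.
have p2 : 0 < normal_peak (2 * s) by exact: normal_peak_gt0.
have p1 : 0 <= normal_peak s by exact: normal_peak_ge0.
set e1 := expR _; set e2 := expR _.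
have -> : b^-1 ^+ k * (normal_peak s / normal_peak (2 * s)) *
    (normal_peak (2 * s) * e2) = normal_peak s * (b^-1 ^+ k * e2).
  by field; rewrite gt_eqF.
rewrite mulrCA; apply: ler_wpM2l => //; rewrite /e1 /e2.
have le0 : 1 + y ^+ 2 <= b^-1 * expR (b * y ^+ 2).
  rewrite ler_pdivlMl// (le_trans _ (expR_ge1Dx _))//.
  by rewrite mulrDr mulr1 lerD2r.
have le1 : (1 + y ^+ 2) ^+ k <= b^-1 ^+ k * expR (k%:R * (b * y ^+ 2)).
  rewrite expRM_natl -exprMn lerXn2r// nnegrE ?addr_ge0 ?sqr_ge0//.
  by rewrite mulr_ge0 ?expR_ge0// invr_ge0 ltW.
apply: le_trans (ler_wpM2r (expR_ge0 _) le1) _.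
rewrite -mulrA ler_wpM2l//; first by rewrite exprn_ge0// invr_ge0 ltW.
rewrite -expRD ler_expR.
have kb : k%:R * b <= (4 * s ^+ 2)^-1.
  have q0 : 0 < 4 * s ^+ 2 by exact: mulr_gt0.
  rewrite ler_pdivrMr// mulrDr mulr1 mulKf ?(gt_eqF q0)//.
  by rewrite lerDr invr_ge0 ltW.
have -> : - y ^+ 2 / ((2 * s) ^+ 2 *+ 2) = - y ^+ 2 * (8 * s ^+ 2)^-1.
  by congr (_ * _^-1); rewrite exprMn -mulr_natr; ring.
have -> : - y ^+ 2 / (s ^+ 2 *+ 2) = - y ^+ 2 * (4 * (8 * s ^+ 2)^-1).
  congr (_ * _); rewrite -mulr_natr; field; exact: s0.
have {}kb : k%:R * b <= 2 * (8 * s ^+ 2)^-1.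
  by apply: le_trans kb _; rewrite le_eqVlt; apply/orP; left; apply/eqP; field; exact: s0.
have : 0 <= (8 * s ^+ 2)^-1 by rewrite invr_ge0 mulr_ge0// ltW.
have := sqr_ge0 y; move: kb; set u := (8 * _)^-1; set v := y ^+ 2.
set w := k%:R * b => wu v0 u0.
have : w * v <= 2 * u * v by rewrite ler_wpM2r.
have := mulr_ge0 u0 v0; rewrite /w; lra.
Qed.

Lemma integrable_normal_weight (h : R -> R) C k : measurable_fun setT h ->
  (forall x, `|h x| <= C * (1 + (x - m) ^+ 2) ^+ k) ->
  mu.-integrable setT (EFin \o (fun x => h x * normal_pdf m s x)).
Proof.
move=> mh hC; have [D HD] := weight_normal_pdf_le k.
have C0 : 0 <= C.
  have := hC m; rewrite subrr expr0n addr0 expr1n mulr1.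
  by apply: le_trans.
have := integrableZl measurableT (C * D) (integrable_normal_pdf m (2 * s)).
apply: le_integrable => //.
  apply/measurable_EFinP; apply: measurable_funM => //.
  exact: measurable_normal_pdf.
move=> x _ /=; rewrite lee_fin normrM [`|normal_pdf _ _ _|]ger0_norm ?normal_pdf_ge0//.
apply: le_trans (ler_wpM2r (normal_pdf_ge0 _ _ _) (hC x)) _.
rewrite -mulrA; apply: le_trans (ler_wpM2l C0 (HD x)) _.
by rewrite mulrA ler_norm.
Qed.

Lemma continuous_meas (f : R -> R) : continuous f -> measurable_fun setT f.
Proof. exact: continuous_measurable_fun. Qed.

Lemma derive_continuous (F F' : R -> R) :
  (forall x : R, is_derive x 1 F (F' x)) -> continuous F.
Proof.
move=> dF x; apply: differentiable_continuous.
by apply/derivable1_diffP; apply: @ex_derive (dF x).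
Qed.

(** The integral over [[- n, n]] is [G n - G (- n)], which tends to zero because
[G] decays quadratically; dominated convergence passes to the whole line. *)
Lemma integral_derive_eq0 (G g : R -> R) K :
  (forall x : R, is_derive x 1 G (g x)) -> continuous g ->
  mu.-integrable setT (EFin \o g) ->
  (forall x, `|G x| * (1 + (x - m) ^+ 2) <= K) ->
  (\int[mu]_x (g x)%:E)%E = 0%E.
Proof.
move=> dG cg ig GK.
pose I n := `[- n.+1%:R, n.+1%:R : R]%classic.
have K0 : 0 <= K by apply: le_trans (GK m); rewrite mulr_ge0// addr_ge0// sqr_ge0.
have ftc n : (\int[mu]_(x in I n) (g x)%:E = (G n.+1%:R)%:E - (G (- n.+1%:R))%:E)%E.
  apply: continuous_FTC2.
  - by rewrite gtrN.
  - exact: continuous_subspaceT.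
  - split.
    + by move=> x _; apply: @ex_derive (dG x).
    + exact/cvg_at_right_filter/(derive_continuous dG).
    + exact/cvg_at_left_filter/(derive_continuous dG).
  - by move=> x _; rewrite derive1E; apply: @derive_val (dG x).
have mg : measurable_fun setT g by exact: continuous_meas.
have mI n : measurable (I n) by exact: measurable_itv.
have [||||| _ _] := @dominated_convergence _ _ R mu setT measurableT
  (fun n x => ((EFin \o g) \_ (I n)) x) (EFin \o g) (fun x => `|(g x)%:E|%E).
- move=> n; apply/(measurable_restrictT _ (mI n)).
  by apply/measurable_EFinP; exact: measurable_funTS.
- exact/measurable_EFinP.
- apply: aeW => x _; apply: cvg_near_cst; near=> n.
  rewrite patchE mem_set// /I /= in_itv /= -ler_norml.
  near: n; have [M _ HM] := nbhs_infty_ger `|x|.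
  exists M => // n Mn; apply: le_trans (HM n Mn) _.
  by rewrite ler_nat.
- exact: (integrable_abse ig).
- apply: aeW => x n _; rewrite patchE; case: ifP => // _.
  by rewrite abse0 lee_fin.
set J := (\int[mu]_x _)%E.
have Jfin : J \is a fin_num by exact: (integrable_fin_num measurableT ig).
move=> cvJ; rewrite -[RHS]/(0%:E).
suff : (fun n => \int[mu]_x ((EFin \o g) \_ (I n)) x)%E @ \oo --> 0%E.
  by move=> c0; apply: cvg_unique cvJ c0.
under eq_fun => n do rewrite -integral_mkcond ftc -EFinB.
apply: cvg_EFin; first by apply: nearW.
apply/cvgrPdist_le => e e0 /=; near=> n; rewrite sub0r normrN.
have [n1 n2] : K / (e / 2) <= `|n.+1%:R - m| /\ K / (e / 2) <= `|- n.+1%:R - m|.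
  have H : K / (e / 2) + `|m| <= n%:R by near: n; exact: nbhs_infty_ger.
  have H2 : n.+1%:R = n%:R + 1 :> R by rewrite -natr1.
  split.
    apply: le_trans (ler_norm _); have := ler_norm m; lra.
  rewrite -normrN opprB opprK; apply: le_trans (ler_norm _).
  by have := ler_norm (- m); rewrite normrN; lra.
have half x : K / (e / 2) <= `|x - m| -> `|G x| <= e / 2.
  rewrite ler_pdivrMr ?divr_gt0// => h.
  have := GK x; have := normr_ge0 (G x); move: h.
  rewrite -(real_normK (num_real (x - m))); set a := `|x - m|; set c := `|G x|.
  move=> h c0 h2; rewrite leNgt; apply/negP => h3.
  have : a <= 1 + a ^+ 2 by have := sqr_ge0 (a - 1); have := sqr_ge0 a; lra.
  have a0 : 0 <= a by rewrite normr_ge0.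
  nra.
apply: le_trans (ler_normB _ _) _.
by have := half _ n1; have := half _ n2; lra.
Unshelve. all: by end_near. Qed.

End ibp.

(** * Gaussian moments and characteristic functions *)

Section transfer.
Context {R : realType} {d d' : measure_display}.
Context {T : measurableType d} {T' : measurableType d'}.
Variables (P : probability T R) (Q : probability T' R) (Z : T -> T').
Hypothesis mZ : measurable_fun setT Z.
Hypothesis lawZ : forall B, measurable B -> P (Z @^-1` B) = Q B.

Let mZ_mixin := isMeasurableFun.Build _ _ _ _ _ mZ.
Let Zf : {mfun T >-> T'} := HB.pack Z mZ_mixin.

Lemma hasE_transfer (h : T' -> R) v : hasE Q h v -> hasE P (h \o Z) v.
Proof.
move=> hv; have hL := hasE_L1 hv.
have mh : measurable_fun setT h := L1_meas hL.
have mhZ : measurable_fun setT (h \o Z) by exact: measurableT_comp.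
have push (g : T' -> \bar R) :
    (\int[Q]_y g y = \int[pushforward P Zf]_y g y)%E.
  by apply: eq_measure_integral => A mA _; exact: (esym (lawZ mA)).
have hZL : L1 P (h \o Z).
  move/integrableP : (hL) => [_]; rewrite push ge0_integral_pushforward//.
    rewrite preimage_setT => fin; apply/integrableP; split=> //.
    exact/measurable_EFinP.
  by apply: measurableT_comp => //; exact/measurable_EFinP.
apply: hasE_of_integral => //.
rewrite -(hasE_integral hv) push (@integral_pushforward _ _ _ _ _ Z)//.
exact/measurable_EFinP.
Qed.

End transfer.

Section gaussian_moments.
Context {R : realType}.
Variables (m s : R).
Hypothesis s0 : s != 0.
Local Notation mu := (@lebesgue_measure R).
Local Notation N := (normal_prob m s).

(** The function [F * pdf] vanishes at infinity and has derivative
[F' * pdf - (x - m) / s^2 * F * pdf], whose integral is therefore zero. *)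
Lemma normal_ibp (F F' : R -> R) C k v :
  (forall x : R, is_derive x 1 F (F' x)) -> continuous F' ->
  (forall x, `|F x| <= C * (1 + (x - m) ^+ 2) ^+ k) ->
  (forall x, `|F' x| <= C * (1 + (x - m) ^+ 2) ^+ k) ->
  hasE N F' v -> hasE N (fun x => (x - m) * F x) (s ^+ 2 * v).
Proof.
move=> dF cF' FC F'C hv.
have cF := derive_continuous dF.
have mF := continuous_meas cF.
have mF' := continuous_meas cF'.
have w1 (x : R) : 1 <= 1 + (x - m) ^+ 2 by rewrite lerDl sqr_ge0.
have w0 (x : R) : 0 <= 1 + (x - m) ^+ 2 by apply: le_trans (w1 x).
have C0 : 0 <= C.
  have := F'C m; rewrite subrr expr0n addr0 expr1n mulr1.
  by apply: le_trans.
have yw (x : R) : `|x - m| <= 1 + (x - m) ^+ 2.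
  rewrite -(real_normK (num_real (x - m))); set a := `|x - m|.
  by have := sqr_ge0 (a - 1); have : 0 <= a := normr_ge0 _; nra.
have yFC x : `|(x - m) * F x| <= C * (1 + (x - m) ^+ 2) ^+ k.+1.
  by rewrite normrM exprS mulrCA; apply: ler_pM.
have cy : continuous (fun x : R => x - m).
  by move=> x; apply: cvgB; [exact: cvg_id|exact: cvg_cst].
have cyF : continuous (fun x : R => (x - m) * F x).
  by move=> x; apply: cvgM; [exact: cy|exact: cF].
have myF := continuous_meas cyF.
have I1 := integrable_normal_weight s0 mF' F'C.
have I2 := integrable_normal_weight s0 myF yFC.
have E1 := hasE_normal mF' I1.
have E2 := hasE_normal myF I2.
have cp := @continuous_normal_pdf _ m s s0.
pose g x := F' x * normal_pdf m s x -
  (s ^+ 2)^-1 * ((x - m) * F x * normal_pdf m s x).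
have dG (x : R) : is_derive x 1 (fun x => F x * normal_pdf m s x) (g x).
  apply: is_derive_eq (is_deriveM (dF x) (is_derive_normal_pdf m s0 x)) _.
  rewrite /g /GRing.scale /=.
  by field; rewrite s0.
have cg : continuous g.
  move=> x; apply: cvgB; first by apply: cvgM; [exact: cF'|exact: cp].
  apply: cvgM; first exact: cvg_cst.
  by apply: cvgM; [exact: cyF|exact: cp].
have ig1 : mu.-integrable setT
    (EFin \o (fun x => (s ^+ 2)^-1 * ((x - m) * F x * normal_pdf m s x))).
  have := integrableZl measurableT (s ^+ 2)^-1 I2.
  by apply: eq_integrable => // x _ /=; rewrite EFinM.
have ig : mu.-integrable setT (EFin \o g).
  have := integrableB measurableT I1 ig1.
  by apply: eq_integrable => // x _ /=; rewrite EFinB.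
have [D HD] := weight_normal_pdf_le m s0 k.+1.
have dec x : `|F x * normal_pdf m s x| * (1 + (x - m) ^+ 2) <=
    C * (`|D| * normal_peak (2 * s)).
  rewrite normrM [`|normal_pdf _ _ _|]ger0_norm ?normal_pdf_ge0//.
  apply: (@le_trans _ _ (C * ((1 + (x - m) ^+ 2) ^+ k.+1 * normal_pdf m s x))).
    have := FC x; have := w0 x; have := normal_pdf_ge0 m s x.
    set W := 1 + _; set q := normal_pdf m s x => q0 W0 h.
    rewrite -mulrA (_ : C * _ = C * W ^+ k * (q * W)); last by rewrite exprS; ring.
    by apply: ler_wpM2r => //; exact: mulr_ge0.
  apply: ler_wpM2l => //; apply: le_trans (HD x) _.
  apply: le_trans (ler_wpM2r (normal_pdf_ge0 _ _ _) (ler_norm D)) _.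
  by apply: ler_wpM2l => //; apply: normal_pdf_ub; rewrite mulf_neq0.
have := integral_derive_eq0 dG cg ig dec.
move=> g0; have : (\int[mu]_x g x)%R = 0 by rewrite /Rintegral g0.
rewrite /g RintegralB// RintegralZl//.
move: E2; rewrite (hasE_uniq E1 hv) => E2.
move=> /eqP; rewrite subr_eq0 => /eqP ve.
by rewrite ve mulVKf// expf_neq0.
Qed.

Let pw (x : R) j k : (j <= k.*2)%N ->
  `|(x - m) ^+ j| <= 1 * (1 + (x - m) ^+ 2) ^+ k.
Proof.
move=> jk; rewrite mul1r normrX; set a := `|x - m|.
have a0 : 0 <= a by exact: normr_ge0.
have -> : (x - m) ^+ 2 = a ^+ 2 by rewrite real_normK ?num_real.
have h : a ^+ 2 <= 1 + a ^+ 2 by rewrite lerDr.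
have h1 : 1 <= 1 + a ^+ 2 by rewrite lerDl sqr_ge0.
have [a1|a1] := leP a 1.
  by apply: le_trans (exprn_ile1 _ _ _) _ => //; exact: exprn_ege1.
apply: (@le_trans _ _ (a ^+ k.*2)); first by apply: ler_weXn2l => //; exact: ltW.
by rewrite -mul2n exprM lerXn2r// nnegrE ?sqr_ge0// addr_ge0// sqr_ge0.
Qed.

Let dpow j (x : R) :
  is_derive x 1 (fun x => (x - m) ^+ j.+1) (j.+1%:R * (x - m) ^+ j).
Proof.
have d1 : is_derive x 1 (fun x : R => x - m) 1.
  by apply: is_derive_eq; rewrite subr0.
have D2 := is_deriveX j.+1 d1; rewrite exprfctE in D2.
apply: is_derive_eq D2 _.
by rewrite /GRing.scale /= mulr1.
Qed.

(** Integration by parts with [F x = (x - m) ^+ j.+1]. *)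
Lemma normal_moment j v : hasE N (fun x => (x - m) ^+ j) v ->
  hasE N (fun x => (x - m) ^+ j.+2) (s ^+ 2 * (j.+1%:R * v)).
Proof.
move=> hv.
have := @normal_ibp (fun x => (x - m) ^+ j.+1) (fun x => j.+1%:R * (x - m) ^+ j)
  j.+1%:R j.+1 (j.+1%:R * v) (dpow j).
move=> /(_ _ _ _ (hasEZ _ hv)) H.
suff : hasE N (fun x => (x - m) * (x - m) ^+ j.+1) (s ^+ 2 * (j.+1%:R * v)).
  by apply: hasE_ext => x; rewrite -exprS.
apply: H.
- move=> x; apply: cvgM; first exact: cvg_cst.
  case: (j) => [|i].
    under eq_fun do rewrite expr0.
    by rewrite expr0; exact: cvg_cst.
  exact: (derive_continuous (dpow i)).
- move=> x; apply: le_trans (pw _ (_ : _ <= j.+1.*2)%N) _; first by lia.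
  by apply: ler_wpM2r; rewrite ?ler1n// exprn_ge0// addr_ge0// sqr_ge0.
- move=> x; rewrite normrM [`|j.+1%:R|]ger0_norm//; apply: ler_wpM2l => //.
  by rewrite -[leRHS]mul1r; apply: pw; lia.
Qed.

Lemma normal_mean : hasE N (fun x => x - m) 0.
Proof.
have := @normal_ibp (fun=> 1) (fun=> 0) 1 0 0.
rewrite mulr0 => H; apply: hasE_ext (H _ _ _ _ _).
- by move=> x; rewrite mulr1.
- by move=> x; exact: cvg_cst.
- by move=> x; rewrite expr0 mulr1 normr1.
- by move=> x; rewrite expr0 mulr1 normr0.
- exact: hasE_cst.
Qed.

Lemma normal_var : hasE N (fun x => (x - m) ^+ 2) (s ^+ 2).
Proof.
have := @normal_moment 0 1 _; rewrite !mulr1; apply.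
by apply: hasE_ext (hasE_cst _ 1) => x; rewrite expr0.
Qed.

Let dlin (a b x : R) : is_derive x 1 (fun x => a * (x - m) + b) a.
Proof.
by apply: is_derive_eq; rewrite /GRing.scale /=; ring.
Qed.

Let dlint (y b t : R) : is_derive t 1 (fun t => t * y + b) y.
Proof.
by apply: is_derive_eq; rewrite /GRing.scale /= !mulr1 ?mulr0 ?addr0 ?add0r.
Qed.

Let mcos (t th : R) : measurable_fun setT (fun x : R => cos (t * (x - m) + th)).
Proof.
apply: continuous_meas; apply: (@derive_continuous _ _
  (fun x => - sin (t * (x - m) + th) * t)) => x.
exact: (@is_derive1_comp _ cos (fun x => t * (x - m) + th)).
Qed.

Let ccos (t th : R) : continuous (fun x : R => cos (t * (x - m) + th)).
Proof.
apply: (@derive_continuous _ _ (fun x => - sin (t * (x - m) + th) * t)) => x.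
exact: (@is_derive1_comp _ cos (fun x => t * (x - m) + th)).
Qed.

Let cos_norm (x : R) : `|cos x| <= 1.
Proof. by rewrite ler_norml cos_geN1 cos_le1. Qed.

Let sin_norm (x : R) : `|sin x| <= 1.
Proof. by rewrite ler_norml sin_geN1 sin_le1. Qed.

Let phi (th t : R) := (\int[N]_x cos (t * (x - m) + th))%R.

Let phiE th t : hasE N (fun x => cos (t * (x - m) + th)) (phi th t).
Proof.
apply: hasE_Ex.
exact (@L1_bounded R _ _ N 1 _ (mcos t th) (fun x => cos_norm _)).
Qed.

Let ibp_sin th t : hasE N (fun x => (x - m) * sin (t * (x - m) + th))
  (s ^+ 2 * (t * phi th t)).
Proof.
apply: (@normal_ibp _ (fun x => t * cos (t * (x - m) + th)) (1 + `|t|) 0).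
- move=> x; apply: is_derive_eq (@is_derive1_comp _ sin _ x _ _ (is_derive_sin _) (dlin t th x)) _.
  by rewrite mulrC.
- by move=> x; apply: cvgM; [exact: cvg_cst|exact: ccos].
- move=> x; rewrite expr0 mulr1; apply: le_trans (sin_norm _) _.
  by rewrite lerDl.
- move=> x; rewrite expr0 mulr1 normrM.
  apply: le_trans (ler_wpM2l (normr_ge0 _) (cos_norm _)) _.
  by rewrite mulr1 lerDr.
- exact: hasEZ (phiE th t).
Qed.

(** Differentiating under the integral and integrating by parts, the
characteristic function solves [phi' = - s^2 t phi]. *)
Let dphi (th t : R) : is_derive t 1 (phi th) (- (s ^+ 2 * (t * phi th t))).
Proof.
pose f (t x : R) := cos (t * (x - m) + th).
have df (t' x : R) : is_derive t' 1 (f ^~ x) (- sin (t' * (x - m) + th) * (x - m)).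
  exact: (@is_derive1_comp _ cos (fun t => t * (x - m) + th)).
have d1 : partial1of2 f = fun t x => - sin (t * (x - m) + th) * (x - m).
  by apply/funext => t'; apply/funext => x; rewrite partial1of2E; apply: derive_val.
have It : `]t - 1, t + 1[%classic t by rewrite /= in_itv /=; apply/andP; split; lra.
have I1 x : `]t - 1, t + 1[%classic x -> N.-integrable setT (EFin \o f x).
  by move=> _; exact: (hasE_L1 (phiE th x)).
have I2 (x : R) (y : R) : `]t - 1, t + 1[%classic x -> [set: R] y ->
   derivable (f ^~ y) x 1 by move=> _ _; apply: @ex_derive (df x y).
have G0 (y : R) : 0 <= 1 + (y - m) ^+ 2 by rewrite addr_ge0// sqr_ge0.
have GL : L1 N (fun y => 1 + (y - m) ^+ 2).
  by apply: L1D; [exact: hasE_L1 (hasE_cst _ 1)|exact: hasE_L1 normal_var].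
have Gub (x y : R) : `]t - 1, t + 1[%classic x -> [set: R] y ->
   `|partial1of2 f x y| <= 1 + (y - m) ^+ 2.
  move=> _ _; rewrite d1 normrM normrN.
  apply: le_trans (ler_wpM2r (normr_ge0 _) (sin_norm _)) _.
  rewrite mul1r -(real_normK (num_real (y - m))); set a := `|y - m|.
  by have := sqr_ge0 (a - 1); have : 0 <= a := normr_ge0 _; nra.
have D := derivable_under_integral measurableT It I1 I2 G0 GL Gub.
have V := differentiation_under_integral measurableT It I1 I2 G0 GL Gub.
apply: DeriveDef; first exact: D.
rewrite -derive1E [LHS]V d1.
have := hasEN (ibp_sin th t) => -[_ <-]; apply: eq_Rintegral => x _.
by rewrite mulNr mulrC.
Qed.

(** The product of [phi] with [expR (t^2 s^2 / 2)] has zero derivative. *)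
Lemma normal_charfun th t : hasE N (fun x => cos (t * (x - m) + th))
  (expR (- (t ^+ 2 * s ^+ 2 / 2)) * cos th).
Proof.
have := phiE th t; suff -> : phi th t = expR (- (t ^+ 2 * s ^+ 2 / 2)) * cos th by [].
pose K t := phi th t * expR (t ^+ 2 * (s ^+ 2 / 2)).
have dK (x : R) : is_derive x 1 K 0.
  have d2 : is_derive x 1 (fun t : R => t ^+ 2 * (s ^+ 2 / 2)) (x * s ^+ 2).
    apply: is_derive_eq; rewrite /GRing.scale /=.
    by rewrite !mulr0 ?add0r; field.
  have d3 := @is_derive1_comp _ expR _ x _ _ (is_derive_expR _) d2.
  have d4 := is_deriveM (dphi th x) d3.
  apply: is_derive_eq d4 _; rewrite /GRing.scale /=; ring.
have := is_derive_0_is_cst t 0 dK; rewrite /K.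
have -> : phi th 0 = cos th.
  rewrite /phi; under eq_Rintegral => x _ do rewrite mul0r add0r.
  by case: (hasE_cst N (cos th)).
rewrite expr0n mul0r expR0 mulr1 => <-.
rewrite mulrCA -expRD (_ : - _ + _ = 0); last by field.
by rewrite expR0 mulr1.
Qed.

End gaussian_moments.

Section centered_gaussian.
Context {R : realType} {d : measure_display} {T : measurableType d}.
Variable P : probability T R.

(** The facts about a centered Gaussian variable of variance [v] on which the
whole proof rests; [v = 0] is allowed. *)
Definition cgauss (Z : T -> R) (v : R) : Prop :=
  [/\ measurable_fun setT Z /\ 0 <= v,
      hasE P Z 0 /\ hasE P (fun w => Z w ^+ 2) v,
      hasE P (fun w => Z w ^+ 4) (3 * v ^+ 2),
      hasE P (fun w => Z w ^+ 6) (15 * v ^+ 3) &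
      forall t th, hasE P (fun w => cos (t * Z w + th))
        (expR (- (t ^+ 2 * v / 2)) * cos th)].

Lemma gaussian_law_cgauss (Z : T -> R) m s : measurable_fun setT Z ->
  (forall B, measurable B -> P (Z @^-1` B) = gaussian_law m s B) ->
  hasE P Z m /\ cgauss (fun w => Z w - m) (s ^+ 2).
Proof.
move=> mZ law; have mZm : measurable_fun setT (fun w => Z w - m).
  exact: measurable_funB.
move: law; rewrite /gaussian_law; have [->|s0] := eqVneq s 0 => law.
  have E h v : measurable_fun setT h -> h m = v -> hasE P (fun w => h (Z w)) v.
    move=> mh <-; apply: (hasE_transfer (Q := \d_m) mZ law (h := h)).
    have mhE : measurable_fun setT (EFin \o h) by exact/measurable_EFinP.
    have d1 : (\d_m [set: R] = 1%:E :> \bar R) by rewrite diracE in_setT.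
    apply: hasE_of_integral.
      apply/integrableP; split=> //; rewrite integral_dirac//.
        by rewrite [X in (X * _)%E]d1 mul1e ltry.
      exact: measurableT_comp.
    by rewrite integral_dirac// [X in (X * _)%E]d1 mul1e.
  have mX k : measurable_fun setT (fun x : R => (x - m) ^+ k).
    by apply: measurable_funX; exact: measurable_funB.
  split; first exact: (E id).
  rewrite (_ : 0 ^+ 2 = 0); last by rewrite expr0n.
  split.
  - by split.
  - split; last by apply: (E (fun x => (x - m) ^+ 2)) => //; rewrite subrr expr0n.
    by apply: (E (fun x => x - m)); rewrite ?subrr//; exact: measurable_funB.
  - by apply: (E (fun x => (x - m) ^+ 4)) => //; rewrite subrr !expr0n /= mulr0.
  - by apply: (E (fun x => (x - m) ^+ 6)) => //; rewrite subrr !expr0n /= mulr0.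
  - move=> t th; apply: (E (fun x => cos (t * (x - m) + th))).
      apply: measurableT_comp; first by apply: continuous_meas => x; exact: continuous_cos.
      apply: measurable_funD => //; apply: measurable_funM => //.
      exact: measurable_funB.
    by rewrite subrr !mulr0 mul0r oppr0 expR0 mul1r add0r.
have tr h v : hasE (normal_prob m s) h v -> hasE P (fun w => h (Z w)) v.
  move=> hv; have X := @hasE_transfer R _ _ T _ P (normal_prob m s) Z mZ law h v hv; exact X.
have h0 := tr _ _ (normal_mean m s0).
have h2 := normal_var m s0; have h4 := normal_moment s0 h2.
have h6 := normal_moment s0 h4.
split.
  have := hasED h0 (hasE_cst P m); rewrite add0r; apply: hasE_ext => w.
  by rewrite subrK.
split; [by split; rewrite ?sqr_ge0|by split; [|exact: tr h2]|..].
- by have := tr _ _ h4; rewrite (_ : _ * (3%:R * _) = 3 * (s ^+ 2) ^+ 2); last by ring.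
- by have := tr _ _ h6; rewrite (_ : _ * (5%:R * _) = 15 * (s ^+ 2) ^+ 3); last by ring.
- by move=> t th; exact: tr (normal_charfun m s0 th t).
Qed.

End centered_gaussian.

(** * Smoothing by a normal kernel *)

Section fubini_real.
Context {R : realType} {d d' : measure_display}.
Context {T : measurableType d} {T' : measurableType d'}.
Variables (P : probability T R) (m : {sigma_finite_measure set T' -> \bar R}).

(** A uniform bound on the inner integrals of the modulus makes [f] integrable
for the product measure, since [P] has total mass one. *)
Lemma fubini_real (f : T * T' -> R) B : measurable_fun setT f ->
  (forall x, m.-integrable setT (fun y => (f (x, y))%:E)) ->
  (forall y, L1 P (fun x => f (x, y))) ->
  (forall x, \int[m]_y `|f (x, y)| <= B) ->
  [/\ L1 P (fun x => \int[m]_y f (x, y)),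
      m.-integrable setT (fun y => (Ex P (fun x => f (x, y)))%:E) &
      Ex P (fun x => \int[m]_y f (x, y)) = \int[m]_y (Ex P (fun x => f (x, y)))].
Proof.
move=> mf fx fy fB.
have mfE : measurable_fun setT (EFin \o f) by exact/measurable_EFinP.
have If : (P \x m)%E.-integrable setT (EFin \o f).
  apply/(integrable12ltyP P m mfE).
  apply: (@le_lt_trans _ _ (\int[P]_x B%:E)%E); last first.
    by rewrite integral_cst//= probability_setT mule1 ltry.
  apply: ge0_le_integral => //.
  - by move=> x _; apply: integral_ge0.
  - apply: (measurable_fun_fubini_tonelli_F (fun z => `|(EFin \o f) z|%E)) => //.
    exact: measurableT_comp.
  - move=> x _; have /integrable_norm ifx := fx x.
    have := fB x; rewrite -lee_fin /Rintegral fineK//.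
    exact: (integrable_fin_num measurableT ifx).
have FE : (fun x => \int[m]_y (EFin \o f) (x, y))%E =
    EFin \o (fun x => \int[m]_y f (x, y)).
  apply/funext => x /=; rewrite /Rintegral fineK//.
  exact: (integrable_fin_num measurableT (fx x)).
have GE : (fun y => \int[P]_x (EFin \o f) (x, y))%E =
    (fun y => (Ex P (fun x => f (x, y)))%:E).
  apply/funext => y /=; rewrite /Ex /Rintegral fineK//.
  exact: (integrable_fin_num measurableT (fy y)).
have I1 := integrable_fubini_F If; rewrite /fubini_F FE in I1.
have I2 : m.-integrable setT (fun y => \int[P]_x (EFin \o f) (x, y))%E.
  have mG := measurable_fubini_G If.
  apply/integrableP; split=> //.
  have /(integrable21ltyP P m mfE) := If; apply: le_lt_trans.
  apply: ge0_le_integral => //.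
  - exact: measurableT_comp.
  - apply: (measurable_fun_fubini_tonelli_G (fun z => `|(EFin \o f) z|%E)) => //.
    exact: measurableT_comp.
  - move=> y _; apply: le_abse_integral => //.
    exact: measurable_int (fy y).
rewrite GE in I2.
split=> //.
have := Fubini If; rewrite (eq_integral (EFin \o (fun x => \int[m]_y f (x, y)))).
  by rewrite GE => /(congr1 fine).
by move=> x _; rewrite -FE.
Qed.

End fubini_real.

Section smoothing.
Context {R : realType} {d : measure_display} {T : measurableType d}.
Variable P : probability T R.
Local Notation mu := (@lebesgue_measure R).
Local Notation N := (normal_prob (0 : R) 1).
Variables (K V : T -> R) (C : R).
Hypotheses (mK : measurable_fun setT K) (mV : measurable_fun setT V).
Hypothesis KC : forall w, `|K w| <= C.

(** The convolution of [h] with the centered normal law of deviation [s]. *)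
Definition smooth (s : R) (h : R -> R) (x : R) : R := Ex (normal_prob x s) h.

Definition kernel_avg (s y : R) : R := Ex P (fun w => K w * normal_pdf (V w) s y).

Lemma measurable_cosT d' (T' : measurableType d') (f : T' -> R) :
  measurable_fun setT f -> measurable_fun setT (fun x => cos (f x)).
Proof.
by move=> mf; apply: measurableT_comp => //; apply: continuous_meas => x; exact: continuous_cos.
Qed.

(** Up to scale the normal density is its own Fourier transform: the average is
over a standard normal frequency [u]. *)
Lemma normal_pdf_cosE (s x y : R) : s != 0 ->
  hasE N (fun u => cos (u * ((y - x) / s))) (normal_pdf x s y / normal_peak s).
Proof.
move=> s0; have := @normal_charfun _ 0 1 (oner_neq0 _) 0 ((y - x) / s).
rewrite cos0 mulr1 => H.
rewrite normal_pdfE// /normal_fun mulrAC divff ?gt_eqF ?normal_peak_gt0// mul1r.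
have -> : - (y - x) ^+ 2 / (s ^+ 2 *+ 2) = - (((y - x) / s) ^+ 2 * 1 ^+ 2 / 2).
  by rewrite -mulr_natr; field.
by apply: hasE_ext H => u; rewrite subr0 addr0 mulrC.
Qed.

Let C0 : 0 <= C. Proof. by have := KC point; exact: le_trans. Qed.

Let measurable_pair_pdf s : s != 0 -> measurable_fun setT
  (fun z : T * R => normal_pdf (V z.1) s z.2).
Proof.
move=> s0; rewrite (_ : (fun _ => _) = (fun z : T * R => normal_pdf 0 s (z.2 - V z.1))).
  apply: (measurableT_comp (measurable_normal_pdf 0 s)).
  by apply: measurable_funB => //; exact: measurableT_comp.
by apply/funext => z; rewrite !normal_pdfE// /normal_fun subr0.
Qed.

Let measurable_pdf_arg s y : s != 0 ->
  measurable_fun setT (fun x => normal_pdf (V x) s y).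
Proof.
move=> s0; have -> : (fun x => normal_pdf (V x) s y) = (fun x => normal_pdf 0 s (y - V x)).
  by apply/funext => x; rewrite !normal_pdfE// /normal_fun subr0.
by apply: (measurableT_comp (measurable_normal_pdf 0 s)); exact: measurable_funB.
Qed.

(** Through the cosine representation of the density, kernel averages only
depend on the functions [E (K cos (s V + tau))]. *)
Lemma kernel_avgE s y : s != 0 ->
  L1 N (fun u => Ex P (fun w => K w * cos (u * ((y - V w) / s)))) /\
  kernel_avg s y =
  normal_peak s * Ex N (fun u => Ex P (fun w => K w * cos (u * ((y - V w) / s)))).
Proof.
move=> s0.
pose f (z : T * measurableTypeR R) : R := K z.1 * cos (z.2 * ((y - V z.1) / s)).
have mf : measurable_fun setT f.
  apply: measurable_funM; first exact: measurableT_comp.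
  apply: measurable_cosT; apply: measurable_funM => //.
  apply: measurable_funM => //; apply: measurable_funB => //.
  exact: measurableT_comp.
have fC z : `|f z| <= C.
  rewrite normrM -[leRHS]mulr1; apply: ler_pM => //.
  by rewrite ler_norml cos_geN1 cos_le1.
have mx x : measurable_fun setT (fun u : R => f (x, u)).
  rewrite /f /=; apply: measurable_funM => //; apply: measurable_cosT.
  exact: measurable_funM.
have my u : measurable_fun setT (fun x => f (x, u)).
  rewrite /f /=; apply: measurable_funM => //; apply: measurable_cosT.
  apply: measurable_funM => //.
  by apply: measurable_funM => //; apply: measurable_funB.
have Lx x : L1 N (fun u => f (x, u)) := L1_bounded N (mx x) (fun u => fC (x, u)).
have Ly u : L1 P (fun x => f (x, u)) := L1_bounded P (my u) (fun x => fC (x, u)).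
have fB x : \int[N]_u `|f (x, u)| <= C.
  apply: (@hasE_le _ _ _ N (fun u => `|f (x, u)|) (fun=> C)) => //.
  - by split=> //; exact: (integrable_norm (Lx x)).
  - exact: hasE_cst.
have [_ I2 E] := fubini_real mf Lx Ly fB.
split=> //; rewrite [in RHS]/Ex -E /kernel_avg.
have : hasE P (fun x => \int[N]_y0 f (x, y0)) (Ex P (fun x => \int[N]_y0 f (x, y0))).
  by have [] := fubini_real mf Lx Ly fB.
move=> /(hasEZ (normal_peak s)) /hasE_eq <-; apply: eq_Rintegral => w _.
have /(hasEZ (K w)) /hasE_eq := normal_pdf_cosE (V w) y s0.
rewrite /Ex /f /= => ->; rewrite mulrCA; congr (_ * _).
by rewrite mulrC divfK// gt_eqF// normal_peak_gt0.
Qed.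

(** Smoothed test functions are integrals of kernel averages, hence determined
by characteristic functions as well. *)
Lemma smooth_kernelE s (h : R -> R) B : s != 0 -> measurable_fun setT h ->
  (forall y, `|h y| <= B) ->
  [/\ L1 P (fun w => K w * smooth s h (V w)),
      mu.-integrable setT (fun y => (h y * kernel_avg s y)%:E) &
      Ex P (fun w => K w * smooth s h (V w)) = \int[mu]_y (h y * kernel_avg s y)].
Proof.
move=> s0 mh hB.
have B0 : 0 <= B by have := hB 0; exact: le_trans.
pose f (z : T * measurableTypeR R) : R := K z.1 * (h z.2 * normal_pdf (V z.1) s z.2).
have mf : measurable_fun setT f.
  apply: measurable_funM; first exact: measurableT_comp.
  by apply: measurable_funM; [exact: measurableT_comp|exact: measurable_pair_pdf].
have hN x : L1 (normal_prob x s) h by exact: (@L1_bounded _ _ _ (normal_prob x s) B h mh hB).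
have hx x := (L1_normalP x s mh).1 (hN x).
have Lx x : mu.-integrable setT (fun y => (f (x, y))%:E).
  have := integrableZl measurableT (K x) (hx (V x)).
  by apply: eq_integrable => // y _ /=; rewrite EFinM.
have fC x y : `|f (x, y)| <= C * (B * normal_pdf (V x) s y).
  rewrite /f /= (normrM (K x)) (normrM (h y)); apply: ler_pM => //.
  by rewrite [`|normal_pdf _ _ _|]ger0_norm ?normal_pdf_ge0// ler_wpM2r ?normal_pdf_ge0.
have Ly y : L1 P (fun x => f (x, y)).
  apply: (@L1_bounded _ _ _ _ (C * (B * normal_peak s))).
    rewrite /f /=; apply: measurable_funM => //; apply: measurable_funM => //.
    exact: measurable_pdf_arg.
  move=> w; apply: le_trans (fC _ _) _; rewrite ler_wpM2l// ler_wpM2l//.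
  exact: normal_pdf_ub.
have fB x : \int[mu]_y `|f (x, y)| <= C * B.
  have I1 := integrable_normal_pdf (V x) s.
  have E1 : \int[mu]_y (C * B * normal_pdf (V x) s y) = C * B.
    rewrite RintegralZl// /Rintegral integral_normal_pdf/= mulr1//.
  rewrite -[leRHS]E1; apply: le_Rintegral => //.
  - exact: (integrable_norm (Lx x)).
  - have := integrableZl measurableT (C * B) I1.
    by apply: eq_integrable => // y _ /=; rewrite EFinM.
  - by move=> y _; rewrite -mulrA; exact: fC.
have [I1 I2 E] := fubini_real mf Lx Ly fB.
have FE : (fun x => \int[mu]_y f (x, y)) = (fun w => K w * smooth s h (V w)).
  apply/funext => w; rewrite /f /= RintegralZl//.
  by congr (_ * _); have [_ <-] := hasE_normal mh (hx (V w)).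
have GE : (fun y => Ex P (fun x => f (x, y))) = (fun y => h y * kernel_avg s y).
  apply/funext => y; rewrite /kernel_avg.
  have hk : L1 P (fun w => K w * normal_pdf (V w) s y).
    apply: (@L1_bounded _ _ _ _ (C * normal_peak s)).
      by apply: measurable_funM => //; exact: measurable_pdf_arg.
    move=> w; rewrite normrM; apply: ler_pM => //.
    by rewrite ger0_norm ?normal_pdf_ge0// normal_pdf_ub.
  have [_ <-] := hasEZ (h y) (hasE_Ex hk).
  by apply: eq_Rintegral => w _; rewrite /f /= mulrCA.
have GEy y : Ex P (fun x => f (x, y)) = h y * kernel_avg s y.
  exact: (congr1 (fun g => g y) GE).
move: I1 E; rewrite FE => I1 E; split=> //.
  by move: I2; apply: eq_integrable => // y _; rewrite GEy.
by rewrite E; apply: eq_Rintegral => y _; rewrite GEy.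
Qed.

End smoothing.

Section uniqueness.
Context {R : realType}.
Local Notation mu := (@lebesgue_measure R).
Local Notation N := (normal_prob (0 : R) 1).

(** From [|u| <= s / 2 + u^2 / (2 s)]. *)
Lemma normal_absdev (s x : R) : 0 < s ->
  exists2 v, hasE (normal_prob x s) (fun y => `|y - x|) v & v <= s.
Proof.
move=> s0; have V := normal_var x (lt0r_neq0 s0).
have le y : `|y - x| <= s / 2 + (2 * s)^-1 * (y - x) ^+ 2.
  rewrite -(real_normK (num_real (y - x))); set a := `|y - x|.
  have -> : s / 2 + (2 * s)^-1 * a ^+ 2 = a + (2 * s)^-1 * (a - s) ^+ 2.
    by field; exact: lt0r_neq0.
  by rewrite lerDl mulr_ge0 ?sqr_ge0// invr_ge0 mulr_ge0// ltW.
have Vb := hasED (hasE_cst (normal_prob x s) (s / 2)) (hasEZ (2 * s)^-1 V).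
have mf : measurable_fun setT (fun y : R => `|y - x|).
  by apply: measurableT_comp => //; exact: measurable_funB.
have L : L1 (normal_prob x s) (fun y => `|y - x|).
  apply: (@L1_le _ _ _ (normal_prob x s) _ _ mf (hasE_L1 Vb)) => y.
  by rewrite normr_id.
exists (Ex (normal_prob x s) (fun y => `|y - x|)) => //.
apply: (le_trans (hasE_le (hasE_Ex L) Vb le)).
rewrite le_eqVlt; apply/orP; left; apply/eqP; field; exact: lt0r_neq0.
Qed.

Section approx.
Variables (h : R -> R) (B : R).
Hypotheses (mh : measurable_fun setT h) (hB : forall y, `|h y| <= B).

Let hN s x : hasE (normal_prob x s) h (smooth s h x).
Proof. by split=> //; exact: (@L1_bounded _ _ _ (normal_prob x s) B h mh hB). Qed.

Lemma smooth_lipschitz_close L s x : 0 < s -> 0 <= L ->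
  (forall y, `|h y - h x| <= L * `|y - x|) -> `|smooth s h x - h x| <= L * s.
Proof.
move=> s0 L0 Lip; have [v Ev vs] := normal_absdev x s0.
have := hasE_norm_le (hasEB (hN s x) (hasE_cst _ (h x))) (hasEZ L Ev) Lip.
by move=> /le_trans; apply; exact: ler_wpM2l.
Qed.

(** Locally Lipschitz functions with at most linear local constants, such as
trigonometric functions of [x^2]. *)
Definition quad_lipschitz (L : R) := 0 <= L /\
  forall x y, `|h y - h x| <= L * ((1 + `|x|) * `|y - x| + (y - x) ^+ 2).

Lemma smooth_close L s x : 0 < s <= 1 -> quad_lipschitz L ->
  `|smooth s h x - h x| <= L * s * (3 + x ^+ 2).
Proof.
move=> /andP[s0 s1] [L0 Lip]; have [v Ev vs] := normal_absdev x s0.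
have V := normal_var x (lt0r_neq0 s0).
have := hasE_norm_le (hasEB (hN s x) (hasE_cst _ (h x)))
  (hasEZ L (hasED (hasEZ (1 + `|x|) Ev) V)) (Lip x).
move=> /le_trans; apply; rewrite -mulrA; apply: ler_wpM2l => //.
rewrite -(real_normK (num_real x)); set a := `|x|.
have a0 : 0 <= a := normr_ge0 _.
have := sqr_ge0 (a - 1); have : (1 + a) * v <= (1 + a) * s.
  by apply: ler_wpM2l => //; lra.
nra.
Qed.

(** Smoothing [h] at width [s] makes the expectation an integral of kernel
averages, which vanish because the transforms [E (K cos (s V + tau))] do; the
smoothing error is of order [s]. Applied to a centered weight [K], it gives the
factorization of an expectation that independence of [K] and [V] would. *)
Lemma fourier_orthogonal {d} {T : measurableType d} (P : probability T R)
    (K V : T -> R) C v L :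
  measurable_fun setT K -> measurable_fun setT V -> (forall w, `|K w| <= C) ->
  hasE P (fun w => V w ^+ 2) v -> quad_lipschitz L ->
  (forall s tau, Ex P (fun w => K w * cos (s * V w + tau)) = 0) ->
  hasE P (fun w => K w * h (V w)) 0.
Proof.
move=> mK mV KC V2 Lip F0.
have C0 : 0 <= C by have := KC point; exact: le_trans.
have B0 : 0 <= B by have := hB 0; exact: le_trans.
have KhL : L1 P (fun w => K w * h (V w)).
  apply: (@L1_bounded _ _ _ P (C * B)).
    by apply: measurable_funM => //; exact: measurableT_comp.
  by move=> w; rewrite normrM; exact: ler_pM.
suff E0 : Ex P (fun w => K w * h (V w)) = 0 by rewrite -E0; exact: hasE_Ex.
have small s : 0 < s <= 1 ->
    `|Ex P (fun w => K w * h (V w))| <= s * (C * (L * (3 + v))).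
  move=> s01; have s0 : s != 0 by case/andP: s01 => /lt0r_neq0.
  have [I1 _ E1] := smooth_kernelE P mK mV KC s0 mh hB.
  have k0 y : kernel_avg P K V s y = 0.
    have [_ ->] := kernel_avgE P mK mV KC y s0.
    rewrite (_ : (fun _ => _) = fun=> 0); last first.
      apply/funext => u; rewrite -[RHS](F0 (- u / s) (u * y / s)).
      congr (Ex P _); apply/funext => w; congr (_ * cos _).
      by field.
    by rewrite (hasE_eq (hasE_cst N 0)) mulr0.
  have {}E1 : hasE P (fun w => K w * smooth s h (V w)) 0.
    split=> //; rewrite [LHS]E1; under eq_Rintegral => y _ do rewrite k0 mulr0.
    by rewrite Rintegral_cst// mul0r.
  have := hasEB (hasE_Ex KhL) E1; rewrite subr0 => D.
  have Bd := hasEZ (C * (L * s)) (hasED (hasE_cst P 3) V2).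
  have le w : `|K w * h (V w) - K w * smooth s h (V w)| <=
      C * (L * s) * (3 + V w ^+ 2).
    rewrite -mulrBr normrM -mulrA; apply: ler_pM => //.
    by rewrite distrC; exact: smooth_close.
  apply: le_trans (hasE_norm_le D Bd le) _.
  by rewrite le_eqVlt; apply/orP; left; apply/eqP; ring.
apply/eqP; rewrite -normr_le0 leNgt; apply/negP => pos.
set e := `|Ex P _| in pos small; pose c := C * (L * (3 + v)).
have c0 : 0 <= c.
  have := small 1; rewrite ltr01 lexx mul1r => /(_ isT); apply: le_trans.
  exact: ltW.
have d0 : 0 < e + 2 * c by lra.
have s01 : 0 < e / (e + 2 * c) <= 1.
  by rewrite divr_gt0//= ler_pdivrMr// mul1r lerDl mulr_ge0.
have := small _ s01; rewrite -/c mulrAC ler_pdivlMr//.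
by have := mulr_ge0 (ltW pos) c0; have := mulr_gt0 pos pos; nra.
Qed.

End approx.
End uniqueness.

(** * The normal distribution function *)

Section Phi_facts.
Context {R : realType}.
Local Notation mu := (@lebesgue_measure R).
Local Notation N := (normal_prob (0 : R) 1).
Implicit Types a b x y : R.

Lemma Phi_ge0 x : 0 <= Phi x. Proof. exact: fine_ge0. Qed.

Lemma Phi_le1 x : Phi x <= 1.
Proof.
rewrite -lee_fin /Phi fineK; last exact: fin_num_measure.
exact: probability_le1.
Qed.

Lemma normal_itv x y : x <= y -> fine (N `]x, y]) = Phi y - Phi x.
Proof.
move=> xy; rewrite /Phi.
have -> : `]-oo, y]%classic = `]-oo, x] `|` `]x, y].
  by rewrite -itv_bndbnd_setU// bnd_simp.
have dis : `]-oo, x]%classic `&` `]x, y]%classic = set0.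
  rewrite -subset0 => z /= []; rewrite !in_itv /= => zx /andP[xz _].
  by move: xz; rewrite ltNge zx.
have -> : N (`]-oo, x] `|` `]x, y]) = (N `]-oo, x] + N `]x, y])%E.
  exact: measureU.
have f1 : N `]-oo, x] \is a fin_num by exact: fin_num_measure.
have f2 : N `]x, y] \is a fin_num by exact: fin_num_measure.
by rewrite (fineD f1 f2) addrAC subrr add0r.
Qed.

Lemma Phi_mono x y : x <= y -> Phi x <= Phi y.
Proof. by move=> xy; rewrite -subr_ge0 -normal_itv// fine_ge0. Qed.

Lemma normal_peak1_le1 : normal_peak (1 : R) <= 1.
Proof.
rewrite /normal_peak expr1n mul1r.
have p2 : 2 <= pi :> R by exact: pi_ge2.
have p1 : 1 <= (pi : R) *+ 2 by rewrite mulr2n; lra.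
have s1 : 1 <= Num.sqrt ((pi : R) *+ 2) by rewrite -[leLHS]sqrtr1 ler_wsqrtr.
by rewrite invf_le1// (lt_le_trans ltr01 s1).
Qed.

(** The normal density is at most one. *)
Lemma Phi_lipschitz x y : x <= y -> Phi y - Phi x <= y - x.
Proof.
move=> xy; rewrite -normal_itv// -lee_fin fineK ?fin_num_measure//.
rewrite /normal_prob.
apply: (@le_trans _ _ (\int[mu]_(z in `]x, y]) 1%:E)%E).
  apply: ge0_le_integral => //.
  - by move=> z _; rewrite lee_fin normal_pdf_ge0.
  - by apply/measurable_EFinP; apply: measurable_funTS; exact: measurable_normal_pdf.
  - move=> z _; rewrite lee_fin; apply: le_trans normal_peak1_le1.
    exact: normal_pdf_ub.
rewrite integral_cst//= mul1e lebesgue_measure_itv /= lte_fin.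
by case: ifP => // _; rewrite lee_fin subr_ge0.
Qed.

Lemma PhiN x : Phi (- x) = 1 - Phi x.
Proof.
have m1 : measurable `]-oo, x]%classic := @measurable_itv R `]-oo, x].
have -> : 1 - Phi x = fine (N `]x, +oo[).
  have f1 : N `]x, +oo[ \is a fin_num by exact: fin_num_measure.
  have E : N `]-oo, x] = (1 - N `]x, +oo[)%E.
    by rewrite -setCitvr probability_setC.
  have f0 : (1%E : \bar R) \is a fin_num by [].
  by rewrite /Phi E (fineB f0 f1) opprB addrC subrK.
rewrite /Phi /normal_prob.
congr fine; rewrite integral_itv_obnd_cbnd; last first.
  by apply/measurable_EFinP; apply: measurable_funTS; exact: measurable_normal_pdf.
rewrite ge0_integration_by_substitutionNy.
- apply: eq_integral => z _; congr EFin.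
  by rewrite /= !normal_pdfE ?oner_neq0// /normal_fun !subr0 sqrrN.
- apply: continuous_subspaceT => z; apply: continuous_normal_pdf; exact: oner_neq0.
- by move=> z _; exact: normal_pdf_ge0.
Qed.

(** Chebyshev's inequality. *)
Lemma Phi_tail (t : R) : 0 < t -> Phi (- t) <= t ^- 2.
Proof.
move=> t0; have V := @normal_var R 0 1 (oner_neq0 _).
have := hasEZ (t ^- 2) V; rewrite expr1n mulr1 => V'.
apply: (prob_le_hasE V') => // x; rewrite indicE subr0.
have [|_] := boolP (x \in _); last by rewrite mulr_ge0 ?invr_ge0 ?sqr_ge0.
rewrite inE /= in_itv /= => xt.
rewrite mulrC ler_pdivlMr ?exprn_gt0// mul1r; nra.
Qed.

End Phi_facts.

Section kolmogorov.
Context {R : realType}.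
Local Notation mu := (@lebesgue_measure R).
Local Notation N := (normal_prob (0 : R) 1).

Definition clamp (x : R) : R := if x <= 0 then 0 else if 1 <= x then 1 else x.

Lemma clamp_lip x y : `|clamp x - clamp y| <= `|x - y|.
Proof.
rewrite /clamp ler_norml; have := ler_norm (x - y); have := ler_norm (- (x - y)).
rewrite normrN; case: (leP x 0); case: (leP y 0); case: (leP 1 x);
  case: (leP 1 y); move=> *; apply/andP; split; lra.
Qed.

Lemma clamp_mono x y : x <= y -> clamp x <= clamp y.
Proof.
rewrite /clamp; case: (leP x 0); case: (leP y 0); case: (leP 1 x);
  case: (leP 1 y); lra.
Qed.

Lemma clamp01 x : 0 <= clamp x <= 1.
Proof. by rewrite /clamp; case: (leP x 0); case: (leP 1 x); lra. Qed.

(** A continuous bump equal to [1] on [[b + e, a - e]] and supported in [[b, a]]. *)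
Definition bump (b a e x : R) : R := clamp ((x - b) / e) - clamp ((x - (a - e)) / e).

Section bump_facts.
Variables (b a e : R).
Hypotheses (e0 : 0 < e) (bea : b + e <= a - e).

Lemma bump_lip x y : `|bump b a e y - bump b a e x| <= 2 / e * `|y - x|.
Proof.
rewrite /bump; set p := clamp _; set q := clamp _; set r := clamp _; set s := clamp _.
have h1 : `|p - r| <= `|y - x| / e.
  apply: le_trans (clamp_lip _ _) _; rewrite -mulrBl normrM.
  have -> : y - b - (x - b) = y - x by ring.
  by rewrite [`|e^-1|]gtr0_norm// invr_gt0.
have h2 : `|q - s| <= `|y - x| / e.
  apply: le_trans (clamp_lip _ _) _; rewrite -mulrBl normrM.
  have -> : y - (a - e) - (x - (a - e)) = y - x by ring.
  by rewrite [`|e^-1|]gtr0_norm// invr_gt0.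
have -> : p - q - (r - s) = (p - r) - (q - s) by ring.
apply: le_trans (ler_normB _ _) _.
have -> : 2 / e * `|y - x| = `|y - x| / e + `|y - x| / e by ring.
exact: lerD.
Qed.

Lemma bump01 x : 0 <= bump b a e x <= 1.
Proof.
rewrite /bump; have /andP[h1 h2] := clamp01 ((x - b) / e).
have /andP[h3 h4] := clamp01 ((x - (a - e)) / e).
have : clamp ((x - (a - e)) / e) <= clamp ((x - b) / e).
  apply: clamp_mono; apply: ler_wpM2r; first by rewrite invr_ge0 ltW.
  by move: e0 bea; lra.
by move=> h5; apply/andP; split; lra.
Qed.

Lemma bump_out x : x <= b \/ a <= x -> bump b a e x = 0.
Proof.
have pos u : 0 <= u -> 0 <= u / e by move=> u0; rewrite divr_ge0// ltW.
rewrite /bump /clamp => -[xb|ax].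
  have h1 : (x - b) / e <= 0 by rewrite pmulr_lle0 ?invr_gt0//; move: e0 bea; lra.
  have h2 : (x - (a - e)) / e <= 0 by rewrite pmulr_lle0 ?invr_gt0//; move: e0 bea; lra.
  by rewrite h1 h2 subr0.
have h1 : 1 <= (x - b) / e by rewrite ler_pdivlMr//; move: e0 bea; lra.
have h2 : 1 <= (x - (a - e)) / e by rewrite ler_pdivlMr//; move: e0 bea; lra.
by rewrite !leNgt !(lt_le_trans ltr01 h1) !(lt_le_trans ltr01 h2) /= -!leNgt h1 h2 subrr.
Qed.

Lemma bump_in x : b + e <= x <= a - e -> bump b a e x = 1.
Proof.
move=> /andP[h1 h2]; rewrite /bump /clamp.
have h3 : 1 <= (x - b) / e by rewrite ler_pdivlMr//; move: e0 bea; lra.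
have h4 : (x - (a - e)) / e <= 0 by rewrite pmulr_lle0 ?invr_gt0//; move: e0 bea; lra.
by rewrite h4 subr0 leNgt (lt_le_trans ltr01 h3) /= h3.
Qed.

Lemma measurable_bump : measurable_fun setT (bump b a e).
Proof.
apply: continuous_meas => x; apply/cvgrPdist_le => d d0; near=> y.
apply: le_trans (bump_lip _ _) _.
rewrite mulrC -ler_pdivlMr ?divr_gt0//; near: y.
by apply: cvgr_dist_le => //; rewrite !divr_gt0.
Unshelve. all: by end_near. Qed.

End bump_facts.
End kolmogorov.

(** * From characteristic functions to distribution functions *)

Section kolmogorov.
Context {R : realType}.
Local Notation mu := (@lebesgue_measure R).
Local Notation N := (normal_prob (0 : R) 1).

Lemma std_charfun (t th : R) :
  hasE N (fun x => cos (t * x + th)) (expR (- (t ^+ 2 / 2)) * cos th).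
Proof.
have := @normal_charfun R 0 1 (oner_neq0 _) th t; rewrite expr1n mulr1.
by apply: hasE_ext => x; rewrite subr0.
Qed.

Lemma std_moment4 : hasE N (fun x => x ^+ 4) 3.
Proof.
have := normal_moment (oner_neq0 _) (@normal_var R 0 1 (oner_neq0 _)).
rewrite !expr1n mul1r mulr1; apply: hasE_ext => x; by rewrite subr0.
Qed.

Section one.
Context {d : measure_display} {T : measurableType d}.
Variables (P : probability T R) (Q : T -> R) (eps : R).
Hypothesis mQ : measurable_fun setT Q.

(** A quantitative form of convergence in law to the standard normal law. The
phase [tau] gives the real and imaginary parts of the characteristic function
together. *)
Definition charfun_close := forall s tau,
  `|Ex P (fun w => cos (s * Q w + tau)) - expR (- (s ^+ 2 / 2)) * cos tau| <=
  eps * (1 + s ^+ 4).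

Hypothesis close : charfun_close.

Let m1 : measurable_fun setT (cst 1 : T -> R). Proof. by []. Qed.
Let m1R : measurable_fun setT (cst 1 : measurableTypeR R -> R). Proof. by []. Qed.
Let b1 (w : T) : `|(cst 1 : T -> R) w| <= 1. Proof. by rewrite normr1. Qed.
Let b1R (w : R) : `|(cst 1 : R -> R) w| <= 1. Proof. by rewrite normr1. Qed.
Let mid : measurable_fun setT (id : measurableTypeR R -> R). Proof. by []. Qed.

Let kernel_close s y : 0 < s ->
  `|kernel_avg P (cst 1) Q s y - kernel_avg N (cst 1) id s y| <=
  normal_peak s * (eps * (1 + 3 / s ^+ 4)).
Proof.
move=> s0; have sn0 := lt0r_neq0 s0.
have [L1P ->] := kernel_avgE P m1 mQ b1 y sn0.
have [L1N ->] := kernel_avgE N m1R mid b1R y sn0.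
rewrite -mulrBr normrM ger0_norm ?normal_peak_ge0// ler_wpM2l ?normal_peak_ge0//.
have D := hasEB (hasE_Ex L1P) (hasE_Ex L1N).
have Bd := hasEZ eps (hasED (hasE_cst N 1) (hasEZ (s ^- 4) std_moment4)).
rewrite [3 / _]mulrC; apply: (hasE_norm_le D Bd) => u.
have -> : Ex N (fun w => cst 1 w * cos (u * ((y - w) / s))) =
    expR (- ((- u / s) ^+ 2 / 2)) * cos (u * y / s).
  have [_ <-] := std_charfun (- u / s) (u * y / s).
  apply: eq_Rintegral => w _; rewrite mul1r; congr cos; by field.
have -> : Ex P (fun w => cst 1 w * cos (u * ((y - Q w) / s))) =
    Ex P (fun w => cos (- u / s * Q w + u * y / s)).
  apply: eq_Rintegral => w _; rewrite mul1r; congr cos; by field.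
apply: le_trans (close _ _) _.
by rewrite le_eqVlt; apply/orP; left; apply/eqP; field.
Qed.

(** Both expectations are replaced by those of the bump smoothed at width [s],
at a cost of order [s / e]; the smoothed expectations are integrals of kernel
averages over the support of the bump, and these are close. *)
Lemma charfun_close_bump b a e s : 0 < s -> 0 < e -> b + e <= a - e ->
  `|Ex P (bump b a e \o Q) - Ex N (bump b a e)| <=
  4 / e * s + (a - b) * (normal_peak s * (eps * (1 + 3 / s ^+ 4))).
Proof.
move=> s0 e0 bea; have sn0 := lt0r_neq0 s0.
set h := bump b a e; set c := normal_peak s * _.
have mh : measurable_fun setT h by exact: measurable_bump.
have h1 x : `|h x| <= 1.
  by have /andP[h0 h1] := bump01 e0 bea x; rewrite ger0_norm.
have L0 : 0 <= 2 / e by rewrite divr_ge0// ltW.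
have cl x : `|smooth s h x - h x| <= 2 / e * s.
  by apply: (smooth_lipschitz_close mh h1 s0 L0) => y; exact: bump_lip.
have hQ : L1 P (h \o Q).
  exact: (@L1_bounded _ _ _ P 1 (h \o Q) (measurableT_comp mh mQ) (fun w => h1 (Q w))).
have hNL : L1 N h by exact: (@L1_bounded _ _ _ N 1 h mh h1).
have [I1 J1 E1] := smooth_kernelE P m1 mQ b1 sn0 mh h1.
have [I2 J2 E2] := smooth_kernelE N m1R mid b1R sn0 mh h1.
have d1 : `|Ex P (fun w => cst 1 w * smooth s h (Q w)) - Ex P (h \o Q)| <= 2 / e * s.
  apply: hasE_norm_le (hasEB (hasE_Ex I1) (hasE_Ex hQ)) (hasE_cst P _) _ => w.
  by rewrite mul1r /=; exact: cl.
have d2 : `|Ex N (fun w => cst 1 w * smooth s h (id w)) - Ex N h| <= 2 / e * s.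
  apply: hasE_norm_le (hasEB (hasE_Ex I2) (hasE_Ex hNL)) (hasE_cst N _) _ => w.
  by rewrite mul1r; exact: cl.
have d3 : `|Ex P (fun w => cst 1 w * smooth s h (Q w)) -
    Ex N (fun w => cst 1 w * smooth s h (id w))| <= (a - b) * c.
  rewrite [X in `|X - _|]E1 [X in `|_ - X|]E2 -RintegralB//.
  have c0 : 0 <= c by apply: le_trans (kernel_close 0 s0).
  have Ih : mu.-integrable setT (EFin \o (fun y => c * \1_(`[b, a]%classic) y)).
    have := integrableZl measurableT c (integrable_indic_itv b a true false).
    by apply: eq_integrable => // y _ /=; rewrite EFinM.
  have Idiff : mu.-integrable setT (EFin \o
     (fun y => h y * kernel_avg P (cst 1) Q s y - h y * kernel_avg N (cst 1) id s y)).
    have := integrableB measurableT J1 J2.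
    by apply: eq_integrable => // y _ /=; rewrite EFinB.
  apply: le_trans (le_normr_Rintegral measurableT Idiff) _.
  apply: (@le_trans _ _ (\int[mu]_y (c * \1_(`[b, a]%classic) y))).
    apply: le_Rintegral => //; first exact: integrable_norm.
    move=> y _; rewrite -mulrBr normrM indicE.
    have [|] := boolP (y \in _).
      rewrite mulr1 -[leRHS]mul1r => _; apply: ler_pM => //.
      exact: kernel_close.
    rewrite notin_setE /= in_itv /= => /negP; rewrite negb_and -!ltNge => yo.
    have -> : h y = 0 by apply: bump_out => //; case/orP: yo => /ltW; [left|right].
    by rewrite normr0 mul0r mulr0.
  rewrite RintegralZl//; last exact: (integrable_indic_itv b a true false).
  rewrite mulrC /Rintegral integral_indic//= setIT lebesgue_measure_itv /= lte_fin.
  by case: ifP => _ //=; rewrite ler_wpM2r// subr_ge0; move: e0 bea; lra.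
have -> : 4 / e * s = 2 / e * s + 2 / e * s by ring.
move: d1 d2 d3; rewrite !ler_norml => /andP[? ?] /andP[? ?] /andP[? ?].
by apply/andP; split; lra.
Qed.

(** Test against a bump of width [2 K] ending at [a]; what the normal law gives
to the left of the bump is a tail. For [a > K] the bump ending at [K] serves,
as [Phi a - Phi K] is itself a tail. *)
Lemma charfun_close_lower a e s K : 0 < s -> 0 < e -> 0 < K -> e <= K ->
  Phi a - e - 2 * Phi (- K + e) -
  (4 / e * s + 2 * K * (normal_peak s * (eps * (1 + 3 / s ^+ 4)))) <=
  fine (P [set w | Q w < a]).
Proof.
move=> s0 e0 K0 eK; set err := _ + 2 * K * _.
have mlt c : measurable [set w | Q w < c].
  rewrite (_ : [set w | Q w < c] = setT `&` Q @^-1` `]-oo, c[%classic).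
    exact: mQ.
  by rewrite setTI; apply/seteqP; split=> w /=; rewrite in_itv.
have low c : Phi (c - e) - Phi (c - 2 * K + e) - err <= fine (P [set w | Q w < c]).
  have bea : c - 2 * K + e <= c - e by lra.
  have := charfun_close_bump s0 e0 bea.
  have -> : c - (c - 2 * K) = 2 * K by ring.
  rewrite -/err; set h := bump _ _ _; rewrite ler_norml => /andP[close_h _].
  have mh : measurable_fun setT h by exact: measurable_bump.
  have h1 x : `|h x| <= 1.
    by have /andP[q0 q1] := bump01 e0 bea x; rewrite ger0_norm.
  have hQ : hasE P (h \o Q) (Ex P (h \o Q)).
    apply: hasE_Ex.
    exact: (@L1_bounded _ _ _ P 1 (h \o Q) (measurableT_comp mh mQ) (fun w => h1 (Q w))).
  have hNL : hasE N h (Ex N h) by apply: hasE_Ex; exact: (@L1_bounded _ _ _ N 1 h mh h1).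
  have u1 : Ex P (h \o Q) <= fine (P [set w | Q w < c]).
    apply: (hasE_le_prob hQ) => // w; rewrite indicE /=.
    have [|] := boolP (w \in _); first by move=> _; have /andP[] := bump01 e0 bea (Q w).
    rewrite notin_setE /= => /negP; rewrite -leNgt => cQ.
    by rewrite /h bump_out//; right.
  have u2 : Phi (c - e) - Phi (c - 2 * K + e) <= Ex N h.
    rewrite -normal_itv//; apply: (prob_le_hasE hNL) => // x; rewrite indicE.
    have [|_] := boolP (x \in _); last by have /andP[] := bump01 e0 bea x.
    rewrite inE /= in_itv /= => /andP[/ltW x1 x2].
    by rewrite /h bump_in// x1.
  apply: le_trans u1; apply: (@le_trans _ _ (Ex N h - err)); first exact: lerB.
  by rewrite addrC -lerBrDr.
clearbody err.
have e1 : Phi a - Phi (a - e) <= e.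
  have h := @Phi_lipschitz R (a - e) a; rewrite (_ : a - (a - e) = e) in h; last by ring.
  by apply: h; rewrite gerBl ltW.
have [aK|Ka] := leP a K.
  have := low a; have : Phi (a - 2 * K + e) <= Phi (- K + e) by apply: Phi_mono; lra.
  have := Phi_ge0 (- K + e); lra.
have : fine (P [set w | Q w < K]) <= fine (P [set w | Q w < a]).
  apply: fine_le; rewrite ?fin_num_measure//; apply: le_measure; rewrite ?inE//.
  by move=> w /=; move=> /lt_trans; apply.
have := low K; have -> : K - 2 * K + e = - K + e by ring.
have -> : K - e = - (- K + e) by ring.
rewrite PhiN; have := Phi_le1 a; have := Phi_ge0 (- K + e); lra.
Qed.

End one.

(** Lower bounds that are uniform in [a] suffice, since applied to [- Q] they
become upper bounds. Uniformity matters: the test is later evaluated at points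
that move with the sample size. *)
Lemma charfun_close_cdf (eta : R) : 0 < eta -> exists2 eps : R, 0 < eps &
  forall d (T : measurableType d) (P : probability T R) (Q : T -> R),
    measurable_fun setT Q -> charfun_close P Q eps ->
    forall a, Phi a - eta <= fine (P [set w | Q w < a]).
Proof.
(* The ramp width [e] and the tail beyond [t] each cost a share of [eta]; the
   smoothing width [s] makes [4 / e * s] another share, and [eps] is chosen
   last so that the kernel term is the final one. *)
move=> eta0; pose e := eta / 4; pose t := 1 + 8 / eta; pose K := e + t.
have e0 : 0 < e by rewrite divr_gt0.
have t0 : 0 < t by rewrite ltr_pwDl// divr_ge0// ltW.
have K0 : 0 < K by rewrite addr_gt0.
pose s := eta * e / 16; have s0 : 0 < s by rewrite divr_gt0// mulr_gt0.
pose c := 2 * K * (normal_peak s * (1 + 3 / s ^+ 4)).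
have c0 : 0 < c.
  rewrite !mulr_gt0// ?normal_peak_gt0 ?lt0r_neq0// ltr_pwDl// divr_ge0//.
  by rewrite exprn_ge0// ltW.
exists (eta / 4 / c); first by rewrite !divr_gt0.
move=> d T P Q mQ close a.
have eK : e <= K by rewrite lerDl ltW.
have := charfun_close_lower mQ close a s0 e0 K0 eK.
have -> : 2 * K * (normal_peak s * (eta / 4 / c * (1 + 3 / s ^+ 4))) =
    eta / 4 / c * c by rewrite /c; ring.
rewrite divfK ?gt_eqF//.
have -> : 4 / e * s = eta / 4 by rewrite /s; field; exact: lt0r_neq0.
have -> : - K + e = - t by rewrite /K; ring.
have : Phi (- t) <= eta / 8.
  apply: le_trans (Phi_tail t0) _; rewrite -[leRHS]invrK lef_pV2 ?posrE ?exprn_gt0 ?invr_gt0 ?divr_gt0//.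
  rewrite invf_div /t; set u := 8 / eta.
  have : 0 < u by rewrite divr_gt0.
  nra.
rewrite /e; lra.
Qed.

End kolmogorov.

(** * The characteristic function of a centered Gaussian square *)

Section trigo_bounds.
Context {R : realType}.
Implicit Types x y : R.

Lemma cos_abs_le1 x : `|cos x| <= 1.
Proof. by rewrite ler_norml cos_geN1 cos_le1. Qed.

Lemma sin_abs_le1 x : `|sin x| <= 1.
Proof. by rewrite ler_norml sin_geN1 sin_le1. Qed.

Lemma mvt_bound (f f' : R -> R) (C x : R) : (forall y : R, is_derive y 1 f (f' y)) ->
  (forall y, `|y| <= `|x| -> `|f' y| <= C) -> `|f x - f 0| <= C * `|x|.
Proof.
move=> df fC; have cf := derive_continuous df.
have [x0|/ltW x0] := leP 0 x.
  have [c + ->] := MVT_segment x0 (fun y _ => df y) (continuous_subspaceT cf).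
  rewrite in_itv /= subr0 normrM => /andP[c0 cx]; apply: ler_wpM2r => //.
  by apply: fC; rewrite !ger0_norm.
have [c + e] := MVT_segment x0 (fun y _ => df y) (continuous_subspaceT cf).
rewrite -normrN opprB e in_itv /= sub0r normrM normrN => /andP[xc c0].
by apply: ler_wpM2r => //; apply: fC; rewrite !ler0_norm// lerN2.
Qed.

Lemma sin_abs_le x : `|sin x| <= `|x|.
Proof.
have := @mvt_bound sin cos 1 x (fun y => is_derive_sin y) (fun y _ => cos_abs_le1 y).
by rewrite sin0 subr0 mul1r.
Qed.

Lemma cos_lipschitz x y : `|cos x - cos y| <= `|x - y|.
Proof.
have D (z : R) : is_derive z 1 (fun z => cos (y + z)) (- sin (y + z)).
  have d1 : is_derive z 1 (fun z => y + z) 1 by apply: is_derive_eq; rewrite add0r mulr1.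
  by apply: is_derive_eq (@is_derive1_comp _ cos _ z _ _ (is_derive_cos _) d1) _; rewrite mulr1.
have := @mvt_bound _ _ 1 (x - y) D; rewrite addr0 mul1r.
rewrite (_ : y + (x - y) = x); last by ring.
by apply=> z _; rewrite normrN sin_abs_le1.
Qed.

Lemma cos_sub1_le x : `|cos x - 1| <= x ^+ 2.
Proof.
have := @mvt_bound cos (fun y => - sin y) `|x| x (fun y => is_derive_cos y).
rewrite cos0 -expr2 real_normK ?num_real//; apply => y yx.
by rewrite normrN; exact: le_trans (sin_abs_le y) _.
Qed.

Lemma sin_taylor x : `|sin x - x| <= `|x| ^+ 3.
Proof.
have D (z : R) : is_derive z 1 (fun z => sin z - z) (cos z - 1) by apply: is_derive_eq.
have := @mvt_bound _ _ (x ^+ 2) x D.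
rewrite sin0 subrr subr0 -(real_normK (num_real x)) -exprSr; apply => y yx.
by apply: le_trans (cos_sub1_le y) _; rewrite -(real_normK (num_real y)) lerXn2r ?nnegrE.
Qed.

Lemma cos_taylor x : `|cos x - (1 - x ^+ 2 / 2)| <= 2 * `|x| ^+ 3.
Proof.
have D (z : R) : is_derive z 1 (fun z => cos z - (1 - z ^+ 2 / 2)) (z - sin z).
  by apply: is_derive_eq; rewrite /GRing.scale /=; field.
have f0 : cos 0 - (1 - 0 ^+ 2 / 2) = 0 :> R.
  by rewrite cos0 expr0n mul0r subr0 subrr.
have n0 : 0 <= `|x| := normr_ge0 x.
have [x1|/ltW x1] := leP `|x| 1.
  have := @mvt_bound _ _ (`|x| ^+ 3) x D; rewrite f0 subr0 => H.
  have {}H : `|cos x - (1 - x ^+ 2 / 2)| <= `|x| ^+ 3 * `|x|.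
    apply: H => y yx; rewrite distrC; apply: le_trans (sin_taylor y) _.
    by rewrite lerXn2r ?nnegrE.
  apply: le_trans H _; apply: (@le_trans _ _ (`|x| ^+ 3)).
    by rewrite ler_piMr// exprn_ge0.
  by rewrite ler_peMl ?exprn_ge0// ler1n.
have := @mvt_bound _ _ (2 * `|x|) x D; rewrite f0 subr0 => H.
have {}H : `|cos x - (1 - x ^+ 2 / 2)| <= 2 * `|x| * `|x|.
  apply: H => y yx; apply: le_trans (ler_normB _ _) _.
  by have := sin_abs_le y; lra.
apply: le_trans H _; rewrite -mulrA ler_wpM2l// !exprS expr0 mulr1.
by apply: ler_wpM2l => //; rewrite ler_peMl.
Qed.

Lemma expRN_taylor (y : R) : 0 <= y -> `|expR (- y) - (1 - y)| <= y ^+ 2.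
Proof.
move=> y0; have D (z : R) : is_derive z 1 (fun z => expR (- z) - (1 - z)) (1 - expR (- z)).
  have d1 : is_derive z 1 (fun z : R => - z) (- 1) by apply: is_derive_eq.
  have d2 := @is_derive1_comp _ expR _ z _ _ (is_derive_expR _) d1.
  by apply: is_derive_eq; rewrite /GRing.scale /=; ring.
have cf := derive_continuous D.
have [c + e] := MVT_segment y0 (fun z _ => D z) (continuous_subspaceT cf).
rewrite in_itv /= => /andP[c0 cy].
have f0 : expR (- 0) - (1 - 0) = 0 :> R by rewrite oppr0 expR0 addr0 subrr.
move: e; rewrite f0 !subr0 => ->; rewrite normrM [`|y|]ger0_norm//.
rewrite expr2; apply: ler_wpM2r => //.
have h1 := expR_ge1Dx (- c); have h2 : expR (- c) <= 1 by rewrite -expR0 ler_expR oppr_le0.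
by rewrite ger0_norm; lra.
Qed.

End trigo_bounds.

Section quadratic_form.
Context {R : realType} {d : measure_display} {T : measurableType d}.
Variable P : probability T R.

Section one_variable.
Variables (V : T -> R) (l t : R).
Hypothesis gV : cgauss P V l.

Let l0 : 0 <= l. Proof. by case: gV => -[]. Qed.
Let mV : measurable_fun setT V. Proof. by case: gV => -[]. Qed.

(** The value of [cos (t Y + om)] at the centered square [Y] of [x]; the two
phases [0] and [- pi / 2] give the real and imaginary parts of the
characteristic function of [Y]. *)
Definition sqc (om : R) (x : R) : R := cos (t * (x ^+ 2 - l) + om).

Lemma sqc_quad_lipschitz om : quad_lipschitz (sqc om) (2 * `|t|).
Proof.
split=> [|x y]; first exact: mulr_ge0.
apply: le_trans (cos_lipschitz _ _) _.
have -> : t * (y ^+ 2 - l) + om - (t * (x ^+ 2 - l) + om) =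
  t * ((y - x) ^+ 2 + 2 * (x * (y - x))) by ring.
rewrite normrM -[leRHS]mulrA [leRHS]mulrCA; apply: ler_wpM2l => //.
apply: le_trans (ler_normD _ _) _.
rewrite [`|(y - x) ^+ 2|]ger0_norm ?sqr_ge0// normrM [`|2|]ger0_norm// normrM.
have := sqr_ge0 (y - x); have := mulr_ge0 (normr_ge0 x) (normr_ge0 (y - x)).
by have := normr_ge0 (y - x); lra.
Qed.

Lemma measurable_sqc om : measurable_fun setT (sqc om).
Proof.
apply: measurable_cosT; apply: measurable_funD => //; apply: measurable_funM => //.
by apply: measurable_funB => //; exact: measurable_funX.
Qed.

Lemma sqc_L1 om : L1 P (fun w => sqc om (V w)).
Proof.
apply: (@L1_bounded _ _ _ P 1); first exact: measurableT_comp (measurable_sqc om) mV.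
by move=> w; exact: cos_abs_le1.
Qed.

Let Y w := V w ^+ 2 - l.

Let EY : hasE P Y 0.
Proof.
by case: gV => _ [_ E2] _ _ _; rewrite -(subrr l); apply: hasEB => //; exact: hasE_cst.
Qed.

Let EY2 : hasE P (fun w => Y w ^+ 2) (2 * l ^+ 2).
Proof.
case: gV => _ [_ E2] E4 _ _.
have := hasED (hasED E4 (hasEZ (- (2 * l)) E2)) (hasE_cst P (l ^+ 2)).
rewrite (_ : _ + _ = 2 * l ^+ 2); last by ring.
by apply: hasE_ext => w; rewrite /Y; ring.
Qed.

Let EY3 : exists2 v, hasE P (fun w => `|Y w| ^+ 3) v & v <= 16 * l ^+ 3.
Proof.
case: gV => _ _ _ E6 _.
have B := hasED E6 (hasE_cst P (l ^+ 3)).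
have le w : `|Y w| ^+ 3 <= V w ^+ 6 + l ^+ 3.
  have -> : V w ^+ 6 = (V w ^+ 2) ^+ 3 by ring.
  rewrite /Y; have := sqr_ge0 (V w); move: (V w ^+ 2) l0 => a l0' a0.
  have [al|/ltW al] := leP l a.
    apply: (@le_trans _ _ (a ^+ 3)); last by rewrite lerDl exprn_ge0.
    by rewrite ger0_norm ?subr_ge0// lerXn2r ?nnegrE ?subr_ge0// gerBl.
  apply: (@le_trans _ _ (l ^+ 3)); last by rewrite lerDr exprn_ge0.
  by rewrite distrC ger0_norm ?subr_ge0// lerXn2r ?nnegrE ?subr_ge0// gerBl.
have mY : measurable_fun setT (fun w => `|Y w| ^+ 3).
  apply: measurable_funX; apply: measurableT_comp => //.
  by apply: measurable_funB => //; exact: measurable_funX.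
have L : L1 P (fun w => `|Y w| ^+ 3).
  apply: L1_le mY (hasE_L1 B) _ => w; rewrite ger0_norm ?exprn_ge0//; exact: le.
exists (Ex P (fun w => `|Y w| ^+ 3)); first exact: hasE_Ex.
apply: le_trans (hasE_le (hasE_Ex L) B le) _.
by rewrite le_eqVlt; apply/orP; left; apply/eqP; ring.
Qed.

(** Third-order Taylor expansion: [Y] has mean zero, variance [2 l^2] and third
absolute moment at most [16 l^3]. *)
Lemma sqc_cos_close :
  `|Ex P (fun w => sqc 0 (V w)) - expR (- (t ^+ 2 * l ^+ 2))| <=
  32 * (`|t| * l) ^+ 3 + (t * l) ^+ 4.
Proof.
have [v EY3v v16] := EY3.
have E1 : hasE P (fun w => 1 - (t * Y w) ^+ 2 / 2) (1 - t ^+ 2 * l ^+ 2).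
  have := hasED (hasE_cst P 1) (hasEZ (- (t ^+ 2 / 2)) EY2).
  rewrite (_ : _ * (2 * _) = - (t ^+ 2 * l ^+ 2)); last by field.
  by apply: hasE_ext => w; field.
have le w : `|sqc 0 (V w) - (1 - (t * Y w) ^+ 2 / 2)| <= 2 * `|t| ^+ 3 * `|Y w| ^+ 3.
  apply: le_trans (_ : 2 * `|t * Y w| ^+ 3 <= _).
    by rewrite /sqc addr0; exact: cos_taylor.
  by rewrite normrM exprMn mulrA.
have h1 := hasE_norm_le (hasEB (hasE_Ex (sqc_L1 0)) E1) (hasEZ _ EY3v) le.
have y0 : 0 <= t ^+ 2 * l ^+ 2 by rewrite mulr_ge0 ?sqr_ge0.
have h2 := expRN_taylor y0.
have h3 : 2 * `|t| ^+ 3 * v <= 32 * (`|t| * l) ^+ 3.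
  rewrite exprMn (_ : 32 * _ = 2 * `|t| ^+ 3 * (16 * l ^+ 3)); last by ring.
  by apply: ler_wpM2l => //; rewrite mulr_ge0// exprn_ge0.
have h4 : (t ^+ 2 * l ^+ 2) ^+ 2 = (t * l) ^+ 4 by ring.
move: h1 h2; rewrite h4 !ler_norml => /andP[? ?] /andP[? ?].
by apply/andP; split; move: h3; lra.
Qed.

Lemma sqc_sin_small : `|Ex P (fun w => sqc (- (pi / 2)) (V w))| <= 32 * (`|t| * l) ^+ 3.
Proof.
have [v EY3v v16] := EY3.
have E1 := hasEZ t EY; rewrite mulr0 in E1.
have le w : `|sqc (- (pi / 2)) (V w) - t * Y w| <= `|t| ^+ 3 * `|Y w| ^+ 3.
  rewrite -exprMn -normrM.
  have -> : sqc (- (pi / 2)) (V w) = sin (t * Y w).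
    by rewrite /sqc cosD cosN sinN cos_pihalf sin_pihalf mulr0 add0r mulrN mulr1 opprK.
  exact: sin_taylor.
have := hasE_norm_le (hasEB (hasE_Ex (sqc_L1 _)) E1) (hasEZ _ EY3v) le.
rewrite subr0 => /le_trans; apply.
rewrite exprMn (_ : 32 * _ = `|t| ^+ 3 * (32 * l ^+ 3)); last by ring.
apply: ler_wpM2l; first by rewrite exprn_ge0.
by apply: le_trans v16 _; apply: ler_wpM2r; rewrite ?exprn_ge0// ler_nat.
Qed.

End one_variable.
End quadratic_form.

(** * A central limit theorem for sums of Gaussian squares *)

Section sum_of_squares.
Context {R : realType} {d : measure_display} {T : measurableType d}.
Variables (P : probability T R) (n : nat) (G : nat -> T -> R) (lam : nat -> R).

Definition lin (c : nat -> R) (w : T) : R := \sum_(i < n) c i * G i w.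
Definition linvar (c : nat -> R) : R := \sum_(i < n) c i ^+ 2 * lam i.

Hypothesis gG : forall c, cgauss P (lin c) (linvar c).

(** Changing the coefficient of [G k] in a linear form. *)
Definition upd (c : nat -> R) (k : nat) (s : R) : nat -> R :=
  fun i => if i == k then s else c i.

Let lin_upd c k s w : (k < n)%N -> c k = 0 ->
  lin (upd c k s) w = lin c w + s * G k w.
Proof.
move=> kn ck; rewrite /lin (bigD1 (Ordinal kn))//= [in RHS](bigD1 (Ordinal kn))//=.
rewrite {1}/upd eqxx ck mul0r add0r addrC; congr (_ + _).
by apply: eq_bigr => i /negbTE ik; rewrite /upd; move: ik; rewrite -val_eqE /= => ->.
Qed.

Let linvar_upd c k s : (k < n)%N -> c k = 0 ->
  linvar (upd c k s) = linvar c + s ^+ 2 * lam k.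
Proof.
move=> kn ck; rewrite /linvar (bigD1 (Ordinal kn))//= [in RHS](bigD1 (Ordinal kn))//=.
rewrite {1}/upd eqxx ck expr0n mul0r add0r addrC; congr (_ + _).
by apply: eq_bigr => i /negbTE ik; rewrite /upd; move: ik; rewrite -val_eqE /= => ->.
Qed.

Let lin0 w : lin (fun=> 0) w = 0.
Proof. by rewrite /lin big1// => i _; rewrite mul0r. Qed.

Let linvar0 : linvar (fun=> 0) = 0.
Proof. by rewrite /linvar big1// => i _; rewrite expr0n mul0r. Qed.

Let gGk k : (k < n)%N -> cgauss P (G k) (lam k).
Proof.
move=> kn; have := gG (upd (fun=> 0) k 1); rewrite linvar_upd//.
rewrite linvar0 add0r expr1n mul1r.
suff -> : lin (upd (fun=> 0) k 1) = G k by [].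
by apply/funext => w; rewrite lin_upd// lin0 add0r mul1r.
Qed.

Let mG k : (k < n)%N -> measurable_fun setT (G k).
Proof. by move=> /gGk; case=> -[]. Qed.

Let mlin c : measurable_fun setT (lin c).
Proof. by case: (gG c) => -[]. Qed.

Variable t : R.

Definition sqsum (k : nat) (w : T) : R := \sum_(i < k) (G i w ^+ 2 - lam i).

Let msqsum k : (k <= n)%N -> measurable_fun setT (sqsum k).
Proof.
move=> kn; rewrite /sqsum; apply: measurable_sum => i.
apply: measurable_funB => //; apply: measurable_funX; apply: mG.
exact: leq_trans (ltn_ord i) kn.
Qed.

Let cosS k tau w : R := cos (t * sqsum k w + tau).

Let mcosS k tau : (k <= n)%N -> measurable_fun setT (cosS k tau).
Proof.
move=> kn; apply: measurable_cosT; apply: measurable_funD => //.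
by apply: measurable_funM => //; exact: msqsum.
Qed.

Let mcosL c th : measurable_fun setT (fun w => cos (lin c w + th)).
Proof. by apply: measurable_cosT; exact: measurable_funD. Qed.

Let bmul2 (f g : T -> R) : measurable_fun setT f -> measurable_fun setT g ->
  (forall w, `|f w| <= 1) -> (forall w, `|g w| <= 1) -> L1 P (fun w => f w * g w).
Proof.
move=> mf mg f1 g1; apply: (L1_bounded P (C := 1)); first exact: measurable_funM.
by move=> w; rewrite normrM -[leRHS]mulr1; apply: ler_pM.
Qed.

Definition cf (k : nat) (tau : R) : R := Ex P (fun w => cos (t * sqsum k w + tau)).

(** The joint characteristic function of [sqsum k] and of a linear form in the
remaining variables factors. Only characteristic functions of linear forms are
known, so independence is replaced by this factorization. *)
Let decoupled k := forall c th tau, (forall i, (i < k)%N -> c i = 0) ->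
  Ex P (fun w => cosS k tau w * cos (lin c w + th)) =
  cf k tau * (expR (- (linvar c / 2)) * cos th).

Let linear_cf c th : hasE P (fun w => cos (lin c w + th))
  (expR (- (linvar c / 2)) * cos th).
Proof.
case: (gG c) => _ _ _ _ /(_ 1 th); rewrite expr1n mul1r.
by apply: hasE_ext => w; rewrite mul1r.
Qed.

Let decoupled0 : decoupled 0.
Proof.
move=> c th tau _.
have E0 w : cosS 0 tau w = cos tau by rewrite /cosS /sqsum big_ord0 mulr0 add0r.
have -> : cf 0 tau = cos tau.
  rewrite /cf -[RHS](hasE_eq (hasE_cst P (cos tau))).
  by apply: eq_Rintegral => w _; exact: E0.
rewrite -(hasE_eq (hasEZ (cos tau) (linear_cf c th))).
by apply: eq_Rintegral => w _; rewrite E0.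
Qed.

Let prod_cos (a b : R) : cos a * cos b = 2^-1 * (cos (a + b) + cos (a - b)).
Proof. by rewrite cosD cosB; field. Qed.

(** The weight [cos (t S_k + tau) cos (lin c + th)] and the variable [G k]
have a product characteristic function, so that [fourier_orthogonal] lets
functions of [G k] be averaged separately. *)
Let peel k c th tau om : (k < n)%N -> decoupled k -> (forall i, (i <= k)%N -> c i = 0) ->
  hasE P (fun w => cosS k tau w * cos (lin c w + th) * sqc (lam k) t om (G k w))
    (cf k tau * (expR (- (linvar c / 2)) * cos th) *
     Ex P (fun w => sqc (lam k) t om (G k w))).
Proof.
move=> kn dec c0; have ck : c k = 0 by exact: c0.
have c0' i : (i < k)%N -> c i = 0 by move=> ik; apply: c0; exact: ltnW.
set K0 := fun w => cosS k tau w * cos (lin c w + th).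
set C0 := cf k tau * _.
have gk := gGk kn.
have mK0 : measurable_fun setT K0 by apply: measurable_funM => //; apply: mcosS; exact: ltnW.
have K01 w : `|K0 w| <= 1.
  by rewrite normrM -[leRHS]mulr1; apply: ler_pM => //; exact: cos_abs_le1.
have Lk om' : L1 P (fun w => sqc (lam k) t om' (G k w)) by exact: sqc_L1 gk _.
have EV s tau' : hasE P (fun w => cos (s * G k w + tau'))
    (expR (- (s ^+ 2 * lam k / 2)) * cos tau') by case: gk.
have F0 s tau' : Ex P (fun w => (K0 w - C0) * cos (s * G k w + tau')) = 0.
  have EK : hasE P (fun w => K0 w * cos (s * G k w + tau'))
      (C0 * (expR (- (s ^+ 2 * lam k / 2)) * cos tau')).
    have L s' th' : L1 P (fun w => cosS k tau w * cos (lin (upd c k s') w + th')).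
      by apply: bmul2 => //; [apply: mcosS; exact: ltnW|move=> w; exact: cos_abs_le1..].
    have dec' s' th' : hasE P (fun w => cosS k tau w * cos (lin (upd c k s') w + th'))
        (cf k tau * (expR (- ((linvar c + s' ^+ 2 * lam k) / 2)) * cos th')).
      split; first exact: L.
      rewrite -linvar_upd//; apply: dec => i ik.
      by rewrite /upd ltn_eqF// c0'.
    have := hasEZ 2^-1 (hasED (dec' s (th + tau')) (dec' (- s) (th - tau'))).
    rewrite sqrrN (_ : 2^-1 * _ = C0 * (expR (- (s ^+ 2 * lam k / 2)) * cos tau')).
      apply: hasE_ext => w; rewrite /K0 !lin_upd// -mulrA prod_cos.
      rewrite (_ : lin c w + - s * G k w + (th - tau') =
        lin c w + th - (s * G k w + tau')); last by ring.
      rewrite (_ : lin c w + s * G k w + (th + tau') =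
        lin c w + th + (s * G k w + tau')); last by ring.
      by ring.
    rewrite /C0 mulrDl opprD expRD cosD cosB; by field.
  have := hasEB EK (hasEZ C0 (EV s tau')); rewrite subrr => /hasE_eq <-.
  by apply: eq_Rintegral => w _; rewrite mulrBl.
have V2 : hasE P (fun w => G k w ^+ 2) (lam k) by case: gk => _ [].
have KC w : `|K0 w - C0| <= 1 + `|C0|.
  by apply: le_trans (ler_normB _ _) _; rewrite lerD2r.
have := fourier_orthogonal (measurable_sqc (lam k) t om)
  (fun x => cos_abs_le1 _) (measurable_funB mK0 (measurable_cst C0)) (mG kn) KC V2
  (sqc_quad_lipschitz (lam k) t om) F0.
move=> /hasED /(_ (hasEZ C0 (hasE_Ex (Lk om)))); rewrite add0r.
by apply: hasE_ext => w; rewrite /K0 /=; ring.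
Qed.

(** Expanding [cos (x + y)] with [x] built from [sqsum k] and [y] from [G k]
produces two terms, with phases shifted by [pi / 2]. *)
Let cf_rec k c th tau : (k < n)%N -> decoupled k -> (forall i, (i <= k)%N -> c i = 0) ->
  Ex P (fun w => cosS k.+1 tau w * cos (lin c w + th)) =
  (cf k tau * Ex P (fun w => sqc (lam k) t 0 (G k w)) -
   cf k (tau - pi / 2) * Ex P (fun w => sqc (lam k) t (- (pi / 2)) (G k w))) *
  (expR (- (linvar c / 2)) * cos th).
Proof.
move=> kn dec c0.
have := hasEB (peel th tau 0 kn dec c0) (peel th (tau - pi / 2) (- (pi / 2)) kn dec c0).
move=> /hasE_eq; rewrite (_ : cf k tau * _ * _ - _ = (cf k tau * Ex P (fun w => sqc (lam k) t 0 (G k w)) -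
   cf k (tau - pi / 2) * Ex P (fun w => sqc (lam k) t (- (pi / 2)) (G k w))) *
  (expR (- (linvar c / 2)) * cos th)); last by ring.
move=> <-; apply: eq_Rintegral => w _.
have shift (x : R) : cos (x - pi / 2) = sin x.
  by rewrite cosB cos_pihalf sin_pihalf mulr0 add0r mulr1.
rewrite /sqc addr0 shift /cosS addrA shift.
have -> : t * sqsum k.+1 w + tau = t * sqsum k w + tau + t * (G k w ^+ 2 - lam k).
  by rewrite /sqsum big_ord_recr /=; ring.
by rewrite (cosD (t * sqsum k w + tau)); ring.
Qed.

Let cfE k tau : (k < n)%N -> decoupled k ->
  cf k.+1 tau = cf k tau * Ex P (fun w => sqc (lam k) t 0 (G k w)) -
   cf k (tau - pi / 2) * Ex P (fun w => sqc (lam k) t (- (pi / 2)) (G k w)).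
Proof.
move=> kn dec; have := @cf_rec k (fun=> 0) 0 tau kn dec (fun _ _ => erefl).
rewrite linvar0 mul0r oppr0 expR0 cos0 !mulr1 => <-.
by apply: eq_Rintegral => w _; rewrite lin0 addr0 cos0 mulr1.
Qed.

Let decoupledE k : (k <= n)%N -> decoupled k.
Proof.
elim: k => [|k IH] kn; first exact: decoupled0.
have dec := IH (ltnW kn) => c th tau c0.
by rewrite (cfE tau kn dec) (cf_rec th tau kn dec).
Qed.

Let cf_le1 k tau : (k <= n)%N -> `|cf k tau| <= 1.
Proof.
move=> kn; apply: hasE_norm_le (hasE_Ex _) (hasE_cst P 1) _.
  by apply: (L1_bounded P (C := 1)) (mcosS tau kn) _ => w; exact: cos_abs_le1.
by move=> w; exact: cos_abs_le1.
Qed.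

(** Replacing the squares one at a time by their Gaussian approximation. *)
Lemma sqsum_charfun tau :
  `|Ex P (fun w => cos (t * sqsum n w + tau)) -
    expR (- (t ^+ 2 * \sum_(i < n) lam i ^+ 2)) * cos tau| <=
  \sum_(i < n) (64 * (`|t| * lam i) ^+ 3 + (t * lam i) ^+ 4).
Proof.
rewrite -/(cf n tau).
suff H k : (k <= n)%N -> forall tau,
    `|cf k tau - expR (- (t ^+ 2 * \sum_(i < k) lam i ^+ 2)) * cos tau| <=
    \sum_(i < k) (64 * (`|t| * lam i) ^+ 3 + (t * lam i) ^+ 4) by exact: H.
elim: k => [|k IH] kn {}tau.
  rewrite !big_ord0 mulr0 oppr0 expR0 mul1r /cf.
  have -> : (fun w => cos (t * sqsum 0 w + tau)) = fun=> cos tau.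
    by apply/funext => w; rewrite /sqsum big_ord0 mulr0 add0r.
  by rewrite (hasE_eq (hasE_cst P _)) subrr normr0.
rewrite (cfE tau kn (decoupledE (ltnW kn))) !big_ord_recr /=.
set u := Ex P _; set v := Ex P _.
have hu := sqc_cos_close t (gGk kn); have hv := sqc_sin_small t (gGk kn).
rewrite -/u in hu; rewrite -/v in hv.
have h1 := cf_le1 tau (ltnW kn); have h2 := cf_le1 (tau - pi / 2) (ltnW kn).
have h3 := IH (ltnW kn) tau.
rewrite mulrDr opprD expRD.
set e1 := expR (- (t ^+ 2 * \sum_(i < k) _)) in h3 *; set e2 := expR _.
rewrite -/e2 in hu.
have e21 : 0 <= e2 <= 1.
  by rewrite expR_ge0 /= -expR0 ler_expR oppr_le0 mulr_ge0 ?sqr_ge0.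
have -> : cf k tau * u - cf k (tau - pi / 2) * v - e1 * e2 * cos tau =
   cf k tau * (u - e2) - cf k (tau - pi / 2) * v + (cf k tau - e1 * cos tau) * e2 by ring.
have t1 : `|(cf k tau - e1 * cos tau) * e2| <=
    \sum_(i < k) (64 * (`|t| * lam i) ^+ 3 + (t * lam i) ^+ 4).
  rewrite normrM [`|e2|]ger0_norm; last by case/andP: e21.
  by apply: le_trans h3; rewrite ler_piMr//; case/andP: e21.
have h4 : `|cf k tau| * `|u - e2| <= `|u - e2| by rewrite ler_piMl.
have h5 : `|cf k (tau - pi / 2)| * `|v| <= `|v| by rewrite ler_piMl.
apply: le_trans (ler_normD _ _) _; rewrite [leRHS]addrC; apply: lerD => //.
apply: le_trans (ler_normB _ _) _; rewrite !normrM.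
apply: le_trans (lerD h4 h5) _; apply: le_trans (lerD hu hv) _.
by rewrite le_eqVlt; apply/orP; left; apply/eqP; ring.
Qed.

End sum_of_squares.

Section clt.
Context {R : realType} {d : measure_display} {T : measurableType d}.

(** The third powers that control the error are interpolated between the second
and the fourth: [lam^3 <= (eps lam^2 + lam^4 / eps) / 2]. *)
Lemma sqsum_charfun_close (P : probability T R) n (G : nat -> T -> R)
    (lam : nat -> R) (eps : R) :
  (forall c, cgauss P (lin n G c) (linvar n lam c)) ->
  (forall i, 0 <= lam i) -> \sum_(i < n) lam i ^+ 2 = 2^-1 ->
  0 < eps <= 1 -> \sum_(i < n) lam i ^+ 4 <= eps ^+ 2 ->
  charfun_close P (sqsum G lam n) (129 * eps).
Proof.
move=> gG l0 l2 /andP[e0 e1] l4 s tau.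
have l3 : \sum_(i < n) lam i ^+ 3 <= eps.
  apply: (@le_trans _ _ (\sum_(i < n) (eps / 2 * lam i ^+ 2 + (2 * eps)^-1 * lam i ^+ 4))).
    apply: ler_sum => i _.
    rewrite (_ : _ + _ = lam i ^+ 3 + (2 * eps)^-1 * (lam i * (lam i - eps)) ^+ 2).
      by rewrite lerDl mulr_ge0 ?sqr_ge0// invr_ge0 mulr_ge0// ltW.
    by field; exact: lt0r_neq0.
  rewrite big_split /= -!mulr_sumr l2.
  have : (2 * eps)^-1 * \sum_(i < n) lam i ^+ 4 <= (2 * eps)^-1 * eps ^+ 2.
    by apply: ler_wpM2l => //; rewrite invr_ge0 mulr_ge0// ltW.
  have -> : (2 * eps)^-1 * eps ^+ 2 = eps / 2 by field; exact: lt0r_neq0.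
  by lra.
have := sqsum_charfun gG s tau; rewrite l2 => /le_trans; apply.
rewrite big_split /= -mulr_sumr.
have -> : \sum_(i < n) (`|s| * lam i) ^+ 3 = `|s| ^+ 3 * \sum_(i < n) lam i ^+ 3.
  by rewrite mulr_sumr; apply: eq_bigr => i _; rewrite exprMn.
have -> : \sum_(i < n) (s * lam i) ^+ 4 = s ^+ 4 * \sum_(i < n) lam i ^+ 4.
  by rewrite mulr_sumr; apply: eq_bigr => i _; rewrite exprMn.
have s4 : s ^+ 4 = `|s| ^+ 4.
  by rewrite -normrX ger0_norm// (_ : s ^+ 4 = (s ^+ 2) ^+ 2) ?sqr_ge0// -exprM.
rewrite s4; set a := `|s|; have a0 : 0 <= a := normr_ge0 s.
have a3 : a ^+ 3 <= 1 + a ^+ 4.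
  have [a1|/ltW a1] := leP a 1.
    by apply: le_trans (exprn_ile1 _ a0 a1) _; rewrite lerDl exprn_ge0.
  apply: (@le_trans _ _ (a ^+ 4)); first by rewrite ler_weXn2l.
  by rewrite lerDr.
have e2 : eps ^+ 2 <= eps by rewrite expr2 ler_piMl// ltW.
have h1 : a ^+ 3 * \sum_(i < n) lam i ^+ 3 <= (1 + a ^+ 4) * eps.
  by apply: ler_pM => //; rewrite ?exprn_ge0// sumr_ge0// => i _; rewrite exprn_ge0.
have h2 : a ^+ 4 * \sum_(i < n) lam i ^+ 4 <= (1 + a ^+ 4) * eps.
  apply: ler_pM; rewrite ?exprn_ge0//.
  - by rewrite sumr_ge0// => i _; rewrite exprn_ge0.
  - by rewrite lerDr.
  - exact: le_trans l4 e2.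
have h3 : 0 <= (1 + a ^+ 4) * eps by rewrite mulr_ge0 ?addr_ge0 ?exprn_ge0// ltW.
lra.
Qed.

End clt.

(** * Independence, covariance and fourth moments *)

Section independence.
Context {R : realType} {d : measure_display} {T : measurableType d}.
Variables (P : probability T R) (a b : T -> R).
Hypotheses (ma : measurable_fun setT a) (mb : measurable_fun setT b).
Hypothesis indep : forall A B : set R, measurable A -> measurable B ->
  P (a @^-1` A `&` b @^-1` B) = (P (a @^-1` A) * P (b @^-1` B))%E.

Let af : {mfun T >-> R} := HB.pack a (isMeasurableFun.Build _ _ _ _ _ ma).
Let bf : {mfun T >-> R} := HB.pack b (isMeasurableFun.Build _ _ _ _ _ mb).
Let Pa : probability (R) R := distribution P af.
Let Pb : probability (R) R := distribution P bf.

Let push (c : {mfun T >-> R}) (h : R -> R) v :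
  measurable_fun setT h -> hasE P (fun w => h (c w)) v -> hasE (distribution P c) h v.
Proof.
move=> mh hv; have mhE : measurable_fun setT (EFin \o h) by exact/measurable_EFinP.
have mc : measurable_fun setT (c : T -> _) by [].
have Lc : P.-integrable ((c : T -> _) @^-1` setT) ((EFin \o h) \o c) by exact: (hasE_L1 hv).
apply: hasE_of_integral; first exact: integrable_pushforward mhE Lc measurableT.
by rewrite (@integral_pushforward _ _ _ _ _ c mc)// preimage_setT; exact: hasE_integral hv.
Qed.

(** The joint law is the product of the marginal laws, so that Fubini's theorem
applies. *)
Lemma indep_charfun u v :
  (forall th, hasE P (fun w => cos (a w + th)) (u * cos th)) ->
  (forall th, hasE P (fun w => cos (b w + th)) (v * cos th)) ->
  hasE P (fun w => cos (a w + b w)) (u * v).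
Proof.
move=> ha hb.
pose Z w : R * R := (a w, b w).
have mZ : measurable_fun setT Z by apply: measurable_fun_pair.
pose Zf : {mfun T >-> (R * R)%type} :=
  HB.pack Z (isMeasurableFun.Build _ _ _ _ _ mZ).
have lawZ B : measurable B -> P (Z @^-1` B) = (Pa \x Pb)%E B.
  move=> mB; apply/esym.
  apply: (@product_measure_unique _ _ _ _ _ Pa Pb (pushforward P Zf)) => //.
pose f (z : R * R) : R := cos (z.1 + z.2).
have mf : measurable_fun setT f.
  by apply: measurable_cosT; apply: measurable_funD; [exact: measurable_fst|exact: measurable_snd].
have f1 z : `|f z| <= 1 by exact: cos_abs_le1.
have mth (th : R) : measurable_fun setT (fun x : R => cos (x + th)).
  by apply: measurable_cosT; exact: measurable_funD.
have Ea th : hasE Pa (fun x => cos (x + th)) (u * cos th) by exact: (@push af _ _ (mth th) (ha th)).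
have Eb th : hasE Pb (fun x => cos (x + th)) (v * cos th) by exact: (@push bf _ _ (mth th) (hb th)).
have Lx x : L1 Pb (fun y => f (x, y)).
  have := hasE_L1 (Eb x); rewrite /f /=; congr L1.
  by apply/funext => y; rewrite addrC.
have Ly y : L1 Pa (fun x => f (x, y)) by exact: hasE_L1 (Ea y).
have fB x : \int[Pb]_y `|f (x, y)| <= 1.
  apply: (hasE_le (hasE_Ex (integrable_norm (Lx x)) : hasE Pb (fun y => `|f (x, y)|) _)
    (hasE_cst Pb 1)) => y; exact: f1.
have [I1 _ _] := fubini_real mf Lx Ly fB.
have LQ : L1 (Pa \x Pb)%E f by exact: (@L1_bounded _ _ _ (Pa \x Pb)%E 1 f mf f1).
have EQ : hasE (Pa \x Pb)%E f (u * v).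
  apply: hasE_of_integral => //.
  rewrite -integral12_prod_meas1//.
  have := hasE_integral (hasEZ v (Ea 0)); rewrite cos0 mulr1 mulrC => <-.
  apply: eq_integral => x _; rewrite addr0.
  rewrite -(hasE_integral (Eb x)); apply: eq_integral => y _.
  by rewrite /f /= addrC.
exact: (hasE_transfer mZ lawZ EQ).
Qed.

(** Independent variables spanning a Gaussian plane are uncorrelated: compare
the characteristic function of the sum with the product of the marginal ones. *)
Lemma indep_uncorrelated va vb c :
  cgauss P a va -> cgauss P b vb -> cgauss P (fun w => a w + b w) (va + vb + 2 * c) ->
  c = 0.
Proof.
move=> [_ _ _ _ ca] [_ _ _ _ cb] [_ _ _ _ cab].
have ca1 th : hasE P (fun w => cos (a w + th)) (expR (- (va / 2)) * cos th).
  by have := ca 1 th; rewrite expr1n mul1r; apply: hasE_ext => w; rewrite mul1r.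
have cb1 th : hasE P (fun w => cos (b w + th)) (expR (- (vb / 2)) * cos th).
  by have := cb 1 th; rewrite expr1n mul1r; apply: hasE_ext => w; rewrite mul1r.
have := cab 1 0; rewrite expr1n mul1r cos0 mulr1 => c1.
have c2 : hasE P (fun w => cos (a w + b w)) (expR (- ((va + vb + 2 * c) / 2))).
  by apply: hasE_ext c1 => w; rewrite mul1r addr0.
have := hasE_uniq c2 (indep_charfun ca1 cb1); rewrite -expRD => /expR_inj.
lra.
Qed.

End independence.

(** [GS] is a linear space of functions that are all centered Gaussian, that is,
a jointly Gaussian family. *)
Section isserlis.
Context {R : realType} {d : measure_display} {T : measurableType d}.
Variables (P : probability T R) (GS : (T -> R) -> Prop).
Hypothesis GSD : forall f g, GS f -> GS g -> GS (fun w => f w + g w).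
Hypothesis GSZ : forall k f, GS f -> GS (fun w => k * f w).
Hypothesis GSg : forall f, GS f -> exists v, cgauss P f v.

Definition cov (f g : T -> R) : R := Ex P (fun w => f w * g w).

Let sq f : GS f -> hasE P (fun w => f w ^+ 2) (cov f f) /\ cgauss P f (cov f f).
Proof.
move=> /GSg[v gv]; have h : hasE P (fun w => f w ^+ 2) v by case: gv => _ [].
have : hasE P (fun w => f w * f w) v by apply: hasE_ext h => w; rewrite expr2.
by move=> /hasE_eq; rewrite -/(cov f f) => ->.
Qed.

Lemma GS_cov f g : GS f -> GS g -> hasE P (fun w => f w * g w) (cov f g).
Proof.
move=> Gf Gg; apply: hasE_Ex.
have [h1 _] := sq Gf; have [h2 _] := sq Gg; have [h3 _] := sq (GSD Gf Gg).
have := hasE_L1 (hasEZ 2^-1 (hasEB h3 (hasED h1 h2))); congr L1.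
by apply/funext => w; field.
Qed.

Lemma GS_cgauss f : GS f -> cgauss P f (cov f f).
Proof. by move=> /sq[]. Qed.

Lemma covC f g : cov f g = cov g f.
Proof. by congr (Ex P _); apply/funext => w; rewrite mulrC. Qed.

(** By polarization, from the fourth moments of the sums [a +- b +- c +- e]. *)
Lemma isserlis a b c e : GS a -> GS b -> GS c -> GS e ->
  hasE P (fun w => a w * b w * (c w * e w))
    (cov a b * cov c e + cov a c * cov b e + cov a e * cov b c).
Proof.
move=> Ga Gb Gc Ge.
pose q s1 s2 s3 := cov a a + s1 ^+ 2 * cov b b + s2 ^+ 2 * cov c c + s3 ^+ 2 * cov e e +
  2 * (s1 * cov a b + s2 * cov a c + s3 * cov a e + s1 * s2 * cov b c +
       s1 * s3 * cov b e + s2 * s3 * cov c e).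
have E4 s1 s2 s3 : hasE P (fun w => (a w + s1 * b w + s2 * c w + s3 * e w) ^+ 4)
    (3 * q s1 s2 s3 ^+ 2).
  have G : GS (fun w => a w + s1 * b w + s2 * c w + s3 * e w).
    exact: (GSD (GSD (GSD Ga (GSZ s1 Gb)) (GSZ s2 Gc)) (GSZ s3 Ge)).
  have [h2 [_ _ h4 _ _]] := sq G.
  suff -> : q s1 s2 s3 = cov (fun w => a w + s1 * b w + s2 * c w + s3 * e w)
     (fun w => a w + s1 * b w + s2 * c w + s3 * e w) by [].
  apply: hasE_uniq h2.
  have := hasED (hasED (hasED (hasED (GS_cov Ga Ga) (hasEZ (s1 ^+ 2) (GS_cov Gb Gb)))
    (hasEZ (s2 ^+ 2) (GS_cov Gc Gc))) (hasEZ (s3 ^+ 2) (GS_cov Ge Ge)))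
    (hasEZ 2 (hasED (hasED (hasED (hasED (hasED (hasEZ s1 (GS_cov Ga Gb))
      (hasEZ s2 (GS_cov Ga Gc))) (hasEZ s3 (GS_cov Ga Ge)))
      (hasEZ (s1 * s2) (GS_cov Gb Gc))) (hasEZ (s1 * s3) (GS_cov Gb Ge)))
      (hasEZ (s2 * s3) (GS_cov Gc Ge)))).
  by apply: hasE_ext => w; ring.
(* The signed sum over the eight sign patterns is [192 (a b c e)]: the
   coefficient of [a b c e] in a fourth power is [24]. *)
have S := hasEZ 192^-1 (hasED
  (hasEB (hasEB (E4 1 1 1) (E4 1 1 (-1))) (hasEB (E4 1 (-1) 1) (E4 1 (-1) (-1))))
  (hasEB (hasEB (E4 (-1) (-1) 1) (E4 (-1) (-1) (-1)))
         (hasEB (E4 (-1) 1 1) (E4 (-1) 1 (-1))))).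
move: S; rewrite (_ : 192^-1 * _ =
  cov a b * cov c e + cov a c * cov b e + cov a e * cov b c); last first.
  by rewrite /q; field.
by apply: hasE_ext => w; field.
Qed.

End isserlis.

(** * Quadratic forms in a Gaussian process *)

Section quadratic_forms.
Context {R : realType} {d : measure_display} {T : measurableType d}.
Variables (P : probability T R) (GS : (T -> R) -> Prop).
Hypothesis GSD : forall f g, GS f -> GS g -> GS (fun w => f w + g w).
Hypothesis GSZ : forall k f, GS f -> GS (fun w => k * f w).
Hypothesis GSg : forall f, GS f -> exists v, cgauss P f v.

Lemma quadratic_form_moments (I : finType) (c : I -> R) (f g : I -> T -> R) :
  (forall x, GS (f x)) -> (forall x, GS (g x)) ->
  let Q w := \sum_x c x * (f x w * g x w) in
  let q := \sum_x c x * cov P (f x) (g x) in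
  hasE P Q q /\
  hasE P (fun w => (Q w - q) ^+ 2)
    (\sum_x \sum_y c x * c y *
       (cov P (f x) (f y) * cov P (g x) (g y) + cov P (f x) (g y) * cov P (g x) (f y))).
Proof.
move=> Gf Gg Q q.
have EQ : hasE P Q q.
  by apply: hasE_sum => x; apply: hasEZ; exact: GS_cov GSD GSg _ _ (Gf x) (Gg x).
split=> //.
have EQ2 : hasE P (fun w => Q w ^+ 2) (\sum_x \sum_y c x * c y *
    (cov P (f x) (g x) * cov P (f y) (g y) + cov P (f x) (f y) * cov P (g x) (g y) +
     cov P (f x) (g y) * cov P (g x) (f y))).
  have := hasE_sum (index_enum I) (fun x => hasE_sum (index_enum I) (fun y =>
     hasEZ (c x * c y) (isserlis GSD GSZ GSg (Gf x) (Gg x) (Gf y) (Gg y)))).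
  apply: hasE_ext => w; rewrite expr2 /Q mulr_suml; apply: eq_bigr => x _.
  by rewrite mulr_sumr; apply: eq_bigr => y _; rewrite mulrACA.
have := hasED (hasEB EQ2 (hasEZ (2 * q) EQ)) (hasE_cst P (q ^+ 2)).
rewrite (_ : _ + _ = \sum_x \sum_y c x * c y *
   (cov P (f x) (f y) * cov P (g x) (g y) + cov P (f x) (g y) * cov P (g x) (f y))).
  by apply: hasE_ext => w; ring.
have -> : \sum_x \sum_y c x * c y *
    (cov P (f x) (g x) * cov P (f y) (g y) + cov P (f x) (f y) * cov P (g x) (g y) +
     cov P (f x) (g y) * cov P (g x) (f y)) = q ^+ 2 + \sum_x \sum_y c x * c y *
   (cov P (f x) (f y) * cov P (g x) (g y) + cov P (f x) (g y) * cov P (g x) (f y)).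
  rewrite expr2 {1}/q mulr_suml -big_split /=; apply: eq_bigr => x _.
  rewrite /q mulr_sumr -big_split /=; apply: eq_bigr => y _; ring.
ring.
Qed.

Lemma cov_suml (I : finType) (c : I -> R) (f : I -> T -> R) g :
  (forall x, GS (f x)) -> GS g ->
  cov P (fun w => \sum_x c x * f x w) g = \sum_x c x * cov P (f x) g.
Proof.
move=> Gf Gg; apply: hasE_eq.
have := hasE_sum (index_enum I) (fun x => hasEZ (c x) (GS_cov GSD GSg (Gf x) Gg)).
by apply: hasE_ext => w; rewrite mulr_suml; apply: eq_bigr => x _; rewrite mulrA.
Qed.

Lemma cov_sum2 (I J : finType) (c : I -> R) (f : I -> T -> R) (e : J -> R) (g : J -> T -> R) :
  (forall x, GS (f x)) -> (forall y, GS (g y)) -> GS (fun w => \sum_y e y * g y w) ->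
  cov P (fun w => \sum_x c x * f x w) (fun w => \sum_y e y * g y w) =
  \sum_x \sum_y c x * e y * cov P (f x) (g y).
Proof.
move=> Gf Gg Ge; rewrite cov_suml//; apply: eq_bigr => x _.
rewrite covC cov_suml// mulr_sumr; apply: eq_bigr => y _.
by rewrite covC mulrA.
Qed.

End quadratic_forms.

(** The times at distance at most [M] from [i] form a window of [2 M + 1]
consecutive times. *)
Lemma count_window n M (i : nat) :
  (\sum_(j < n) (`|j.+1%:Z - i%:Z| <= M)%N <= M.*2.+1)%N.
Proof.
rewrite -[X in (X <= _)%N]big_mkcond sum1_card cardE -(size_map val).
rewrite -(size_iota (i - M.+1) M.*2.+1); apply: uniq_leq_size.
  by rewrite (map_inj_uniq val_inj) enum_uniq.
move=> k /mapP[j]; rewrite mem_enum => jM ->; rewrite mem_iota.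
by move: jM; rewrite unfold_in /=; lia.
Qed.

Lemma count_windowR (R : realType) n M (i : nat) :
  \sum_(j < n) ((`|j.+1%:Z - i%:Z| <= M)%N)%:R <= M.*2.+1%:R :> R.
Proof. by rewrite -natr_sum ler_nat; exact: count_window. Qed.

Section process.
Context {R : realType} {d : measure_display} {T : measurableType d}.
Context (P : probability T R) {p : nat} (X : nat -> {RV P >-> p.-tuple R}).
Variables (M : nat) (mu : 'cV[R]_p) (Gam : int -> 'M[R]_p).
Hypotheses (gaussX : gaussian_process X) (depX : m_dependent X M).
Hypotheses (meanX : has_mean X mu) (autocovX : has_autocov X M Gam).

Definition ctrd (t : nat) (i : 'I_p) (w : T) : R := vec X t w i 0 - mu i 0.
Local Notation Y := ctrd.

(** The linear span of the centered process: a space of jointly Gaussian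
variables that contains every linear statistic used below. *)
Definition gspace (Z : T -> R) : Prop := exists (N : nat) (a : nat -> 'cV[R]_p),
  Z = fun w => \sum_(t < N) \sum_i a t i 0 * Y t i w.

Lemma measurable_vec t i : measurable_fun setT (fun w => vec X t w i 0).
Proof.
rewrite (_ : (fun w => _) = (@tnth _ _ ^~ i) \o X t); last first.
  by apply/funext => w; rewrite /vec mxE.
by apply: measurableT_comp; [exact: measurable_tnth|exact: measurable_funP].
Qed.

Lemma measurable_ctrd t i : measurable_fun setT (Y t i).
Proof. by apply: measurable_funB => //; exact: measurable_vec. Qed.

Let comb_law N (a : nat -> 'cV[R]_p) : exists m s : R,
  hasE P (fun w => \sum_(t < N) \sum_i a t i 0 * vec X t w i 0) m /\
  cgauss P (fun w => \sum_(t < N) \sum_i a t i 0 * vec X t w i 0 - m) s.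
Proof.
have [m [s law]] := gaussX (fun t : 'I_N => a t).
have E : (fun w => \sum_(t < N) ((a t)^T *m vec X t w) 0 0) =
         (fun w => \sum_(t < N) \sum_i a t i 0 * vec X t w i 0).
  apply/funext => w; apply: eq_bigr => t _; rewrite mxE.
  by apply: eq_bigr => i _; rewrite mxE.
exists m, (s ^+ 2); apply: gaussian_law_cgauss.
  apply: measurable_sum => t; apply: measurable_sum => i.
  by apply: measurable_funM => //; exact: measurable_vec.
by move=> B mB; rewrite -law// -E.
Qed.

Lemma hasE_vec t i : hasE P (fun w => vec X t w i 0) (mu i 0).
Proof.
pose a (s : nat) : 'cV[R]_p := \col_j ((s == t) && (j == i))%:R.
have [m [s [hm _]]] := comb_law t.+1 a.
have {}hm : hasE P (fun w => vec X t w i 0) m.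
  apply: hasE_ext hm => w; rewrite big_ord_recr /= big1 ?add0r => [|s' _].
    rewrite (bigD1 i)//= big1 ?addr0 => [|j /negbTE ji].
      by rewrite mxE !eqxx mul1r.
    by rewrite mxE eqxx ji mul0r.
  by rewrite big1// => j _; rewrite mxE ltn_eqF// mul0r.
suff <- : m = mu i 0 by [].
have := meanX t i; rewrite unlock; have := hasE_integral hm => ->.
by case.
Qed.

Lemma gspace_cgauss Z : gspace Z -> exists v, cgauss P Z v.
Proof.
move=> [N [a ->]]; have [m [s [hm gm]]] := comb_law N a.
exists s; suff -> : (fun w => \sum_(t < N) \sum_i a t i 0 * Y t i w) =
  (fun w => \sum_(t < N) \sum_i a t i 0 * vec X t w i 0 - m) by [].
have E := hasE_sum (index_enum 'I_N) (fun t => hasE_sum (index_enum 'I_p)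
  (fun i => hasEZ (a t i 0) (hasE_vec t i))).
rewrite (hasE_uniq hm E); apply/funext => w; rewrite -sumrB.
by apply: eq_bigr => t _; rewrite -sumrB; apply: eq_bigr => i _; rewrite mulrBr.
Qed.

Let pad N N' (a : nat -> 'cV[R]_p) w : (N <= N')%N ->
  \sum_(t < N) \sum_i a t i 0 * Y t i w =
  \sum_(t < N') \sum_i (if (t < N)%N then a t else 0) i 0 * Y t i w.
Proof.
move=> NN; rewrite (big_ord_widen N' (fun t => \sum_i a t i 0 * Y t i w) NN).
rewrite big_mkcond; apply: eq_bigr => t _; case: ifP => // _.
by rewrite big1// => i _; rewrite mxE mul0r.
Qed.

Lemma gspaceD f g : gspace f -> gspace g -> gspace (fun w => f w + g w).
Proof.
move=> [N [a ->]] [N' [b ->]].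
exists (maxn N N'), (fun t => (if (t < N)%N then a t else 0) + (if (t < N')%N then b t else 0)).
apply/funext => w; rewrite (pad _ _ (leq_maxl N N')) (pad _ _ (leq_maxr N N')).
rewrite -big_split; apply: eq_bigr => t _; rewrite -big_split; apply: eq_bigr => i _.
by rewrite [in RHS]mxE mulrDl.
Qed.

Lemma gspaceZ k f : gspace f -> gspace (fun w => k * f w).
Proof.
move=> [N [a ->]]; exists N, (fun t => k *: a t); apply/funext => w.
rewrite mulr_sumr; apply: eq_bigr => t _; rewrite mulr_sumr; apply: eq_bigr => i _.
by rewrite mxE mulrA.
Qed.

Lemma gspace_ctrd t i : gspace (Y t i).
Proof.
exists t.+1, (fun s : nat => \col_j ((s == t) && (j == i))%:R); apply/funext => w.
rewrite big_ord_recr /= big1 ?add0r => [|s' _].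
  rewrite (bigD1 i)//= big1 ?addr0 => [|j /negbTE ji].
    by rewrite mxE !eqxx mul1r.
  by rewrite mxE eqxx ji mul0r.
by rewrite big1// => j _; rewrite mxE ltn_eqF// mul0r.
Qed.

Lemma gspace0 : gspace (fun=> 0).
Proof. by exists 0%N, (fun=> 0); apply/funext => w; rewrite big_ord0. Qed.

Lemma gspace_sum (I : Type) (r : seq I) (f : I -> T -> R) :
  (forall x, gspace (f x)) -> gspace (fun w => \sum_(x <- r) f x w).
Proof.
move=> Gf; elim: r => [|x r IH].
  by under eq_fun do rewrite big_nil; exact: gspace0.
by under eq_fun do rewrite big_cons; exact: gspaceD.
Qed.

Lemma gspace_comb (I : Type) (r : seq I) (c : I -> R) (f : I -> T -> R) :
  (forall x, gspace (f x)) -> gspace (fun w => \sum_(x <- r) c x * f x w).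
Proof. by move=> Gf; apply: gspace_sum => x; exact: gspaceZ. Qed.

Definition acov (s t : nat) : 'M[R]_p := \matrix_(i, j) cov P (Y s i) (Y t j).

Lemma acov_tr s t : (acov s t)^T = acov t s.
Proof. by apply/matrixP => i j; rewrite !mxE covC. Qed.

Lemma acov_near s t : (`|t%:Z - s%:Z| <= M)%N -> acov s t = Gam (t%:Z - s%:Z).
Proof.
move=> st; apply/matrixP => i j; rewrite mxE.
have := autocovX i j st; rewrite covariance.unlock !meanX unlock /=.
have := hasE_integral (GS_cov gspaceD gspace_cgauss (gspace_ctrd s i) (gspace_ctrd t j)).
by rewrite /ctrd => -> [].
Qed.

Let ctrd_sigma t i (A : set R) : measurable A -> exists B : set (p.-tuple R),
  measurable B /\ Y t i @^-1` A = X t @^-1` B.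
Proof.
move=> mA; pose g (x : p.-tuple R) := tnth x i - mu i 0.
have mg : measurable_fun setT g.
  by apply: measurable_funB => //; exact: measurable_tnth.
exists (g @^-1` A); split; first by rewrite -[X in measurable X]setTI; exact: mg.
by apply/seteqP; split=> w /=; rewrite /ctrd /g /vec mxE.
Qed.

(** Independence beyond lag [M] enters the proof only here. *)
Let acov_after s t : (s + M < t)%N -> acov s t = 0.
Proof.
move=> st; apply/matrixP => i j; rewrite !mxE.
have Ga := gspace_ctrd s i; have Gb := gspace_ctrd t j.
have ga := GS_cgauss gspace_cgauss Ga; have gb := GS_cgauss gspace_cgauss Gb.
have gab := GS_cgauss gspace_cgauss (gspaceD Ga Gb).
apply: (indep_uncorrelated (measurable_ctrd s i) (measurable_ctrd t j) _ ga gb).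
  move=> A B mA mB; apply: (depX (s := s)); apply: sub_sigma_algebra.
    by have [C [mC ->]] := ctrd_sigma s i mA; exists s, C; split => /=.
  by have [C [mC ->]] := ctrd_sigma t j mB; exists t, C; split => /=.
suff <- : cov P (fun w => Y s i w + Y t j w) (fun w => Y s i w + Y t j w) =
    cov P (Y s i) (Y s i) + cov P (Y t j) (Y t j) + 2 * cov P (Y s i) (Y t j) by [].
apply: hasE_eq.
have C f g Gf Gg := @GS_cov _ _ _ _ _ gspaceD gspace_cgauss f g Gf Gg.
have := hasED (hasED (C _ _ Ga Ga) (C _ _ Gb Gb)) (hasEZ 2 (C _ _ Ga Gb)).
by apply: hasE_ext => w; ring.
Qed.

Lemma acov_far s t : (M < `|t%:Z - s%:Z|)%N -> acov s t = 0.
Proof.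
move=> st; have [ts|ts] := leqP t s; last by apply: acov_after; lia.
by rewrite -acov_tr acov_after ?trmx0//; lia.
Qed.

(** Compare the covariances of times [0], [k] and [k], [0]. *)
Lemma Gam_tr (h : int) : (`|h| <= M)%N -> (Gam h)^T = Gam (- h).
Proof.
move=> hM.
have key k : (k <= M)%N -> (Gam k%:Z)^T = Gam (- k%:Z).
  move=> kM; have <- : acov 0 k = Gam k%:Z by rewrite acov_near ?subr0.
  by rewrite acov_tr acov_near sub0r// abszN.
case: (intP h) hM => [|k|k] hM; [exact: (key 0%N)|exact: (key k.+1)|].
by rewrite opprK -key ?trmxK// -[k.+1]abszN.
Qed.

Variable K : R.
Hypothesis GamK : forall h : int, (`|h| <= M)%N -> frob (Gam h) <= K.

Let K0 : 0 <= K.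
Proof. by apply: le_trans (GamK (h := 0) _) => //; exact: frob_ge0. Qed.

Lemma acov_inner_le s t s' t' : `|\tr (acov s t *m (acov s' t')^T)| <=
  K * ((`|t%:Z - s%:Z| <= M)%N && (`|t'%:Z - s'%:Z| <= M)%N)%:R.
Proof.
have [st|st] := leqP `|t%:Z - s%:Z|%N M; last first.
  by rewrite acov_far// mul0mx mxtrace0 normr0 mulr0.
have [st'|st'] := leqP `|t'%:Z - s'%:Z|%N M; last first.
  by rewrite [acov s' t']acov_far// trmx0 mulmx0 mxtrace0 normr0 mulr0.
rewrite mulr1; apply: le_trans (tr_mul_le _ _) _.
by rewrite !acov_near//; have := GamK st; have := GamK st'; lra.
Qed.

Lemma tr_acov s t s' t' : \tr (acov s t *m (acov s' t')^T) =
  \sum_i \sum_j cov P (Y s i) (Y t j) * cov P (Y s' i) (Y t' j).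
Proof.
apply: eq_bigr => i _; rewrite mxE; apply: eq_bigr => j _.
by rewrite !mxE.
Qed.

Lemma tr_acov1 s t : \tr (acov s t) = \sum_i cov P (Y s i) (Y t i).
Proof. by apply: eq_bigr => i _; rewrite mxE. Qed.

(** The variance of a quadratic form in the sample: by Isserlis it is a sum over
pairs of pairs of times, and a pair only interacts with the pairs whose times
are within distance [M]. *)
Lemma quadratic_variance_le (n : nat) (c : 'I_n -> 'I_n -> R) (cm ct : R) :
  0 <= cm -> (forall s u, `|c s u| <= cm) -> \sum_s \sum_u `|c s u| <= ct ->
  let Q w := \sum_s \sum_u c s u * \sum_i Y s.+1 i w * Y u.+1 i w in
  let q := \sum_s \sum_u c s u * \tr (acov s.+1 u.+1) in
  hasE P Q q /\ exists2 v, hasE P (fun w => (Q w - q) ^+ 2) v &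
    v <= 2 * K * (ct * cm * M.*2.+1%:R ^+ 2).
Proof.
move=> cm0 ccm cct Q q.
pose I := (('I_n * 'I_n) * 'I_p)%type.
pose f (x : I) := Y x.1.1.+1 x.2; pose g (x : I) := Y x.1.2.+1 x.2.
pose e (x : I) := c x.1.1 x.1.2.
have [] := quadratic_form_moments gspaceD gspaceZ gspace_cgauss e
  (fun x => gspace_ctrd x.1.1.+1 x.2 : gspace (f x))
  (fun x => gspace_ctrd x.1.2.+1 x.2 : gspace (g x)).
have flat (F : 'I_n -> 'I_n -> 'I_p -> R) :
    \sum_(x : I) F x.1.1 x.1.2 x.2 = \sum_s \sum_u \sum_i F s u i.
  rewrite -(pair_big xpredT xpredT (fun z i => F z.1 z.2 i)) /=.
  by rewrite -(pair_big xpredT xpredT (fun s u => \sum_i F s u i)).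
have QE w : \sum_x e x * (f x w * g x w) = Q w.
  rewrite (flat (fun s u i => c s u * (Y s.+1 i w * Y u.+1 i w))).
  by apply: eq_bigr => s _; apply: eq_bigr => u _; rewrite mulr_sumr.
have -> : \sum_x e x * cov P (f x) (g x) = q.
  rewrite (flat (fun s u i => c s u * cov P (Y s.+1 i) (Y u.+1 i))).
  by apply: eq_bigr => s _; apply: eq_bigr => u _; rewrite tr_acov1 mulr_sumr.
move=> EQ EV; split; first by apply: hasE_ext EQ => w; exact: QE.
eexists; first by apply: hasE_ext EV => w; rewrite QE.
pose w1 (s s' : 'I_n) : R := ((`|s'.+1%:Z - s.+1%:Z| <= M)%N)%:R.
have sw (s : 'I_n) : \sum_s' w1 s s' <= M.*2.+1%:R by exact: count_windowR.
have w0 s s' : 0 <= w1 s s' by rewrite /w1; case: (_ <= _)%N.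
pose D (s u s' u' : 'I_n) := \tr (acov s.+1 s'.+1 *m (acov u.+1 u'.+1)^T) +
  \tr (acov s.+1 u'.+1 *m (acov u.+1 s'.+1)^T).
have -> : \sum_x \sum_y e x * e y * (cov P (f x) (f y) * cov P (g x) (g y) +
      cov P (f x) (g y) * cov P (g x) (f y)) =
    \sum_s \sum_u \sum_s' \sum_u' c s u * c s' u' * D s u s' u'.
  rewrite (flat (fun s u i => \sum_(y : I) c s u * e y *
    (cov P (Y s.+1 i) (f y) * cov P (Y u.+1 i) (g y) +
     cov P (Y s.+1 i) (g y) * cov P (Y u.+1 i) (f y)))).
  apply: eq_bigr => s _; apply: eq_bigr => u _.
  under eq_bigr => i _ do rewrite (flat (fun s' u' j => c s u * c s' u' *
    (cov P (Y s.+1 i) (Y s'.+1 j) * cov P (Y u.+1 i) (Y u'.+1 j) +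
     cov P (Y s.+1 i) (Y u'.+1 j) * cov P (Y u.+1 i) (Y s'.+1 j)))).
  rewrite exchange_big; apply: eq_bigr => s' _.
  rewrite exchange_big; apply: eq_bigr => u' _.
  rewrite /D !tr_acov -big_split mulr_sumr /=; apply: eq_bigr => i _.
  by rewrite -big_split mulr_sumr.
have D_le s u s' u' : `|D s u s' u'| <= K * (w1 s s' * w1 u u' + w1 s u' * w1 u s').
  apply: le_trans (ler_normD _ _) _; rewrite mulrDr; apply: lerD.
    by apply: le_trans (acov_inner_le _ _ _ _) _; rewrite /w1 -natrM mulnb.
  by apply: le_trans (acov_inner_le _ _ _ _) _; rewrite /w1 -natrM mulnb.
apply: (@le_trans _ _ (\sum_s \sum_u `|c s u| * (cm * (2 * K * M.*2.+1%:R ^+ 2)))).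
  apply: ler_sum => s _; apply: ler_sum => u _.
  apply: (@le_trans _ _ (\sum_s' \sum_u' `|c s u| * (cm *
      (K * (w1 s s' * w1 u u' + w1 s u' * w1 u s'))))).
    apply: ler_sum => s' _; apply: ler_sum => u' _.
    apply: le_trans (ler_norm _) _; rewrite !normrM -mulrA.
    apply: ler_wpM2l => //; apply: ler_pM => //; exact: D_le.
  have -> : \sum_s' \sum_u' `|c s u| * (cm * (K * (w1 s s' * w1 u u' + w1 s u' * w1 u s'))) =
      `|c s u| * (cm * (K * (\sum_s' \sum_u' w1 s s' * w1 u u' +
         \sum_s' \sum_u' w1 s u' * w1 u s'))).
    rewrite -big_split /= !mulr_sumr; apply: eq_bigr => s' _.
    by rewrite -big_split /= !mulr_sumr.
  rewrite [X in _ + X]exchange_big /= -!big_distrlr /=.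
  apply: ler_wpM2l => //; apply: ler_wpM2l => //.
  rewrite (_ : 2 * K * _ = K * (M.*2.+1%:R ^+ 2 + M.*2.+1%:R ^+ 2)); last by ring.
  apply: ler_wpM2l => //.
  by apply: lerD; apply: ler_pM => //; apply: sumr_ge0.
under eq_bigr => s _ do rewrite -mulr_suml.
rewrite -mulr_suml [leRHS](_ : _ = ct * (cm * (2 * K * M.*2.+1%:R ^+ 2))); last by ring.
apply: ler_wpM2r => //.
by rewrite !mulr_ge0// exprn_ge0.
Qed.

End process.

(** * The weights of the trace estimator *)

Section theta.
Context {R : realType}.
Variables (n M : nat).
Hypothesis n0 : (0 < n)%N.

Let nR : n%:R != 0 :> R. Proof. by rewrite pnatr_eq0 -lt0n. Qed.
Let nR0 : 0 < n%:R :> R. Proof. by rewrite ltr0n. Qed.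

Lemma sum_eq_le1 (r : seq nat) (t : nat) : uniq r -> \sum_(s <- r) ((s == t)%:R : R) <= 1.
Proof.
move=> ur; have [tr|tr] := boolP (t \in r).
  rewrite (bigD1_seq t)//= eqxx big1 ?addr0// => s /negbTE ->; by [].
rewrite big1_seq ?ler01// => s /= sr; case: eqP => // st.
by move: sr; rewrite st (negbTE tr).
Qed.

Lemma ctr_abs_le1 (t s : nat) : `|ctr n t s : R| <= 1.
Proof.
rewrite /ctr; have h : n%:R^-1 <= 1 :> R by rewrite invf_le1// ler1n.
have h0 : 0 <= n%:R^-1 :> R by rewrite invr_ge0 ltW.
by case: eqP => _ /=; rewrite ler_norml; apply/andP; split; lra.
Qed.

Lemma ctr_sum_le (t : nat) : \sum_(1 <= s < n.+1) `|ctr n t s : R| <= 2.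
Proof.
apply: (@le_trans _ _ (\sum_(1 <= s < n.+1) ((s == t)%:R + n%:R^-1))).
  apply: ler_sum => s _; apply: le_trans (ler_normB _ _) _.
  by rewrite !ger0_norm// invr_ge0 ltW.
rewrite big_split /= sumr_const_nat subn1 /= -[n%:R^-1 *+ n]mulr_natl divff//.
have -> : 2 = 1 + 1 :> R by [].
by rewrite lerD2r; apply: sum_eq_le1; exact: iota_uniq.
Qed.

Lemma ctrC (t s : nat) : ctr n t s = ctr n s t :> R.
Proof. by rewrite /ctr eq_sym. Qed.

Lemma ctr_sum_part_le (s h : nat) : \sum_(1 <= t < (n - h).+1) `|ctr n t s : R| <= 2.
Proof.
apply: le_trans (ctr_sum_le s).
rewrite (@big_cat_nat _ _ _ (n - h).+1 1 n.+1) //=; last by rewrite ltnS leq_subr.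
under eq_bigr do rewrite ctrC.
by rewrite lerDl; apply: sumr_ge0.
Qed.

Lemma dist_count_le (r : seq nat) (s k : nat) : uniq r ->
  \sum_(u <- r) ((`|s%:Z - u%:Z|%N == k)%:R : R) <= 2.
Proof.
move=> ur; have -> : 2 = 1 + 1 :> R by [].
apply: le_trans (lerD (sum_eq_le1 (s + k) ur) (sum_eq_le1 (s - k) ur)).
rewrite -big_split /=; apply: ler_sum => u _.
rewrite -natrD ler_nat.
case: (`|s%:Z - u%:Z|%N =P k) => //= e.
have [->|->] : (u = s + k \/ u = s - k)%N; first by lia.
  by rewrite eqxx add1n.
by rewrite eqxx addn1.
Qed.

(** Multiplying out the two centering coefficients leaves a diagonal term and
three terms of order [n^-1]. *)
Lemma Theta_close (h k : 'I_M.+1) :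
  `|Theta n M h k - (h == k)%:R * (n - h)%:R / n%:R| <= 6 / n%:R :> R.
Proof.
rewrite mxE.
pose w (s u : nat) : R := (`|s%:Z - u%:Z|%N == k)%:R.
have w0 s u : 0 <= w s u by rewrite /w; case: (_ == _).
pose r := index_iota 1 n.+1.
have ur : uniq r by exact: iota_uniq.
have E t : (0 < t)%N -> (t + h <= n)%N ->
  \sum_(s <- r) \sum_(u <- r) ctr n t s * ctr n (t + h) u * w s u =
  (h == k)%:R - n%:R^-1 * (\sum_(u <- r) w t u) - n%:R^-1 * (\sum_(s <- r) w s (t + h)) +
    n%:R^-1 ^+ 2 * \sum_(s <- r) \sum_(u <- r) w s u.
  move=> t0 tn.
  have delta (v : nat) (F : nat -> R) : (0 < v <= n)%N -> \sum_(s <- r) (s == v)%:R * F s = F v.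
    move=> vn; rewrite (bigD1_seq v) ?mem_index_iota//= eqxx mul1r big1 ?addr0//.
    by move=> s /negbTE ->; rewrite mul0r.
  have in_u s : \sum_(u <- r) ctr n (t + h) u * w s u =
      w s (t + h) - n%:R^-1 * \sum_(u <- r) w s u.
    rewrite -(delta (t + h)%N (w s)); last by rewrite tn addn_gt0 t0.
    by rewrite mulr_sumr -sumrB; apply: eq_bigr => u _; rewrite -mulrBl.
  transitivity (\sum_(s <- r) ctr n t s * (w s (t + h) - n%:R^-1 * \sum_(u <- r) w s u)).
    by apply: eq_bigr => s _; rewrite -in_u mulr_sumr; apply: eq_bigr => u _; rewrite mulrA.
  transitivity (\sum_(s <- r) (s == t)%:R * (w s (t + h) - n%:R^-1 * \sum_(u <- r) w s u)
     - n%:R^-1 * \sum_(s <- r) (w s (t + h) - n%:R^-1 * \sum_(u <- r) w s u)).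
    by rewrite mulr_sumr -sumrB; apply: eq_bigr => s _; rewrite -mulrBl.
  rewrite delta; last by lia.
  rewrite sumrB -mulr_sumr {1}/w (_ : (`|t%:Z - (t + h)%N%:Z|%N == k) = (h == k)).
    by ring.
  by rewrite -val_eqE /=; congr (_ == _); lia.
have hn : (n - h)%:R <= n%:R :> R by rewrite ler_nat leq_subr.
rewrite (eq_big_nat _ _ (F2 := fun t => (h == k)%:R - n%:R^-1 * (\sum_(u <- r) w t u) -
    n%:R^-1 * (\sum_(s <- r) w s (t + h)) +
    n%:R^-1 ^+ 2 * \sum_(s <- r) \sum_(u <- r) w s u)); last first.
  by move=> t /andP[t0 tn]; apply: E => //; lia.
have -> : (h == k)%:R * (n - h)%:R / n%:R = n%:R^-1 *
   \sum_(1 <= t < (n - h).+1) (h == k)%:R :> R.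
  rewrite sumr_const_nat subn1 /= -[_ *+ (n - h)]mulr_natr; ring.
rewrite -mulrBr normrM ger0_norm ?invr_ge0 ?(ltW nR0)// mulrC.
rewrite ler_pM2r ?invr_gt0// -sumrB.
have c1 t : n%:R^-1 * (\sum_(u <- r) w t u) <= n%:R^-1 * 2.
  by apply: ler_wpM2l; [rewrite invr_ge0 ltW|exact: dist_count_le].
have c2 t : n%:R^-1 * (\sum_(s <- r) w s t) <= n%:R^-1 * 2.
  apply: ler_wpM2l; [by rewrite invr_ge0 ltW|].
  rewrite (eq_bigr (fun s => (`|t%:Z - s%:Z|%N == k)%:R)) ?dist_count_le// => s _.
  by rewrite /w; congr (_%:R); congr (_ == _); lia.
have c3 : n%:R^-1 ^+ 2 * (\sum_(s <- r) \sum_(u <- r) w s u) <= n%:R^-1 * 2.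
  rewrite expr2 -mulrA; apply: ler_wpM2l; first by rewrite invr_ge0 ltW.
  rewrite ler_pdivrMl//; apply: (@le_trans _ _ (\sum_(s <- r) 2)).
    by apply: ler_sum => s _; exact: dist_count_le.
  by rewrite sumr_const_nat subn1 /= -[2 *+ n]mulr_natl.
apply: le_trans (ler_norm_sum _ _ _) _.
apply: (@le_trans _ _ (\sum_(1 <= t < (n - h).+1) n%:R^-1 * 6)); last first.
  rewrite sumr_const_nat subn1 /= -[_ *+ (n - h)]mulr_natl mulrA.
  by rewrite ler_piMl// ler_pdivrMr// mul1r.
apply: ler_sum => t _.
have p1 : 0 <= n%:R^-1 * (\sum_(u <- r) w t u) by rewrite mulr_ge0 ?invr_ge0 ?(ltW nR0)// sumr_ge0.
have p2 : 0 <= n%:R^-1 * (\sum_(s <- r) w s (t + h)%N) by rewrite mulr_ge0 ?invr_ge0 ?(ltW nR0)// sumr_ge0.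
have p3 : 0 <= n%:R^-1 ^+ 2 * (\sum_(s <- r) \sum_(u <- r) w s u).
  by rewrite mulr_ge0 ?sqr_ge0// sumr_ge0// => s _; rewrite sumr_ge0.
rewrite ler_norml; have := c1 t; have := c2 (t + h)%N; move: c3 p1 p2 p3.
move: (n%:R^-1 * (\sum_(u <- r) w t u)) (n%:R^-1 * (\sum_(s <- r) w s (t + h)%N))
  (n%:R^-1 ^+ 2 * (\sum_(s <- r) \sum_(u <- r) w s u)) => x1 x2 x3.
by move=> *; apply/andP; split; lra.
Qed.

Let m : R := M.+1%:R.
Let rho : R := 7 * m / n%:R.
Let E : 'M[R]_M.+1 := Theta n M - 1%:M.

Lemma Theta_row_le (Mn : (M < n)%N) (h : 'I_M.+1) :
  \sum_k `|(Theta n M - 1%:M : 'M[R]_M.+1) h k| <= 7 * M.+1%:R / n%:R.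
Proof.
apply: (@le_trans _ _ (\sum_(k < M.+1) (6 / n%:R + (k == h)%:R * (M.+1%:R / n%:R)))).
  apply: ler_sum => k _; rewrite mxE [X in _ + X]mxE [X in _ - X]mxE.
  have -> : Theta n M h k - (h == k)%:R = (Theta n M h k - (h == k)%:R * (n - h)%:R / n%:R) -
     (k == h)%:R * (h%:R / n%:R) :> R.
    rewrite natrB; last by apply: leq_trans (ltnW Mn); rewrite -ltnS.
    by rewrite [k == h]eq_sym; field.
  apply: le_trans (ler_normB _ _) _; apply: lerD; first exact: Theta_close.
  rewrite ger0_norm ?mulr_ge0 ?invr_ge0//.
  by rewrite ler_wpM2l// ler_wpM2r ?invr_ge0// ler_nat ltnW.
rewrite big_split /= sumr_const card_ord (bigD1 h)//= eqxx mul1r.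
rewrite big1 ?addr0 => [|k /negbTE ->]; last by rewrite mul0r.
by rewrite -[_ *+ M.+1]mulr_natr le_eqVlt; apply/orP; left; apply/eqP; ring.
Qed.

Hypothesis n_large : (14 * M.+1 <= n)%N.

Let Mn : (M < n)%N. Proof. by move: n_large; lia. Qed.
Let rho_half : rho <= 2^-1.
Proof.
rewrite /rho /m ler_pdivrMr// ler_pdivlMl// mulrA -natrM -natrM ler_nat.
by move: n_large; lia.
Qed.

(** Once [n >= 14 (M + 1)], the rows of [Theta - 1] have absolute sum at most one
half, so that [x = b - (Theta - 1) x] bounds [x] by twice [b]. *)
Let contraction (x b : 'cV[R]_M.+1) (B : R) :
  (forall i : 'I_M.+1, `|b i 0| <= B) ->
  Theta n M *m x = b -> forall i : 'I_M.+1, `|x i 0| <= 2 * B.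
Proof.
move=> bB xb h.
pose h0 := [arg max_(i > ord0 : 'I_M.+1 | true) `|x i 0|]%O.
have hmax i : `|x i 0| <= `|x h0 0|.
  by rewrite /h0; case: Order.TotalTheory.arg_maxP => //= j _; apply.
have xE : x h0 0 = b h0 0 - \sum_k (Theta n M - 1%:M : 'M[R]_M.+1) h0 k * x k 0.
  have : ((Theta n M - 1%:M) *m x) h0 0 = b h0 0 - x h0 0.
    by rewrite mulmxBl mul1mx xb !mxE.
  by rewrite mxE => ->; rewrite opprB addrC subrK.
have le1 : `|\sum_k (Theta n M - 1%:M : 'M[R]_M.+1) h0 k * x k 0| <= rho * `|x h0 0|.
  apply: le_trans (ler_norm_sum _ _ _) _.
  apply: le_trans (_ : \sum_k `|(Theta n M - 1%:M : 'M[R]_M.+1) h0 k| * `|x h0 0| <= _).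
    by apply: ler_sum => k _; rewrite normrM; apply: ler_wpM2l.
  by rewrite -mulr_suml; apply: ler_wpM2r => //; exact: Theta_row_le.
have le2 : rho * `|x h0 0| <= 2^-1 * `|x h0 0| by exact: ler_wpM2r.
have le3 : `|x h0 0| <= B + rho * `|x h0 0|.
  by rewrite {1}xE; apply: le_trans (ler_normB _ _) _; exact: lerD.
apply: le_trans (hmax h) _; move: le2 le3; lra.
Qed.

(** The kernel is trivial by the preceding bound with [b = 0]. *)
Lemma Theta_unit : Theta n M \in (unitmx : pred 'M[R]_M.+1).
Proof.
rewrite -unitmx_tr -row_free_unit -kermx_eq0; apply/eqP/row_matrixP => i.
rewrite row0; set v := row i _.
have vT : v *m (Theta n M)^T = 0 by rewrite /v -row_mul mulmx_ker row0.
have : Theta n M *m v^T = 0 by rewrite -(trmxK (Theta n M)) -trmx_mul vT trmx0.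
move=> /(contraction (B := 0)) H; apply/matrixP => a j; rewrite ord1 [RHS]mxE.
have := H _ j; rewrite mulr0 [v^T _ _]mxE => H'.
by apply/eqP; rewrite -normr_le0; apply: H' => h; rewrite mxE normr0.
Qed.

Let Theta_beta : Theta n M *m beta_vec n M = b_vec n M :> 'cV[R]_M.+1.
Proof. by rewrite /beta_vec mulmxA mulmxV ?mul1mx// Theta_unit. Qed.

Lemma beta_le (h : 'I_M.+1) : `|beta_vec n M h 0 : R| <= 4.
Proof.
have -> : 4 = 2 * 2 :> R by ring.
apply: contraction Theta_beta h => h; rewrite mxE; case: ifP => _.
  by rewrite normr1 ler1n.
have h1 : h%:R / n%:R <= 1 :> R.
  by rewrite ler_pdivrMr// mul1r ler_nat; apply: leq_trans (ltnW Mn); rewrite -ltnS.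
have h2 : 0 <= h%:R / n%:R :> R by rewrite divr_ge0.
by rewrite ger0_norm; [lra|rewrite mulr_ge0//; lra].
Qed.

Lemma beta_close (h : 'I_M.+1) : `|beta_vec n M h 0 - b_vec n M h 0 : R| <= 4 * rho.
Proof.
have -> : beta_vec n M h 0 - b_vec n M h 0 =
    - \sum_k (Theta n M - 1%:M : 'M[R]_M.+1) h k * beta_vec n M k 0.
  have : ((Theta n M - 1%:M) *m beta_vec n M) h 0 = b_vec n M h 0 - beta_vec n M h 0 :> R.
    by rewrite mulmxBl mul1mx Theta_beta [LHS]mxE [X in _ + X = _]mxE.
  by rewrite mxE => ->; rewrite opprB.
rewrite normrN; apply: le_trans (ler_norm_sum _ _ _) _.
apply: le_trans (_ : \sum_k `|(Theta n M - 1%:M : 'M[R]_M.+1) h k| * 4 <= _).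
  by apply: ler_sum => k _; rewrite normrM; apply: ler_wpM2l => //; exact: beta_le.
by rewrite -mulr_suml mulrC ler_wpM2l//; exact: Theta_row_le.
Qed.

(** The estimator has mean [beta^T Theta g], whereas [beta] solves
[Theta beta = b] and [Theta] need not be symmetric. The bias is nevertheless
negligible because [Theta] and [beta] are within [O(M / n)] of [1] and [b]. *)
Lemma beta_bias (g : 'cV[R]_M.+1) B : (forall k, `|g k 0| <= B) ->
  `|((beta_vec n M)^T *m (Theta n M *m g)) 0 0 - ((b_vec n M)^T *m g) 0 0| <=
  56 * M.+1%:R ^+ 2 / n%:R * B.
Proof.
move=> gB.
have B0 : 0 <= B by apply: le_trans (gB ord0).
have -> : ((beta_vec n M)^T *m (Theta n M *m g)) 0 0 - ((b_vec n M)^T *m g) 0 0 =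
  \sum_h (beta_vec n M h 0 * (\sum_k (Theta n M - 1%:M : 'M[R]_M.+1) h k * g k 0) +
     (beta_vec n M h 0 - b_vec n M h 0) * g h 0).
  rewrite mxE [X in _ - X]mxE -sumrB; apply: eq_bigr => h _.
  have -> : \sum_k (Theta n M - 1%:M : 'M[R]_M.+1) h k * g k 0 =
     (Theta n M *m g) h 0 - g h 0.
    have <- : ((Theta n M - 1%:M) *m g) h 0 = \sum_k (Theta n M - 1%:M : 'M[R]_M.+1) h k * g k 0.
      by rewrite mxE.
    by rewrite mulmxBl mul1mx [LHS]mxE [X in _ + X = _]mxE.
  by rewrite ![(_^T) _ _]mxE; ring.
apply: le_trans (ler_norm_sum _ _ _) _.
apply: le_trans (_ : \sum_(i < M.+1) (8 * rho * B) <= _); last first.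
  rewrite sumr_const card_ord -[_ *+ M.+1]mulr_natr /rho /m.
  by rewrite le_eqVlt; apply/orP; left; apply/eqP; ring.
apply: ler_sum => h _; apply: le_trans (ler_normD _ _) _; rewrite !normrM.
have -> : 8 * rho * B = 4 * (rho * B) + 4 * rho * B by ring.
apply: lerD; last by apply: ler_pM => //; exact: beta_close.
apply: ler_pM => //; first exact: beta_le.
apply: le_trans (ler_norm_sum _ _ _) _.
apply: le_trans (_ : \sum_k `|(Theta n M - 1%:M : 'M[R]_M.+1) h k| * B <= _).
  by apply: ler_sum => k _; rewrite normrM; apply: ler_wpM2l.
by rewrite -mulr_suml; apply: ler_wpM2r => //; exact: Theta_row_le.
Qed.

End theta.

(** * The covariance matrix of the sample mean *)

Section statistic.
Context {R : realType} {d : measure_display} {T : measurableType d}.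
Context (P : probability T R) {p : nat} (X : nat -> {RV P >-> p.-tuple R}).
Variables (M : nat) (mu : 'cV[R]_p) (Gam : int -> 'M[R]_p).
Hypotheses (gaussX : gaussian_process X) (depX : m_dependent X M).
Hypotheses (meanX : has_mean X mu) (autocovX : has_autocov X M Gam).
Local Notation C := (acov X mu).

Lemma tr_GamN (k : nat) : (k <= M)%N -> \tr (Gam (- k%:Z)) = \tr (Gam k%:Z).
Proof.
by move=> kM; rewrite -(Gam_tr gaussX meanX autocovX)// mxtrace_tr.
Qed.

Lemma tr_acov_gamma s t : \tr (C s t) =
  \sum_(k < M.+1) (`|s%:Z - t%:Z|%N == k)%:R * \tr (Gam k%:Z).
Proof.
have [le_M | gt_M] := leqP `|t%:Z - s%:Z|%N M.
  have ltM : (`|s%:Z - t%:Z| < M.+1)%N by lia.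
  rewrite (bigD1 (Ordinal ltM)) //= eqxx mul1r big1 ?addr0; last first.
    move=> k; rewrite -val_eqE /= eq_sym => /negbTE ->; exact: mul0r.
  rewrite (acov_near gaussX meanX autocovX)//.
  have [h|h] := leqP s t.
    by congr (\tr (Gam _)); lia.
  by rewrite -[RHS]tr_GamN; [congr (\tr (Gam _)); lia|lia].
rewrite (acov_far gaussX depX meanX)// mxtrace0 big1// => k _.
by case: eqP => [e|_]; [have := ltn_ord k; lia|rewrite mul0r].
Qed.

Variable n : nat.
Hypothesis n0 : (0 < n)%N.

Local Notation Y := (ctrd X mu).
Local Notation GS := (gspace X mu).
Local Notation O := (Omega X n).

Let nR : n%:R != 0 :> R. Proof. by rewrite pnatr_eq0 -lt0n. Qed.
Let nR0 : 0 < n%:R :> R. Proof. by rewrite ltr0n. Qed.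

Let GSg := @gspace_cgauss _ _ _ _ _ X mu gaussX meanX.
Let GSD := @gspaceD _ _ _ _ _ X mu.
Let GSZ := @gspaceZ _ _ _ _ _ X mu.

Definition cmean (i : 'I_p) (w : T) : R := \sum_(t < n) n%:R^-1 * Y t.+1 i w.

Lemma gspace_cmean i : GS (cmean i).
Proof. by apply: gspace_comb => t; exact: gspace_ctrd. Qed.

Lemma XbarE i w : Xbar X n w i 0 = mu i 0 + cmean i w.
Proof.
rewrite /Xbar mxE summxE big_add1 big_mkord mulr_sumr.
rewrite /cmean /ctrd; under [in RHS]eq_bigr do rewrite mulrBr.
rewrite big_split /= sumrN sumr_const card_ord -[(_ * _) *+ n]mulr_natl mulVKf//.
rewrite addrCA subrr addr0; apply: eq_bigr => t _; by rewrite mxE.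
Qed.

Lemma OmegaE i j : O i j = n%:R * cov P (cmean i) (cmean j).
Proof.
rewrite mxE; congr (_ * _).
have EX k : hasE P (fun w => Xbar X n w k 0) (mu k 0).
  have [v [_ [h _] _ _ _]] := GSg (gspace_cmean k).
  have := hasED (hasE_cst P (mu k 0)) h; rewrite addr0.
  by apply: hasE_ext => w; rewrite XbarE.
have EX' k : expectation P (fun w => Xbar X n w k 0) = (mu k 0)%:E.
  by rewrite unlock; exact: hasE_integral (EX k).
rewrite covariance.unlock !EX' unlock /=.
have := hasE_integral (GS_cov GSD GSg (gspace_cmean i) (gspace_cmean j)).
move=> /(congr1 fine) /= <-; congr fine; apply: eq_integral => w _.
transitivity (((Xbar X n w i 0 - mu i 0) * (Xbar X n w j 0 - mu j 0))%:E) => //.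
by rewrite !XbarE ![mu _ _ + _]addrC !addrK.
Qed.

Lemma Omega_sym : O^T = O.
Proof. by apply/matrixP => i j; rewrite mxE !OmegaE covC. Qed.

Let J := ('I_n * 'I_n)%type.
Let A (z : J) : 'M[R]_p := C z.1.+1 z.2.+1.
Let wt (z : J) : R := ((`|z.2.+1%:Z - z.1.+1%:Z| <= M)%N)%:R.

Lemma Omega_sum : O = n%:R^-1 *: \sum_(z : J) A z.
Proof.
apply/matrixP => i j; rewrite OmegaE mxE summxE -(pair_big xpredT xpredT (fun s t : 'I_n => A (s, t) i j)) /=.
have Gy k (t : 'I_n) := gspace_ctrd X mu t.+1 k.
rewrite /cmean (cov_sum2 GSD GSg) //; last by apply: gspace_comb.
rewrite !mulr_sumr; apply: eq_bigr => s _; rewrite !mulr_sumr; apply: eq_bigr => t _.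
by rewrite mxE; field.
Qed.

Let sum_wt : \sum_(z : J) wt z <= n%:R * M.*2.+1%:R.
Proof.
rewrite -(pair_big xpredT xpredT (fun s t : 'I_n => ((`|t.+1%:Z - s.+1%:Z| <= M)%N)%:R)) /=.
apply: (@le_trans _ _ (\sum_(s < n) M.*2.+1%:R)).
  by apply: ler_sum => s _; exact: count_windowR.
by rewrite sumr_const card_ord mulr_natl.
Qed.

Let wt0 z : 0 <= wt z. Proof. by rewrite /wt; case: (_ <= _)%N. Qed.

(** [Omega] is [n^-1] times a sum over pairs of times, of which at most
[n (2 M + 1)] have a nonzero covariance matrix. *)
Lemma tr_Omega4_le B : 0 <= B ->
  (forall a b c f : int, (`|a| <= M)%N -> (`|b| <= M)%N -> (`|c| <= M)%N -> (`|f| <= M)%N ->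
     `|\tr (Gam a *m Gam b *m Gam c *m Gam f)| <= B) ->
  `|\tr (O *m O *m O *m O)| <= M.*2.+1%:R ^+ 4 * B.
Proof.
move=> B0 GB.
have t4 z1 z2 z3 z4 : `|\tr (A z1 *m A z2 *m A z3 *m A z4)| <= wt z1 * wt z2 * wt z3 * wt z4 * B.
  rewrite /wt /A.
  have [h1|h1] := leqP; last by rewrite (acov_far gaussX depX meanX)// !mul0mx mxtrace0 normr0 !mul0r.
  have [h2|h2] := leqP; last by rewrite [C z2.1.+1 _](acov_far gaussX depX meanX)// mulmx0 !mul0mx mxtrace0 normr0 !(mul0r, mulr0).
  have [h3|h3] := leqP; last by rewrite [C z3.1.+1 _](acov_far gaussX depX meanX)// mulmx0 !mul0mx mxtrace0 normr0 !(mul0r, mulr0).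
  have [h4|h4] := leqP; last by rewrite [C z4.1.+1 _](acov_far gaussX depX meanX)// mulmx0 mxtrace0 normr0 !(mul0r, mulr0).
  by rewrite !mul1r !(acov_near gaussX meanX autocovX)// GB.
have -> : \tr (O *m O *m O *m O) = n%:R ^- 4 *
    \sum_z1 \sum_z2 \sum_z3 \sum_z4 \tr (A z1 *m A z2 *m A z3 *m A z4).
  rewrite Omega_sum.
  rewrite -!scalemxAl -!scalemxAr -!scalemxAl !scalerA mxtraceZ.
  congr (_ * _); first by field.
  rewrite !mulmx_suml raddf_sum /=; apply: eq_bigr => z1 _.
  rewrite [A z1 *m _]mulmx_sumr !mulmx_suml raddf_sum /=; apply: eq_bigr => z2 _.
  rewrite [A z1 *m A z2 *m _]mulmx_sumr !mulmx_suml raddf_sum /=; apply: eq_bigr => z3 _.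
  by rewrite mulmx_sumr raddf_sum.
rewrite normrM ger0_norm ?invr_ge0 ?exprn_ge0// ler_pdivrMl ?exprn_gt0//.
have le1 : `|\sum_z1 \sum_z2 \sum_z3 \sum_z4 \tr (A z1 *m A z2 *m A z3 *m A z4)| <=
    (\sum_z wt z) ^+ 4 * B.
  have -> : (\sum_z wt z) ^+ 4 * B =
      \sum_z1 \sum_z2 \sum_z3 \sum_z4 wt z1 * wt z2 * wt z3 * wt z4 * B.
    rewrite !exprS expr0 mulr1 !mulrA !mulr_suml; apply: eq_bigr => z1 _.
    rewrite [wt z1 * _]mulr_sumr !mulr_suml; apply: eq_bigr => z2 _.
    rewrite [wt z1 * wt z2 * _]mulr_sumr !mulr_suml; apply: eq_bigr => z3 _.
    by rewrite [wt z1 * wt z2 * wt z3 * _]mulr_sumr mulr_suml.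
  by do 4!(apply: le_trans (ler_norm_sum _ _ _) _; apply: ler_sum => ? _).
apply: le_trans le1 _; rewrite mulrA -exprMn ler_wpM2r//.
by rewrite lerXn2r ?nnegrE ?mulr_ge0 ?ler0n// sumr_ge0.
Qed.

Lemma qform_Omega_le v B : 0 <= B ->
  (forall h : int, (`|h| <= M)%N -> `|qform (Gam h) v| <= B) ->
  `|qform O v| <= M.*2.+1%:R * B.
Proof.
move=> B0 GB.
have -> : qform O v = n%:R^-1 * \sum_z qform (A z) v.
  by rewrite /qform Omega_sum -scalemxAr -scalemxAl mulmx_sumr mulmx_suml mxE summxE.
rewrite normrM ger0_norm ?invr_ge0 ?(ltW nR0)// ler_pdivrMl//.
apply: le_trans (ler_norm_sum _ _ _) _.
apply: (@le_trans _ _ (\sum_z wt z * B)).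
  apply: ler_sum => z _; rewrite /A /wt.
  have [h1|h1] := leqP; last first.
    by rewrite (acov_far gaussX depX meanX)// /qform mulmx0 mul0mx mxE normr0 mul0r.
  by rewrite mul1r (acov_near gaussX meanX autocovX)// GB.
by rewrite -mulr_suml mulrA ler_wpM2r.
Qed.

Let dist_count0 : \sum_(s < n) \sum_(t < n) ((`|s.+1%:Z - t.+1%:Z|%N == 0%N)%:R : R) = n%:R.
Proof.
rewrite (eq_bigr (fun=> 1)) ?sumr_const ?card_ord// => s _.
rewrite (bigD1 s)//= subrr eqxx big1 ?addr0// => t ts.
case: eqP => // e; move: ts; rewrite -val_eqE /= => ts; exfalso.
by move: ts e => /eqP; lia.
Qed.

Let shift_count (k : nat) : (k <= n)%N ->
  \sum_(s < n) \sum_(t < n) ((t == s + k :> nat)%N%:R : R) = (n - k)%:R.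
Proof.
move=> kn.
transitivity (\sum_(s < n) ((s < n - k)%N%:R : R)).
  apply: eq_bigr => s _; have [h|h] := ltnP s (n - k).
    have skn : (s + k < n)%N by lia.
    rewrite (bigD1 (Ordinal skn))//= eqxx big1 ?addr0// => t.
    by rewrite -val_eqE /= => /negbTE ->.
  rewrite big1// => t _; case: eqP => // e; have := ltn_ord t; lia.
rewrite -natr_sum; congr (_%:R).
rewrite -[RHS](card_ord (n - k)) -sum1_card.
rewrite (big_ord_widen n (fun=> 1%N) (leq_subr k n)) [RHS]big_mkcond /=.
by apply: eq_bigr => s _; case: ltnP.
Qed.

Let dist_count (k : nat) : (0 < k <= n)%N ->
  \sum_(s < n) \sum_(t < n) ((`|s.+1%:Z - t.+1%:Z|%N == k)%:R : R) = 2 * (n - k)%:R.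
Proof.
move=> /andP[k0 kn].
have -> : 2 * (n - k)%:R = \sum_(s < n) \sum_(t < n) ((t == s + k :> nat)%N%:R : R) +
   \sum_(s < n) \sum_(t < n) ((s == t + k :> nat)%N%:R : R).
  by rewrite [X in _ + X]exchange_big /= !shift_count//; ring.
rewrite -big_split; apply: eq_bigr => s _; rewrite -big_split; apply: eq_bigr => t _.
rewrite /= -natrD; congr (_%:R).
by case: eqP => e; case: eqP => e1; case: eqP => e2 //=; lia.
Qed.

Lemma tr_Omega_b : (M < n)%N -> \tr O = ((b_vec n M)^T *m gamma_vec M Gam) 0 0.
Proof.
move=> Mn; rewrite Omega_sum mxtraceZ raddf_sum /= mxE.
rewrite -(pair_big xpredT xpredT (fun s t : 'I_n => \tr (C s.+1 t.+1))) /=.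
transitivity (n%:R^-1 * \sum_(k < M.+1) (\sum_(s < n) \sum_(t < n)
    ((`|s.+1%:Z - t.+1%:Z|%N == k)%:R : R)) * \tr (Gam k%:Z)).
  congr (_ * _).
  under [LHS]eq_bigr => s _ do under eq_bigr => t _ do rewrite tr_acov_gamma.
  under [LHS]eq_bigr => s _ do rewrite exchange_big /=.
  rewrite exchange_big /=; apply: eq_bigr => k _.
  rewrite mulr_suml; apply: eq_bigr => s _.
  by rewrite mulr_suml.
rewrite mulr_sumr; apply: eq_bigr => k _; rewrite !mxE mulrA; congr (_ * _).
case: eqP => [->|/eqP k0]; first by rewrite dist_count0 mulVf.
have kM : (k <= M)%N by rewrite -ltnS.
rewrite dist_count; last by rewrite lt0n k0 /=; lia.
by rewrite natrB; [field|lia].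
Qed.

End statistic.

(** * Decomposition of the statistic *)

Section moments.
Context {R : realType} {d : measure_display} {T : measurableType d}.
Context (P : probability T R) {p : nat} (X : nat -> {RV P >-> p.-tuple R}).
Variables (M : nat) (mu : 'cV[R]_p) (Gam : int -> 'M[R]_p).
Hypotheses (gaussX : gaussian_process X) (depX : m_dependent X M).
Hypotheses (meanX : has_mean X mu) (autocovX : has_autocov X M Gam).
Variable n : nat.
Hypothesis n_large : (14 * M.+1 <= n)%N.

Local Notation Y := (ctrd X mu).
Local Notation GS := (gspace X mu).
Local Notation C := (acov X mu).
Local Notation Om := (Omega X n).
Local Notation m := (M.+1%:R : R).
Local Notation Z := (cmean X mu n).

Let n0 : (0 < n)%N. Proof. by move: n_large; lia. Qed.
Let nR : n%:R != 0 :> R. Proof. by rewrite pnatr_eq0 -lt0n. Qed.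
Let nR0 : 0 < n%:R :> R. Proof. by rewrite ltr0n. Qed.
Let nV0 : 0 <= n%:R^-1 :> R. Proof. by rewrite invr_ge0 ltW. Qed.

Let GSg := @gspace_cgauss _ _ _ _ _ X mu gaussX meanX.
Let GSD := @gspaceD _ _ _ _ _ X mu.
Let GSZ := @gspaceZ _ _ _ _ _ X mu.
Let GZ (i : 'I_p) : GS (Z i) := gspace_cmean X mu n i.

Let covZ i j : cov P (Z i) (Z j) = Om i j / n%:R.
Proof. by rewrite (OmegaE gaussX meanX n0) mulrC mulKf. Qed.

(** The coefficient of the pair of times [s.+1], [u.+1] in the estimator of
[\tr Omega]. *)
Definition hat_coef (s u : 'I_n) : R := \sum_(h < M.+1) beta_vec n M h 0 *
  (n%:R^-1 * \sum_(1 <= t < (n - h).+1) ctr n t s.+1 * ctr n (t + h) u.+1).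

Let centerE t i w : (0 < t <= n)%N -> (vec X t w - Xbar X n w) i 0 =
  \sum_(s < n) ctr n t s.+1 * Y s.+1 i w.
Proof.
case: t => // t /= tn; rewrite [LHS]mxE [X in _ + X]mxE (XbarE X mu n0).
under [RHS]eq_bigr do rewrite mulrBl.
rewrite sumrB (bigD1 (Ordinal tn)) //= eqxx mul1r big1 ?addr0.
  by rewrite -/(cmean X mu n i w) /ctrd opprD addrA.
by move=> s st; rewrite (_ : (s.+1 == t.+1) = false) ?mul0r//; apply/negbTE.
Qed.

Lemma tr_Omega_hatE w : tr_Omega_hat X n M w =
  \sum_s \sum_u hat_coef s u * \sum_i Y s.+1 i w * Y u.+1 i w.
Proof.
rewrite /tr_Omega_hat mxE.
transitivity (\sum_(h < M.+1) \sum_(s < n) \sum_(u < n) beta_vec n M h 0 *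
  (n%:R^-1 * \sum_(1 <= t < (n - h).+1) ctr n t s.+1 * ctr n (t + h) u.+1) *
  \sum_i Y s.+1 i w * Y u.+1 i w).
  apply: eq_bigr => h _; rewrite !mxE /Gamma_hat mxtraceZ raddf_sum /=.
  under [RHS]eq_bigr => s _ do under eq_bigr => u _ do rewrite -!mulrA.
  under [RHS]eq_bigr => s _ do rewrite -mulr_sumr.
  rewrite -mulr_sumr; congr (_ * _).
  under [RHS]eq_bigr => s _ do rewrite -mulr_sumr.
  rewrite -mulr_sumr; congr (_ * _).
  under [RHS]eq_bigr => s _ do under eq_bigr => u _ do rewrite mulr_suml.
  under [RHS]eq_bigr => s _ do rewrite exchange_big /=.
  rewrite [RHS]exchange_big /=; apply: eq_big_nat => t tn.
  transitivity (\sum_i (\sum_(s < n) ctr n t s.+1 * Y s.+1 i w) *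
     (\sum_(u < n) ctr n (t + h) u.+1 * Y u.+1 i w)).
    by apply: eq_bigr => i _; rewrite mxE big_ord1 [X in _ * X]mxE !centerE//; lia.
  under [LHS]eq_bigr => i _ do rewrite big_distrlr /=.
  rewrite exchange_big /=; apply: eq_bigr => s _.
  rewrite exchange_big /=; apply: eq_bigr => u _.
  by rewrite mulr_sumr; apply: eq_bigr => i _; rewrite mulrACA.
rewrite exchange_big /=; apply: eq_bigr => s _.
rewrite exchange_big /=; apply: eq_bigr => u _.
by rewrite mulr_suml.
Qed.

Let beta4 (h : 'I_M.+1) : `|beta_vec n M h 0 : R| <= 4. Proof. exact: beta_le. Qed.

(** The weights [beta] are at most [4] and the centering coefficients of one
time have absolute sum at most [2]. *)
Let hat_coef_max s u : `|hat_coef s u| <= 8 * m / n%:R.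
Proof.
apply: le_trans (ler_norm_sum _ _ _) _.
apply: (@le_trans _ _ (\sum_(h < M.+1) 8 / n%:R)); last first.
  by rewrite sumr_const card_ord -[(_ / _) *+ _]mulr_natl; lra.
apply: ler_sum => h _; rewrite normrM.
have -> : 8 / n%:R = 4 * (n%:R^-1 * 2) :> R by ring.
apply: ler_pM => //; rewrite normrM ger0_norm//.
rewrite ler_wpM2l//.
apply: le_trans (ler_norm_sum _ _ _) _.
apply: le_trans (ctr_sum_part_le n0 s.+1 h).
apply: ler_sum => t _; rewrite normrM ler_piMr//.
exact: ctr_abs_le1.
Qed.

Let ctr_ord_sum t : \sum_(s < n) `|ctr n t s.+1 : R| <= 2.
Proof.
have := @ctr_sum_le R n n0 t; rewrite big_add1 big_mkord; exact.
Qed.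

Let hat_coef_sum : \sum_s \sum_u `|hat_coef s u| <= 16 * m.
Proof.
apply: (@le_trans _ _ (\sum_(s < n) \sum_(u < n) \sum_(h < M.+1)
   4 * (n%:R^-1 * \sum_(1 <= t < (n - h).+1) `|ctr n t s.+1| * `|ctr n (t + h) u.+1|))).
  apply: ler_sum => s _; apply: ler_sum => u _.
  apply: le_trans (ler_norm_sum _ _ _) _; apply: ler_sum => h _.
  rewrite normrM; apply: ler_pM => //.
  rewrite normrM ger0_norm// ler_wpM2l//.
  apply: le_trans (ler_norm_sum _ _ _) _.
  by apply: ler_sum => t _; rewrite normrM.
under eq_bigr => s _ do rewrite exchange_big /=.
rewrite exchange_big /=.
apply: (@le_trans _ _ (\sum_(h < M.+1) 16)); last first.
  by rewrite sumr_const card_ord -[_ *+ _]mulr_natl mulrC.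
apply: ler_sum => h _.
under eq_bigr => s _ do rewrite -mulr_sumr -mulr_sumr.
rewrite -mulr_sumr -mulr_sumr.
have -> : 16 = 4 * (n%:R^-1 * (n%:R * 4)) :> R by rewrite mulKf//; ring.
rewrite ler_pM2l// ler_pM2l ?invr_gt0//.
under eq_bigr => s _ do rewrite exchange_big /=.
rewrite exchange_big /=.
apply: (@le_trans _ _ (\sum_(1 <= t < (n - h).+1) (4 : R))); last first.
  by rewrite sumr_const_nat subn1 /= -[_ *+ _]mulr_natl ler_wpM2r// ler_nat leq_subr.
apply: ler_sum => t _; rewrite -big_distrlr /=.
have -> : 4 = 2 * 2 :> R by ring.
by apply: ler_pM => //; apply: sumr_ge0.
Qed.

Let hat_mean : \sum_s \sum_u hat_coef s u * \tr (C s.+1 u.+1) =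
  ((beta_vec n M)^T *m (Theta n M *m gamma_vec M Gam)) 0 0.
Proof.
rewrite mxE.
transitivity (\sum_(h < M.+1) \sum_(s < n) \sum_(u < n) beta_vec n M h 0 *
  (n%:R^-1 * \sum_(1 <= t < (n - h).+1) ctr n t s.+1 * ctr n (t + h) u.+1) *
  \tr (C s.+1 u.+1)).
  rewrite [RHS]exchange_big /=; apply: eq_bigr => s _.
  rewrite [RHS]exchange_big /=; apply: eq_bigr => u _.
  by rewrite mulr_suml.
apply: eq_bigr => h _; rewrite [X in _ = X * _]mxE [X in _ = _ * X]mxE.
under [LHS]eq_bigr => s _ do under eq_bigr => u _ do rewrite -!mulrA.
under [LHS]eq_bigr => s _ do rewrite -mulr_sumr.
rewrite -mulr_sumr; congr (_ * _).
under [LHS]eq_bigr => s _ do under eq_bigr => u _ do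
  rewrite (tr_acov_gamma gaussX depX meanX autocovX) mulr_sumr mulr_sumr.
under [LHS]eq_bigr => s _ do rewrite exchange_big /=.
rewrite exchange_big /=; apply: eq_bigr => k _.
rewrite !mxE; under [LHS]eq_bigr => s _ do under eq_bigr => u _ do
  rewrite mulrA mulrA.
under [LHS]eq_bigr => s _ do rewrite -mulr_suml.
rewrite -mulr_suml; congr (_ * _).
under [LHS]eq_bigr => s _ do under eq_bigr => u _ do rewrite -mulrA.
under [LHS]eq_bigr => s _ do rewrite -mulr_sumr.
rewrite -mulr_sumr; congr (_ * _).
under [LHS]eq_bigr => s _ do under eq_bigr => u _ do rewrite mulr_suml.
under [LHS]eq_bigr => s _ do rewrite exchange_big /=.
rewrite exchange_big /=; apply: eq_bigr => t _.
rewrite big_add1 big_mkord; apply: eq_bigr => s _.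
by rewrite big_add1 big_mkord.
Qed.

(** The error is a variance, of order [M^4 K / n], plus a squared bias; in the
latter the traces of the autocovariances are at most [sqrt (p K)]. *)
Lemma trace_estimator_error K : (forall h : int, (`|h| <= M)%N -> frob (Gam h) <= K) ->
  exists2 v, hasE P (fun w => (tr_Omega_hat X n M w - \tr Om) ^+ 2) v &
    v <= m ^+ 4 * K / n%:R * (1024 + 3136 * (p%:R / n%:R)).
Proof.
move=> GK.
have K0 : 0 <= K by apply: le_trans (GK 0 _) => //; exact: frob_ge0.
have c0 : 0 <= 8 * m / n%:R by rewrite divr_ge0 ?mulr_ge0 ?ler0n.
have [EQ [v Ev vle]] := quadratic_variance_le gaussX depX meanX autocovX GK c0
  hat_coef_max hat_coef_sum.
set Q := fun w => _ in EQ Ev; set q := \sum_s _ in EQ Ev.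
have := hasED (hasED Ev (hasEZ (2 * (q - \tr Om)) (hasEB EQ (hasE_cst P q))))
  (hasE_cst P ((q - \tr Om) ^+ 2)).
rewrite subrr mulr0 addr0 => E.
exists (v + (q - \tr Om) ^+ 2).
  by apply: hasE_ext E => w; rewrite tr_Omega_hatE -/(Q w); ring.
have bq : `|q - \tr Om| <= 56 * m ^+ 2 / n%:R * Num.sqrt (p%:R * K).
  rewrite /q hat_mean (tr_Omega_b gaussX depX meanX autocovX n0); last by move: n_large; lia.
  apply: beta_bias => // k; rewrite mxE -sqrtr_sqr ler_wsqrtr//.
  apply: le_trans (tr_sqr_le _) _; rewrite ler_wpM2l// GK//.
  by rewrite absz_nat -ltnS.
have bq2 : (q - \tr Om) ^+ 2 <= (56 * m ^+ 2 / n%:R) ^+ 2 * (p%:R * K).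
  rewrite -(real_normK (num_real (q - _))) -[X in _ * X]sqr_sqrtr ?mulr_ge0//.
  by rewrite -exprMn lerXn2r ?nnegrE// (le_trans _ bq).
apply: le_trans (lerD vle bq2) _.
have m2 : M.*2.+1%:R ^+ 2 <= 4 * m ^+ 2.
  by rewrite -natrX -natrX -natrM ler_nat; nia.
have -> : m ^+ 4 * K / n%:R * (1024 + 3136 * (p%:R / n%:R)) =
  2 * K * (16 * m * (8 * m / n%:R) * (4 * m ^+ 2)) + (56 * m ^+ 2 / n%:R) ^+ 2 * (p%:R * K).
  by field.
rewrite lerD2r ler_wpM2l ?mulr_ge0// ler_wpM2l// mulr_ge0 ?mulr_ge0 ?ler0n//.
Qed.

Let Om_sym : Om^T = Om := Omega_sym gaussX meanX n0.

(** The part of the statistic that drives its asymptotic law. *)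
Definition sqdev w : R := \sum_i Z i w ^+ 2 - \tr Om / n%:R.
Definition linear_part w : R := 2 * \sum_i mu i 0 * Z i w.

(** Isserlis' formula for the squared length of the centered mean, whose
covariance matrix is [n^-1 Omega]. *)
Lemma sqdev_moments : hasE P sqdev 0 /\
  hasE P (fun w => sqdev w ^+ 2) (2 * \tr (Om *m Om) / n%:R ^+ 2).
Proof.
have [] := quadratic_form_moments GSD GSZ GSg (fun=> 1) GZ GZ.
have -> : \sum_i 1 * cov P (Z i) (Z i) = \tr Om / n%:R.
  by rewrite /mxtrace mulr_suml; apply: eq_bigr => i _; rewrite mul1r covZ.
have qE w : \sum_i 1 * (Z i w * Z i w) - \tr Om / n%:R = sqdev w.
  by congr (_ - _); apply: eq_bigr => i _; rewrite mul1r expr2.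
move=> E1 E2; split.
  have := hasEB E1 (hasE_cst P (\tr Om / n%:R)); rewrite subrr.
  exact: hasE_ext.
rewrite (_ : _ / _ = \sum_x \sum_y 1 * 1 * (cov P (Z x) (Z y) * cov P (Z x) (Z y) +
   cov P (Z x) (Z y) * cov P (Z x) (Z y))).
  by apply: hasE_ext E2 => w; rewrite qE.
rewrite /mxtrace mulr_sumr mulr_suml; apply: eq_bigr => i _.
rewrite mxE mulr_sumr mulr_suml; apply: eq_bigr => j _.
have -> : Om j i = Om i j by rewrite -[in LHS]Om_sym mxE.
by rewrite covZ; field.
Qed.

Lemma linear_part_moment :
  hasE P (fun w => linear_part w ^+ 2) (4 * qform Om mu / n%:R).
Proof.
pose l w := \sum_i mu i 0 * Z i w.
have Gl : GS l by apply: gspace_comb => i; exact: GZ.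
have := hasEZ 4 (GS_cov GSD GSg Gl Gl).
rewrite (_ : 4 * _ = 4 * qform Om mu / n%:R).
  by apply: hasE_ext => w; rewrite /linear_part -/(l w); ring.
rewrite (cov_sum2 GSD GSg)// qformE -mulrA mulr_suml; congr (_ * _).
apply: eq_bigr => i _; rewrite mulr_suml; apply: eq_bigr => j _.
by rewrite covZ; field.
Qed.

Lemma MstatE w : Mstat X n M w = (mu^T *m mu) 0 0 + sqdev w +
  (linear_part w - n%:R^-1 * (tr_Omega_hat X n M w - \tr Om)).
Proof.
rewrite /Mstat mxE /sqdev /linear_part.
rewrite (eq_bigr (fun i => mu i 0 ^+ 2 + Z i w ^+ 2 + 2 * (mu i 0 * Z i w))); last first.
  by move=> i _; rewrite mxE (XbarE X mu n0); ring.
rewrite !big_split /= -mulr_sumr [(_^T *m _) 0 0]mxE.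
rewrite [X in _ = X + _ + _](eq_bigr (fun i => mu i 0 ^+ 2)); last first.
  by move=> i _; rewrite mxE expr2.
ring.
Qed.

Let tau := \tr (Om *m Om).

Lemma tau_ge0 : 0 <= tau.
Proof.
rewrite /tau -[X in _ *m X]Om_sym -/(frob Om); exact: frob_ge0.
Qed.

(** Diagonalizing [Omega] turns [sqdev] into a sum of centered squares of
independent Gaussian variables. With the normalization below their variances
are the eigenvalues divided by [sqrt (2 tr Omega^2)], so that the sum of their
fourth powers is [tr Omega^4 / (4 (tr Omega^2)^2)]. *)
Lemma sqdev_charfun_close eps : 0 < tau -> 0 < eps <= 1 ->
  `|\tr (Om *m Om *m Om *m Om)| <= 4 * eps ^+ 2 * tau ^+ 2 ->
  charfun_close P (fun w => sqdev w * (n%:R / Num.sqrt (2 * tau))) (129 * eps).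
Proof.
move=> tau0 eps01 t4.
have [U [D [UU OE]]] := real_spectral Om_sym.
have UU' : U^T *m U = 1%:M by exact: mulmx1C.
pose r := Num.sqrt (2 * tau).
have r0 : 0 < r by rewrite sqrtr_gt0 mulr_gt0.
have r2 : r ^+ 2 = 2 * tau by rewrite sqr_sqrtr// mulr_ge0// ltW.
pose sc := Num.sqrt (n%:R / r).
have sc2 : sc ^+ 2 = n%:R / r by rewrite sqr_sqrtr// divr_ge0// ltW.
pose g (j : 'I_p) w := sc * \sum_i U j i * Z i w.
(* indices beyond the dimension carry the null variable *)
pose G (k : nat) w := if insub k is Some j then g j w else 0.
pose lam (k : nat) := if insub k is Some j then D 0 j / r else 0.
have GE (j : 'I_p) : G j =1 g j by move=> w; rewrite /G valK.
have lamE (j : 'I_p) : lam j = D 0 j / r by rewrite /lam valK.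
have Gz (j : 'I_p) : GS (fun w => \sum_i U j i * Z i w) by exact: gspace_comb.
have Gg j : GS (g j) by exact: GSZ.
have covg j k : cov P (g j) (g k) = (j == k)%:R * (D 0 j / r).
  have -> : cov P (g j) (g k) = sc ^+ 2 * cov P (fun w => \sum_i U j i * Z i w) (fun w => \sum_i U k i * Z i w).
    apply: hasE_eq; have := hasEZ (sc ^+ 2) (GS_cov GSD GSg (Gz j) (Gz k)).
    by apply: hasE_ext => w; rewrite /g; ring.
  rewrite (cov_sum2 GSD GSg)// sc2.
  have -> : \sum_x \sum_y U j x * U k y * cov P (Z x) (Z y) =
      (U *m Om *m U^T) j k / n%:R.
    rewrite mxE mulr_suml exchange_big /=; apply: eq_bigr => y _.
    rewrite !mxE !mulr_suml; apply: eq_bigr => x _; rewrite covZ; ring.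
  rewrite OE !mulmxA UU mul1mx -mulmxA UU mulmx1 mxE mulrnAl.
  case: eqP => _ /=; last by rewrite mulr0n mul0r mulr0 mul0r.
  by rewrite mulr1n mul1r; field; rewrite nR gt_eqF.
have D0 j : 0 <= D 0 j / r.
  have := GS_cgauss GSg (Gg j); rewrite covg eqxx mul1r.
  by case=> [[]].
have dg k : \tr (iter k (mulmx (diag_mx D)) (diag_mx D)) = \sum_j D 0 j ^+ k.+1.
  apply: eq_bigr => j _; elim: k (j) => [|k IH] i /=; first by rewrite mxE eqxx expr1.
  rewrite mxE (bigD1 i)//= big1 ?addr0 => [|l li].
    by rewrite IH mxE eqxx mulr1n -exprS.
  by rewrite mxE eq_sym (negbTE li) mul0r.
have trU A : \tr (U^T *m A *m U) = \tr A.
  by rewrite mxtrace_mulC mulmxA UU mul1mx.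
have tr2 : tau = \sum_j D 0 j ^+ 2.
  rewrite -(dg 1%N) /= -[RHS]trU /tau OE; congr (\tr _).
  by rewrite !mulmxA -[_ *m U *m U^T]mulmxA UU mulmx1.
have tr4 : \tr (Om *m Om *m Om *m Om) = \sum_j D 0 j ^+ 4.
  rewrite -(dg 3%N) /= -[RHS]trU OE; congr (\tr _).
  by rewrite !mulmxA -!(mulmxA _ U U^T) UU !mulmx1.
have := @sqsum_charfun_close _ _ _ P p G lam eps.
rewrite (_ : sqsum G lam p = fun w => sqdev w * (n%:R / Num.sqrt (2 * tau))); last first.
  apply/funext => w; rewrite /sqsum -/r -sc2 /sqdev mulrBl mulr_suml sumrB; congr (_ - _).
    rewrite (eq_bigr (fun j : 'I_p => g j w ^+ 2)) => [|j _]; last by rewrite GE.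
    pose zv : 'cV[R]_p := \col_i Z i w.
    have nz (v : 'cV[R]_p) : \sum_i v i 0 ^+ 2 = (v^T *m v) 0 0.
      by rewrite mxE; apply: eq_bigr => i _; rewrite mxE expr2.
    transitivity (sc ^+ 2 * \sum_j (U *m zv) j 0 ^+ 2).
      rewrite mulr_sumr; apply: eq_bigr => j _; rewrite /g exprMn; congr (_ * _ ^+ 2).
      by rewrite mxE; apply: eq_bigr => i _; rewrite mxE.
    rewrite nz trmx_mul mulmxA -(mulmxA _ U^T) UU' mulmx1 -nz mulr_sumr.
    by apply: eq_bigr => i _; rewrite mxE mulrC.
  rewrite (eq_bigr (fun j => D 0 j / r)) => [|j _]; last exact: lamE.
  rewrite -mulr_suml sc2 OE mxtrace_mulC mulmxA UU mul1mx.
  have -> : \tr (diag_mx D) = \sum_j D 0 j by rewrite -(dg 0%N).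
  by field; rewrite nR gt_eqF.
apply => //.
- move=> c; have Gl : GS (lin p G c).
    rewrite (_ : lin p G c = fun w => \sum_(j < p) c j * g j w).
      by apply: gspace_comb.
    by apply/funext => w; apply: eq_bigr => j _; rewrite GE.
  have := GS_cgauss GSg Gl; rewrite (_ : cov P _ _ = linvar p lam c)//.
  rewrite (_ : lin p G c = fun w => \sum_(j < p) c j * g j w); last first.
    by apply/funext => w; apply: eq_bigr => j _; rewrite GE.
  rewrite (cov_sum2 GSD GSg)//; last by apply: gspace_comb.
  apply: eq_bigr => j _; rewrite (bigD1 j)//= covg eqxx mul1r big1 ?addr0 => [|k kj].
    by rewrite lamE; ring.
  by rewrite covg eq_sym (negbTE kj) mul0r mulr0.
- by move=> k; rewrite /lam; case: insub.
- rewrite (eq_bigr (fun j => D 0 j ^+ 2 * r ^- 2)) => [|j _]; last by rewrite lamE expr_div_n.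
  by rewrite -mulr_suml -tr2 r2; field; rewrite gt_eqF.
- rewrite (eq_bigr (fun j => D 0 j ^+ 4 * r ^- 4)) => [|j _]; last by rewrite lamE expr_div_n.
  rewrite -mulr_suml -tr4 ler_pdivrMr ?exprn_gt0//.
  apply: le_trans (ler_norm _) (le_trans t4 _).
  by rewrite (exprM r 2 2) r2; lra.
Qed.

End moments.

(** * Perturbation of a variance and of a studentized statistic *)

Section perturbation.
Context {R : realType} {d : measure_display} {T : measurableType d}.
Variable P : probability T R.

(** The cross term is bounded by [eta A^2 / 2 + D^2 / (2 eta)], whose mean is at
most [eta s2]. The case [s2 = 0] is included: it will exclude a degenerate
[Omega]. *)
Lemma variance_perturbation (A D : T -> R) (c s2 eta dd : R) :
  measurable_fun setT D ->
  hasE P A 0 -> hasE P (fun w => A w ^+ 2) s2 -> hasE P (fun w => D w ^+ 2) dd ->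
  0 < eta -> dd <= eta ^+ 2 * s2 ->
  `|fine 'V_P[(fun w => c + A w + D w)] - s2| <= (2 * eta + eta ^+ 2) * s2.
Proof.
move=> mD EA EA2 ED2 eta0 ddle; have mA := L1_meas (hasE_L1 EA).
have LD : L1 P D.
  apply: L1_le mD (hasE_L1 (hasED (hasE_cst P 1) ED2)) _ => w.
  by have := sqr_ge0 (`|D w| - 1); rewrite -(real_normK (num_real (D w))); have := normr_ge0 (D w); nra.
have dom : hasE P (fun w => eta / 2 * A w ^+ 2 + (2 * eta)^-1 * D w ^+ 2)
    (eta / 2 * s2 + (2 * eta)^-1 * dd) by exact: hasED (hasEZ _ EA2) (hasEZ _ ED2).
have domP w : `|A w * D w| <= eta / 2 * A w ^+ 2 + (2 * eta)^-1 * D w ^+ 2.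
  have -> : eta / 2 * A w ^+ 2 + (2 * eta)^-1 * D w ^+ 2 =
      `|A w * D w| + (2 * eta)^-1 * (eta * `|A w| - `|D w|) ^+ 2.
    rewrite -(real_normK (num_real (A w))) -(real_normK (num_real (D w))) normrM.
    by field; rewrite gt_eqF.
  by rewrite lerDl mulr_ge0 ?sqr_ge0// invr_ge0 mulr_ge0// ltW.
have LAD : L1 P (fun w => A w * D w).
  by apply: L1_le (hasE_L1 dom) domP; apply: measurable_funM.
have EAD := hasE_Ex LAD; have ED := hasE_Ex LD.
set e := Ex P D in ED; set f := Ex P _ in EAD.
have fle : `|f| <= eta * s2.
  apply: le_trans (hasE_norm_le EAD dom domP) _.
  have : (2 * eta)^-1 * dd <= (2 * eta)^-1 * (eta ^+ 2 * s2).
    by rewrite ler_wpM2l// invr_ge0 mulr_ge0// ltW.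
  have -> : (2 * eta)^-1 * (eta ^+ 2 * s2) = eta / 2 * s2 by field; rewrite gt_eqF.
  lra.
have EV : hasE P (fun w => (A w + (D w - e)) ^+ 2) (s2 + 2 * f + (dd - e ^+ 2)).
  have := hasEB (hasED (hasED EA2 (hasEZ 2 EAD)) ED2)
    (hasED (hasEZ (2 * e) EA) (hasEB (hasEZ (2 * e) ED) (hasE_cst P (e ^+ 2)))).
  rewrite (_ : _ - _ = s2 + 2 * f + (dd - e ^+ 2)); last by ring.
  by apply: hasE_ext => w; ring.
have ee : 0 <= dd - e ^+ 2.
  apply: (@hasE_ge0 _ _ _ P (fun w => (D w - e) ^+ 2)) => [|w]; last exact: sqr_ge0.
  have := hasED (hasEB ED2 (hasEZ (2 * e) ED)) (hasE_cst P (e ^+ 2)).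
  rewrite (_ : _ + _ = dd - e ^+ 2); last by ring.
  by apply: hasE_ext => w; ring.
have -> : fine 'V_P[(fun w => c + A w + D w)] = s2 + 2 * f + (dd - e ^+ 2).
  have EM : expectation P (fun w => c + A w + D w) = (c + e)%:E.
    rewrite unlock; apply: hasE_integral.
    by have := hasED (hasED (hasE_cst P c) EA) ED; rewrite addr0.
  rewrite /variance covariance.unlock EM unlock -(hasE_eq EV) /Ex /Rintegral.
  congr fine; apply: eq_integral => w _.
  transitivity (((c + A w + D w - (c + e)) * (c + A w + D w - (c + e)))%:E) => //.
  by congr (_%:E); ring.
have e0 := sqr_ge0 e; move: fle; rewrite !ler_norml => /andP[f1 f2].
by apply/andP; split; lra.
Qed.

Lemma measurable_ltset (f g : T -> R) : measurable_fun setT f -> measurable_fun setT g ->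
  measurable [set w | f w < g w].
Proof.
move=> mf mg; have := measurable_fun_ltr mf mg => /(_ measurableT [set true] I).
by rewrite setTI; congr measurable; apply/seteqP; split => w.
Qed.

Lemma measurable_leset (f g : T -> R) : measurable_fun setT f -> measurable_fun setT g ->
  measurable [set w | f w <= g w].
Proof.
move=> mf mg; have := measurable_fun_ler mf mg => /(_ measurableT [set true] I).
by rewrite setTI; congr measurable; apply/seteqP; split => w.
Qed.

(** Where the variance estimator is not positive the quotient is [0]. *)
Lemma measurable_studentized (z : R) (f V : T -> R) :
  measurable_fun setT f -> measurable_fun setT V ->
  measurable [set w | z < f w / Num.sqrt (V w)].
Proof.
move=> mf mV.
have mS : measurable_fun setT (fun w => Num.sqrt (V w)).
  by apply: measurableT_comp mV; apply: continuous_measurable_fun; exact: sqrt_continuous.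
have mc (a : R) : measurable_fun setT (fun _ : T => a) by exact: measurable_cst.
rewrite (_ : [set w | _] = ([set w | V w <= 0] `&` [set w | z < 0]) `|`
    ([set w | 0 < V w] `&` [set w | z * Num.sqrt (V w) < f w])).
  by apply: measurableU; apply: measurableI;
    [exact: measurable_leset|exact: measurable_ltset|exact: measurable_ltset
    |apply: measurable_ltset => //; exact: measurable_funM].
apply/seteqP; split => w /=.
  have [V0|V0] := leP (V w) 0; first by rewrite ler0_sqrtr// invr0 mulr0; left.
  by rewrite ltr_pdivlMr ?sqrtr_gt0//; right.
case=> -[V0]; first by rewrite ler0_sqrtr// invr0 mulr0.
by rewrite ltr_pdivlMr ?sqrtr_gt0.
Qed.

Lemma prob_le_bad A B E F (a b : R) : measurable A -> measurable B -> measurable E ->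
  measurable F -> fine (P E) <= a -> fine (P F) <= b -> A `<=` B `|` (E `|` F) ->
  fine (P A) <= fine (P B) + a + b.
Proof.
move=> mA mB mE mF Ea Fb AB.
have fP G (mG : measurable G) : P G = (fine (P G))%:E by rewrite fineK// fin_num_measure.
have h : (P A <= P B + (P E + P F))%E.
  apply: le_trans (_ : P (B `|` (E `|` F)) <= _)%E.
    by apply: le_measure; rewrite ?inE//; do 2?apply: measurableU.
  apply: le_trans (measureU2 _ _ _) _ => //; first exact: measurableU.
  by rewrite leeD2l// measureU2.
have : fine (P A) <= fine (P B) + (fine (P E) + fine (P F)).
  by rewrite -lee_fin !EFinD -!fP.
by move: Ea Fb; lra.
Qed.

Lemma prob_compl A : measurable A -> fine (P (~` A)) = 1 - fine (P A).
Proof.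
move=> mA; rewrite probability_setC//.
by rewrite -(@fineK _ (P A)) ?fin_num_measure// -EFinB.
Qed.

(** Slutsky's argument. [Q + D] is the normalized statistic without its
noncentrality [delta], and [V / v] the normalized variance estimator. The
noncentrality is arbitrary, so both inequalities go through the uniform lower
bounds on the distribution functions of [Q] and [- Q]. *)
Lemma power_close (Q D V : T -> R) (z delta s v e r dd eta b rho : R) :
  measurable_fun setT Q -> measurable_fun setT D -> measurable_fun setT V ->
  (forall a, Phi a - eta <= fine (P [set w | Q w < a])) ->
  (forall a, Phi a - eta <= fine (P [set w | - Q w < a])) ->
  hasE P (fun w => D w ^+ 2) dd -> 0 < rho -> 0 < s -> 0 < v ->
  `|v / s ^+ 2 - 1| <= r -> 0 <= r <= 4^-1 -> 0 < e <= 4^-1 ->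
  fine (P [set w | e <= `|V w / v - 1|]) <= b ->
  `|fine (P [set w | z < s * (delta + Q w + D w) / Num.sqrt (V w)]) - Phi (- z + delta)|
  <= eta + b + dd / rho ^+ 2 + (rho + `|z| * (2 * (e + r))).
Proof.
move=> mQ mD mV lQ uQ ED rho0 s0 v0 vs /andP[r0 r1] /andP[e0 e1] Pb.
pose g := rho + `|z| * (2 * (e + r)).
have g0 : 0 <= g by rewrite addr_ge0 ?(ltW rho0)// !mulr_ge0// addr_ge0// ltW.
have mc (a : R) : measurable_fun setT (fun _ : T => a) by exact: measurable_cst.
have mnQ : measurable_fun setT (fun w => - Q w) by exact: measurableT_comp.
pose E := [set w | e <= `|V w / v - 1|].
have mE : measurable E.
  apply: measurable_leset => //; apply: measurableT_comp => //.
  by apply: measurable_funB => //; apply: measurable_funM.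
pose F := [set w | rho <= `|D w|].
have mF : measurable F by apply: measurable_leset => //; exact: measurableT_comp.
have PF : fine (P F) <= dd / rho ^+ 2.
  rewrite mulrC; apply: prob_le_hasE (hasEZ (rho ^- 2) ED) mF _ => w.
  rewrite indicE; case: (boolP (w \in F)) => [|_]; last by rewrite mulr_ge0 ?sqr_ge0// invr_ge0 sqr_ge0.
  rewrite inE /F /= => h; rewrite mulrC ler_pdivlMr ?exprn_gt0// mul1r.
  by rewrite -(real_normK (num_real (D w))) lerXn2r ?nnegrE// ltW.
pose S := [set w | z < s * (delta + Q w + D w) / Num.sqrt (V w)].
have mS : measurable S.
  apply: measurable_studentized => //; apply: measurable_funM => //.
  by do 2!apply: measurable_funD => //.
(* [W] is the normalized estimated deviation; off [E] and [F] it is near [1] *)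
have good w : ~ E w -> ~ F w -> exists2 W, S w <-> z * W < delta + Q w + D w &
    `|D w| < rho /\ `|z * W - z| <= `|z| * (2 * (e + r)).
  move=> /negP; rewrite /E /= -ltNge => Ew /negP; rewrite /F /= -ltNge => Fw.
  pose W2 := V w / v * (v / s ^+ 2).
  have [x xE] : exists x, x = V w / v by exists (V w / v).
  have [y yE] : exists y, y = v / s ^+ 2 by exists (v / s ^+ 2).
  move: Ew vs; rewrite -xE -yE ltr_norml ler_norml => /andP[x1 x2] /andP[y1 y2].
  have W2E : W2 = x * y by rewrite /W2 -xE -yE.
  have VE : V w = s ^+ 2 * W2 by rewrite /W2; field; rewrite !gt_eqF.
  have W2b : `|W2 - 1| <= 2 * (e + r) by rewrite W2E ler_norml; apply/andP; split; nra.
  have W20 : 0 < W2 by rewrite W2E mulr_gt0//; lra.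
  exists (Num.sqrt W2).
    rewrite /S /= VE sqrtrM ?sqr_ge0// sqrtr_sqr gtr0_norm// ltr_pdivlMr; last first.
      by rewrite mulr_gt0// sqrtr_gt0.
    by rewrite mulrCA ltr_pM2l.
  split=> //; rewrite -[X in _ - X]mulr1 -mulrBr normrM ler_wpM2l//.
  apply: le_trans W2b; rewrite -[X in _ <= `|X - _|](sqr_sqrtr (ltW W20)).
  have -> : Num.sqrt W2 ^+ 2 - 1 = (Num.sqrt W2 - 1) * (Num.sqrt W2 + 1) by ring.
  rewrite normrM ler_peMr// ger0_norm; last by rewrite addr_ge0// sqrtr_ge0.
  by rewrite lerDr sqrtr_ge0.
have up : Phi (- z + delta - g) - eta <= fine (P S) + b + dd / rho ^+ 2.
  apply: le_trans (uQ _) _; apply: prob_le_bad mE mF Pb PF _ => //.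
    exact: measurable_ltset.
  move=> w /= Qw; case: (pselect (E w)) => Ew; first by right; left.
  case: (pselect (F w)) => Fw; first by right; right.
  left; have [W [_ h] []] := good w Ew Fw; rewrite ltr_norml ler_norml => /andP[d1 d2] /andP[w1 w2].
  by apply: h; move: Qw; rewrite /g; lra.
have lo : Phi (z - delta - g) - eta <= fine (P (~` S)) + b + dd / rho ^+ 2.
  apply: le_trans (lQ _) _; apply: prob_le_bad mE mF Pb PF _ => //.
  - exact: measurable_ltset.
  - exact: measurableC.
  move=> w /= Qw; case: (pselect (E w)) => Ew; first by right; left.
  case: (pselect (F w)) => Fw; first by right; right.
  left=> Sw; have [W [h _] []] := good w Ew Fw; rewrite ltr_norml ler_norml => /andP[d1 d2] /andP[w1 w2].
  by have := h Sw; move: Qw; rewrite /g; lra.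
have l1 := Phi_lipschitz (_ : - z + delta - g <= - z + delta).
have l2 := Phi_lipschitz (_ : z - delta - g <= z - delta).
have := PhiN (z - delta); rewrite opprB [delta - z]addrC => N.
move: lo; rewrite prob_compl// => lo; rewrite -/g -/S ler_norml.
have {}l1 := l1 ltac:(lra); have {}l2 := l2 ltac:(lra).
by apply/andP; split; lra.
Qed.

End perturbation.

(** * The power at a fixed sample size *)

Section power.
Context {R : realType} {d : measure_display} {T : measurableType d}.
Context (P : probability T R) {p : nat} (X : nat -> {RV P >-> p.-tuple R}).
Variables (M : nat) (mu : 'cV[R]_p) (Gam : int -> 'M[R]_p).
Hypotheses (gaussX : gaussian_process X) (depX : m_dependent X M).
Hypotheses (meanX : has_mean X mu) (autocovX : has_autocov X M Gam).
Variable n : nat.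
Hypothesis n_large : (14 * M.+1 <= n)%N.

Local Notation Y := (ctrd X mu).
Local Notation Om := (Omega X n).
Local Notation m := (M.+1%:R : R).
Local Notation Z := (cmean X mu n).
Local Notation tau := (\tr (Om *m Om)).
Local Notation A := (sqdev X mu n).

Let n0 : (0 < n)%N. Proof. by move: n_large; lia. Qed.
Let nR : n%:R != 0 :> R. Proof. by rewrite pnatr_eq0 -lt0n. Qed.
Let nR0 : 0 < n%:R :> R. Proof. by rewrite ltr0n. Qed.
Let m0 : 0 < m. Proof. by rewrite ltr0n. Qed.
Let tau0 : 0 <= tau. Proof. exact: (tau_ge0 gaussX meanX n_large). Qed.

Definition remainder w : R :=
  linear_part X mu n w - n%:R^-1 * (tr_Omega_hat X n M w - \tr Om).

Lemma measurable_remainder : measurable_fun setT remainder.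
Proof.
have mY t i := measurable_ctrd X mu t i.
have mc (a : R) : measurable_fun setT (fun _ : T => a) by exact: measurable_cst.
apply: measurable_funB.
  apply: measurable_funM => //; apply: measurable_sum => i; apply: measurable_funM => //.
  by apply: measurable_sum => t; apply: measurable_funM.
apply: measurable_funM => //; apply: measurable_funB => //.
rewrite (funext (tr_Omega_hatE X mu n_large)).
apply: measurable_sum => s; apply: measurable_sum => u; apply: measurable_funM => //.
by apply: measurable_sum => i; apply: measurable_funM.
Qed.

(** The trace condition at the lags [h, - h, h, - h] bounds the fourth power of
the Frobenius norm up to the factor [p]. *)
Lemma frob_Gam_le :
  (forall a b c f : int, (`|a| <= M)%N -> (`|b| <= M)%N -> (`|c| <= M)%N -> (`|f| <= M)%N ->
     `|\tr (Gam a *m Gam b *m Gam c *m Gam f)| <= m ^- 4 * tau ^+ 2) ->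
  forall h : int, (`|h| <= M)%N -> frob (Gam h) <= Num.sqrt p%:R * m ^- 2 * tau.
Proof.
move=> t4 h hM.
have hN : (`|- h| <= M)%N by rewrite abszN.
rewrite -(ler_pXn2r (_ : (0 < 2)%N)) ?nnegrE ?frob_ge0 ?mulr_ge0 ?sqrtr_ge0 ?invr_ge0 ?exprn_ge0 ?(ltW m0)//.
apply: le_trans (frob_sqr_le _) _.
have -> : (Num.sqrt p%:R * m ^- 2 * tau) ^+ 2 = p%:R * (m ^- 4 * tau ^+ 2).
  have -> : (Num.sqrt p%:R * m ^- 2 * tau) ^+ 2 = (Num.sqrt p%:R) ^+ 2 * (m ^- 4 * tau ^+ 2).
    by field; rewrite gt_eqF.
  by rewrite sqr_sqrtr ?ler0n.
rewrite ler_wpM2l ?ler0n// (Gam_tr gaussX meanX autocovX)//.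
by apply: le_trans (ler_norm _) _; exact: t4.
Qed.

(** The local alternative at [h] and [- h] controls the two square roots that
dominate the quadratic form of [Gam h]. *)
Lemma qform_Omega_small (e : R) : 0 <= e ->
  (forall h : int, (`|h| <= M)%N ->
     `|qform (psd_sqrt (Gam h *m Gam (- h))) mu| <= e * (m^-1 * n%:R^-1 * tau)) ->
  `|qform Om mu| <= 2 * e * tau / n%:R.
Proof.
move=> e0 loc.
have B0 : 0 <= e * (m^-1 * n%:R^-1 * tau).
  by rewrite !mulr_ge0// invr_ge0 ltW.
have h1 : `|qform Om mu| <= M.*2.+1%:R * (e * (m^-1 * n%:R^-1 * tau)).
  apply: (qform_Omega_le gaussX depX meanX autocovX n0 B0) => h hM.
  have hN : (`|- h| <= M)%N by rewrite abszN.
  have := bilinear_le_psd_sqrt (Gam h) mu.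
  have l1 := loc _ hM; have := loc _ hN; rewrite opprK => l2.
  rewrite (Gam_tr gaussX meanX autocovX)// => bil.
  move: bil l1 l2; rewrite ![`|qform (psd_sqrt _) _| <= _]ler_norml => bil /andP[_ a1] /andP[_ a2].
  rewrite -(ler_pM2l (ltr0Sn R 1)); apply: le_trans bil _.
  by apply: le_trans (lerD a1 a2) _; rewrite -mulr2n mulr_natl.
apply: le_trans h1 _.
have -> : 2 * e * tau / n%:R = 2 * m * (e * (m^-1 * n%:R^-1 * tau)) by field; rewrite nR gt_eqF.
by rewrite ler_wpM2r// -natrM ler_nat; lia.
Qed.

Lemma remainder_moment (K B : R) :
  (forall h : int, (`|h| <= M)%N -> frob (Gam h) <= K) -> `|qform Om mu| <= B ->
  exists2 v, hasE P (fun w => remainder w ^+ 2) v &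
    v <= 8 * B / n%:R + 2 * n%:R ^- 2 * (m ^+ 4 * K / n%:R * (1024 + 3136 * (p%:R / n%:R))).
Proof.
move=> GK qB.
have [v Ev vle] := trace_estimator_error gaussX depX meanX autocovX n_large GK.
have EL := linear_part_moment gaussX meanX n_large.
have dom := hasED (hasEZ 2 EL) (hasEZ (2 * n%:R ^- 2) Ev).
have domP w : `|remainder w ^+ 2| <= 2 * linear_part X mu n w ^+ 2 +
    2 * n%:R ^- 2 * (tr_Omega_hat X n M w - \tr Om) ^+ 2.
  rewrite ger0_norm ?sqr_ge0//.
  have -> : n%:R ^- 2 = n%:R^-1 ^+ 2 :> R by rewrite exprVn.
  have := sqr_ge0 (linear_part X mu n w + n%:R^-1 * (tr_Omega_hat X n M w - \tr Om)).
  by rewrite /remainder; nra.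
have LR : L1 P (fun w => remainder w ^+ 2).
  apply: L1_le (hasE_L1 dom) domP; apply: measurable_funX; exact: measurable_remainder.
exists (Ex P (fun w => remainder w ^+ 2)); first exact: hasE_Ex.
apply: le_trans (ler_norm _) (le_trans (hasE_norm_le (hasE_Ex LR) dom domP) _).
apply: lerD; last by rewrite ler_wpM2l// mulr_ge0// invr_ge0 sqr_ge0.
have -> : 8 * B / n%:R = 2 * (4 * B / n%:R) by ring.
rewrite ler_pM2l// ler_pM2r ?invr_gt0// ler_pM2l//.
exact: le_trans (ler_norm _) qB.
Qed.

Lemma charfun_closeN (Q : T -> R) e : charfun_close P Q e -> charfun_close P (fun w => - Q w) e.
Proof.
move=> h s t; have := h (- s) t; rewrite sqrrN (exprM (- s) 2 2) sqrrN -exprM.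
by congr (`|Ex P _ - _| <= _); apply/funext => w; rewrite mulNr mulrN.
Qed.

(** The variance of the statistic is that of [sqdev] up to a relative error
[3 zeta]. It cannot vanish, since then the relative error of any estimator
would be one; hence [tau > 0] and the normalization makes sense. *)
Lemma power_at (V : {RV P >-> R}) (z zeta clt eta b e rho v : R) :
  hasE P (fun w => remainder w ^+ 2) v ->
  v <= zeta ^+ 2 * (2 * tau / n%:R ^+ 2) -> 0 < zeta <= 1 ->
  3 * zeta <= e -> 0 < e <= 4^-1 -> 0 < clt <= 1 -> b < 1 -> 0 < rho ->
  `|\tr (Om *m Om *m Om *m Om)| <= 4 * clt ^+ 2 * tau ^+ 2 ->
  (forall Q : T -> R, measurable_fun setT Q -> charfun_close P Q (129 * clt) ->
     forall a, Phi a - eta <= fine (P [set w | Q w < a])) ->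
  fine (P [set w | e <= `|V w / var_Mstat X n M - 1|]) <= b ->
  `|fine (P [set w | z < Tstat X n M V w]) -
    Phi (- z + n%:R * (mu^T *m mu) 0 0 / Num.sqrt (2 * tau))| <=
  eta + b + zeta ^+ 2 / rho ^+ 2 + (rho + `|z| * (4 * e)).
Proof.
move=> Er vle /andP[z0 z1] ze e01 clt01 b1 rho0 t4 cdf bad.
have [EA EA2] := sqdev_moments gaussX meanX n_large.
have mr := measurable_remainder.
set s2 := 2 * tau / n%:R ^+ 2 in vle EA2.
have s20 : 0 <= s2 by rewrite divr_ge0 ?sqr_ge0// mulr_ge0.
have vp := variance_perturbation ((mu^T *m mu) 0 0) mr EA EA2 Er z0 vle.
have varE : fine 'V_P[(fun w => (mu^T *m mu) 0 0 + A w + remainder w)] = var_Mstat X n M.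
  congr (fine (variance P _)); apply/funext => w.
  by rewrite (MstatE X mu n_large).
rewrite varE in vp; set nu := var_Mstat X n M in bad vp varE.
have vp3 : `|nu - s2| <= 3 * zeta * s2.
  by apply: le_trans vp _; rewrite ler_wpM2r//; nra.
have nu0 : nu != 0.
  apply/eqP => nu0; move: bad; rewrite nu0.
  rewrite (_ : [set w | _] = setT); first by rewrite probability_setT /=; lra.
  apply/seteqP; split => // w _ /=; rewrite invr0 mulr0 sub0r normrN1.
  by move: e01; lra.
have s2_gt0 : 0 < s2.
  rewrite lt_neqAle s20 andbT eq_sym; apply/eqP => s2z.
  by move: vp3; rewrite s2z mulr0 subr0 normr_le0 (negbTE nu0).
have tau_gt0 : 0 < tau.
  rewrite lt_neqAle tau0 andbT eq_sym; apply/eqP => tz.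
  by move: s2_gt0; rewrite /s2 tz mulr0 mul0r ltxx.
have [r rE] : exists r, r = Num.sqrt (2 * tau) by exists (Num.sqrt (2 * tau)).
have r0 : 0 < r by rewrite rE sqrtr_gt0 mulr_gt0.
have r2 : r ^+ 2 = 2 * tau by rewrite rE sqr_sqrtr// mulr_ge0// ltW.
have [s sE] : exists s, s = r / n%:R by exists (r / n%:R).
have s0 : 0 < s by rewrite sE divr_gt0.
have ss : s ^+ 2 = s2 by rewrite sE expr_div_n r2.
pose Q w := A w * (n%:R / Num.sqrt (2 * tau)).
have cQ : charfun_close P Q (129 * clt).
  exact: (sqdev_charfun_close gaussX meanX n_large tau_gt0 clt01 t4).
have mA : measurable_fun setT A by exact: L1_meas (hasE_L1 EA).
have mc (a : R) : measurable_fun setT (fun _ : T => a) by exact: measurable_cst.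
have mQ : measurable_fun setT Q by apply: measurable_funM.
have mQN : measurable_fun setT (fun w => - Q w) by exact: measurableT_comp.
have mD : measurable_fun setT (fun w => s^-1 * remainder w) by apply: measurable_funM.
have ED : hasE P (fun w => (s^-1 * remainder w) ^+ 2) (s ^- 2 * v).
  by apply: hasE_ext (hasEZ (s ^- 2) Er) => w; rewrite exprMn exprVn.
have nu_gt0 : 0 < nu.
  move: vp3; rewrite ler_norml => /andP[h _].
  have h1 : 3 * zeta * s2 <= 4^-1 * s2 by rewrite ler_wpM2r//; move: ze e01; lra.
  by lra.
have nus : `|nu / s ^+ 2 - 1| <= 3 * zeta.
  have -> : nu / s ^+ 2 - 1 = (nu - s2) / s2 by rewrite ss; field; rewrite gt_eqF.
  by rewrite normrM [X in _ * X]gtr0_norm ?invr_gt0// ler_pdivrMr.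
have := @power_close _ _ _ P Q (fun w => s^-1 * remainder w) V z
  ((mu^T *m mu) 0 0 / s) s nu e (3 * zeta) (s ^- 2 * v) eta b rho mQ mD
  (@measurable_funPT _ _ _ _ V) (cdf _ mQ cQ) (cdf _ mQN (charfun_closeN cQ)) ED rho0 s0 nu_gt0 nus.
rewrite (_ : (mu^T *m mu) 0 0 / s = n%:R * (mu^T *m mu) 0 0 / Num.sqrt (2 * tau)); last first.
  by rewrite -rE sE; field; rewrite nR gt_eqF.
rewrite (_ : [set w | z < _] = [set w | z < Tstat X n M V w]); last first.
  apply/seteqP; split => w /=; rewrite /Tstat (MstatE X mu n_large) -/(remainder w) /Q -rE sE;
    by congr (_ < _ / _); field; rewrite nR gt_eqF.
move=> h; apply: le_trans (h _ _ bad) _ => //.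
  by apply/andP; split; move: z0 ze e01; lra.
apply: lerD; last by rewrite lerD2l ler_wpM2l//; move: ze; lra.
rewrite lerD2l ler_wpM2r ?invr_ge0 ?sqr_ge0//.
by rewrite mulrC ss ler_pdivrMr.
Qed.

End power.

(** * Rates *)

Section rates.
Context {R : realType}.

Lemma bigO_nat (f g : nat -> R) : f =O_\oo g ->
  exists2 C : R, 0 < C & \forall n \near \oo, `|f n| <= C * `|g n|.
Proof. by move=> /eqO_exP. Qed.

(** Raise both sides to the eighth power. *)
Lemma near_root8_ge (B : R) : \forall n \near \oo, B <= (n%:R : R) `^ 8^-1.
Proof.
have := nbhs_infty_ger (`|B| ^+ 8) => h; near=> n.
have hn : `|B| ^+ 8 <= n%:R by near: n.
apply: le_trans (ler_norm B) _.
rewrite leNgt; apply/negP => lt.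
have q8 : ((n%:R : R) `^ 8^-1) ^+ 8 = n%:R.
  by rewrite -powR_mulrn ?powR_ge0// -powRrM mulVf ?powRr1.
move: hn; rewrite -q8 leNgt => /negP; apply.
by rewrite ltrXn2r//= ?powR_ge0.
Unshelve. all: by end_near. Qed.

Lemma near_ereal_le (u : nat -> \bar R) (b : R) : 0 < b -> u @ \oo --> 0%E ->
  \forall n \near \oo, fine (u n) <= b.
Proof.
move=> b0 u0; have h : \forall x \near (0%E : \bar R), fine x <= b.
  apply: filterS (open_ereal_lt' (_ : (0 < b%:E)%E)); last by rewrite lte_fin.
  by case=> [r||] //=; rewrite ?lte_fin; [exact: ltW|move=> _; exact: ltW].
exact: u0 h.
Qed.

(** The dimension and the dependence order are small enough: with
[q = n `^ 8^-1], the remainder has relative size [q ^+ 2 * q ^+ 4 / q ^+ 8]. *)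
Lemma near_rates (p M : nat -> nat) (c1 c2 x : R) : 0 <= c1 -> 0 <= c2 -> 0 < x ->
  (fun n => (p n)%:R : R) =O_\oo (fun n => n%:R : R) ->
  (fun n => (M n)%:R : R) =O_\oo (fun n => (n%:R : R) `^ 8^-1) ->
  \forall n \near \oo, (14 * (M n).+1 <= n)%N /\
    (M n).+1%:R ^+ 2 * Num.sqrt (p n)%:R / n%:R * (c1 + c2 * ((p n)%:R / n%:R)) <= x.
Proof.
move=> c10 c20 x0 /bigO_nat[Cp Cp0 pC] /bigO_nat[C C0 MC].
near=> n.
have [q qE] : exists q, q = (n%:R : R) `^ 8^-1 by exists (n%:R `^ 8^-1).
have q1 : 1 <= q by rewrite qE; near: n; exact: near_root8_ge.
have qA : 14 * (C + 1) <= q by rewrite qE; near: n; exact: near_root8_ge.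
pose D := (C + 1) ^+ 2 * Num.sqrt Cp * (c1 + c2 * Cp).
have qD : D / x <= q by rewrite qE; near: n; exact: near_root8_ge.
have q8 : q ^+ 8 = n%:R by rewrite qE -powR_mulrn ?powR_ge0// -powRrM mulVf ?powRr1.
have q0 : 0 < q by lra.
have n0 : 0 < n%:R :> R by rewrite -q8 exprn_gt0.
have Mq : (M n)%:R <= C * q.
  have : `|(M n)%:R| <= C * `|(n%:R : R) `^ 8^-1| by near: n.
  by rewrite -qE ger0_norm// gtr0_norm.
have pq : (p n)%:R <= Cp * n%:R.
  have : `|(p n)%:R| <= Cp * `|n%:R : R| by near: n.
  by rewrite !ger0_norm.
have mq : (M n).+1%:R <= (C + 1) * q by rewrite -natr1; lra.
have q7 : q <= q ^+ 7 by rewrite -[X in X <= _]expr1 ler_weXn2l.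
split.
  rewrite -(ler_nat R) natrM -q8 exprSr.
  have h : 14 * (M n).+1%:R <= 14 * (C + 1) * q by rewrite -mulrA ler_pM2l.
  by apply: le_trans h _; rewrite ler_pM2r//; apply: le_trans qA q7.
have sp : Num.sqrt (p n)%:R <= Num.sqrt Cp * q ^+ 4.
  have -> : q ^+ 4 = Num.sqrt (n%:R) by rewrite -q8 (exprM q 4 2) sqrtr_sqr ger0_norm// exprn_ge0// ltW.
  by rewrite -sqrtrM ?(ltW Cp0)// ler_wsqrtr.
have pn : (p n)%:R / n%:R <= Cp by rewrite ler_pdivrMr.
have -> : x = x * q ^+ 2 * q ^+ 6 / n%:R by rewrite -q8; field; rewrite gt_eqF.
apply: (@le_trans _ _ (((C + 1) * q) ^+ 2 * (Num.sqrt Cp * q ^+ 4) / n%:R * (c1 + c2 * Cp))).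
  apply: ler_pM => //.
  - by rewrite addr_ge0 ?mulr_ge0 ?divr_ge0.
  - rewrite ler_pM2r ?invr_gt0//; apply: ler_pM => //.
    by rewrite lerXn2r ?nnegrE// mulr_ge0 ?addr_ge0// ltW.
  - by rewrite lerD2l ler_wpM2l.
have -> : ((C + 1) * q) ^+ 2 * (Num.sqrt Cp * q ^+ 4) / n%:R * (c1 + c2 * Cp) =
  D * q ^+ 6 / n%:R by rewrite /D; ring.
rewrite ler_pM2r ?invr_gt0// ler_pM2r ?exprn_gt0//.
move: qD; rewrite ler_pdivrMr// mulrC => h; apply: le_trans h _.
by rewrite ler_pM2l// -[X in X <= _]expr1 ler_weXn2l.
Unshelve. all: by end_near. Qed.

End rates.

(** * The limit of the power *)

Theorem mainTheorem5 (R : realType) (d : nat -> measure_display)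
  (T : forall n, measurableType (d n)) (P : forall n, probability (T n) R)
  (p M : nat -> nat) (mu : forall n, 'cV[R]_(p n))
  (Gam : forall n, int -> 'M[R]_(p n))
  (X : forall n, nat -> {RV (P n) >-> (p n).-tuple R})
  (Vhat : forall n, {RV (P n) >-> R}) (alpha z : R)
  (stationaryX : forall n, strictly_stationary (X n))
  (gaussianX : forall n, gaussian_process (X n))
  (dependentX : forall n, m_dependent (X n) (M n))
  (meanX : forall n, has_mean (X n) (mu n))
  (autocovX : forall n, has_autocov (X n) (M n) (Gam n))
  (p_bigO : (fun n => (p n)%:R : R) =O_\oo (fun n => n%:R : R))
  (p_infty : p @ \oo --> \oo)
  (M_bigO : (fun n => (M n)%:R : R) =O_\oo (fun n => (n%:R : R) `^ 8^-1))
  (Omega_cvg : (fun n => max_entry (Omega (X n) n - spectral0 (M n) (Gam n)))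
     @ \oo --> (0 : R))
  (trace4 : forall e : R, 0 < e -> \forall n \near \oo,
     forall a b c f : int,
       (`|a| <= M n)%N -> (`|b| <= M n)%N -> (`|c| <= M n)%N ->
       (`|f| <= M n)%N ->
       `|\tr (Gam n a *m Gam n b *m Gam n c *m Gam n f)| <=
       e * ((M n).+1%:R ^- 4 *
            \tr (Omega (X n) n *m Omega (X n) n) ^+ 2))
  (local_alternative : forall e : R, 0 < e -> \forall n \near \oo,
     forall h : int, (`|h| <= M n)%N ->
       `|qform (psd_sqrt (Gam n h *m Gam n (- h))) (mu n)| <=
       e * ((M n).+1%:R^-1 * n%:R^-1 *
            \tr (Omega (X n) n *m Omega (X n) n)))
  (Vhat_consistent :
     ratio_consistent Vhat (fun n => var_Mstat (X n) n (M n)))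
  (alpha01 : 0 < alpha < 1) (z_alpha : Phi z = 1 - alpha) :
  (fun n =>
     fine (P n [set w | z < Tstat (X n) n (M n) (Vhat n) w]) -
     Phi (- z + n%:R * ((mu n)^T *m mu n) 0 0 /
                Num.sqrt (2 * \tr (Omega (X n) n *m Omega (X n) n))))
    @ \oo --> (0 : R).
Proof.
apply/cvgrPdist_le => eps eps0.
(* Five error terms of size at most [eta] are to be added up; all parameters of
   the estimate at a fixed sample size are chosen accordingly. *)
have [eta etaE] : exists eta, eta = eps / 8 by exists (eps / 8).
have eta0 : 0 < eta by rewrite etaE divr_gt0.
have [e0 e00 cdf] := @charfun_close_cdf R eta eta0.
have [clt clt01 clte] : exists2 clt : R, 0 < clt <= 1 & 129 * clt <= e0.
  exists (Num.min 1 (e0 / 129)); first by rewrite lt_min ltr01 divr_gt0//= ge_min lexx.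
  by rewrite mulrC -ler_pdivlMr// ge_min lexx orbT.
have /andP[clt0 clt1] := clt01.
have [b b01 be] : exists2 b : R, 0 < b < 1 & b <= eta.
  exists (Num.min 2^-1 eta); last by rewrite ge_min lexx orbT.
  by rewrite lt_min invr_gt0 ltr0n eta0 gt_min (_ : 2^-1 < 1)//; lra.
have /andP[b0 b1] := b01.
have [e e01 ez] : exists2 e : R, 0 < e <= 4^-1 & `|z| * (4 * e) <= eta.
  exists (Num.min 4^-1 (eta / (4 * (`|z| + 1)))).
    rewrite lt_min invr_gt0 ltr0n ge_min lexx /= divr_gt0// mulr_gt0// ltr_pwDr//.
  apply: (@le_trans _ _ (`|z| * (4 * (eta / (4 * (`|z| + 1)))))).
    by rewrite ler_wpM2l// ler_pM2l// ge_min lexx orbT.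
  have z1 : 0 < `|z| + 1 by rewrite ltr_pwDr.
  have -> : `|z| * (4 * (eta / (4 * (`|z| + 1)))) = eta * (`|z| / (`|z| + 1)).
    by field; rewrite gt_eqF.
  by rewrite ler_piMr// ?(ltW eta0)// ler_pdivrMr// mul1r; lra.
have /andP[e_0 e_1] := e01.
have [zeta z01 [ze zr]] : exists2 zeta : R, 0 < zeta <= 1 &
    3 * zeta <= e /\ zeta ^+ 2 / eta ^+ 2 <= eta.
  exists (Num.min (e / 3) (Num.min eta (eta ^+ 2))).
    rewrite !lt_min eta0 exprn_gt0// divr_gt0//= ge_min.
    by rewrite (_ : e / 3 <= 1)//; lra.
  split; first by rewrite mulrC -ler_pdivlMr// ge_min lexx.
  have m0 : 0 <= Num.min (e / 3) (Num.min eta (eta ^+ 2)).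
    by rewrite !le_min !divr_ge0 ?exprn_ge0 ?(ltW eta0) ?(ltW e_0).
  rewrite ler_pdivrMr ?exprn_gt0// expr2; apply: ler_pM => //.
    by rewrite !ge_min lexx orbT.
  by rewrite !ge_min lexx !orbT.
have /andP[z0 z1] := z01.
have zz0 : 0 < zeta ^+ 2 by rewrite exprn_gt0.
have clt4 : 0 < clt ^+ 2 / 4 by rewrite divr_gt0 ?exprn_gt0.
have zz16 : 0 < zeta ^+ 2 / 16 by rewrite divr_gt0.
have zz2 : 0 < zeta ^+ 2 / 2 by rewrite divr_gt0.
have t1 := trace4 _ (ltr01 : 0 < 1 :> R).
have t2 := trace4 _ clt4.
have loc := local_alternative _ zz16.
have rates := near_rates (ler0n R 1024) (ler0n R 3136) zz2 p_bigO M_bigO.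
have bad := near_ereal_le b0 (Vhat_consistent e e_0).
apply: filterS (filterI (filterI t1 t2) (filterI loc (filterI rates bad))) => n.
move=> [[t1n t2n] [locn [[nM rt] badn]]].
have n_gt0 : 0 < n%:R :> R by rewrite ltr0n; move: nM; case: (n).
have m_gt0 : 0 < (M n).+1%:R :> R by rewrite ltr0n.
have tau0 := tau_ge0 (gaussianX n) (meanX n) nM.
have FK := frob_Gam_le (gaussianX n) (meanX n) (autocovX n) nM (_ : forall a b c f : int, _).
have {}FK h : (`|h| <= M n)%N -> frob (Gam n h) <= Num.sqrt (p n)%:R * (M n).+1%:R ^- 2 *
    \tr (Omega (X n) n *m Omega (X n) n).
  apply: FK => a b' c f ha hb hc hf; rewrite -[X in _ <= X]mul1r.
  exact: t1n.
have qO := qform_Omega_small (gaussianX n) (dependentX n) (meanX n) (autocovX n) nM (ltW zz16)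
  locn.
have [v Ev vle] := remainder_moment (gaussianX n) (dependentX n) (meanX n) (autocovX n) nM FK qO.
set tau := \tr (_ *m _) in tau0 vle *.
have vle' : v <= zeta ^+ 2 * (2 * tau / n%:R ^+ 2).
  apply: le_trans vle _.
  set k := 1024 + _; have {}rt : (M n).+1%:R ^+ 2 * Num.sqrt (p n)%:R / n%:R * k <= zeta ^+ 2 / 2 by [].
  (* one half for the linear part, one half for the trace estimator *)
  have -> : zeta ^+ 2 * (2 * tau / n%:R ^+ 2) = zeta ^+ 2 * tau / n%:R ^+ 2 +
     2 * n%:R ^- 2 * tau * (zeta ^+ 2 / 2) by field; rewrite gt_eqF.
  apply: lerD.
    by rewrite le_eqVlt; apply/orP; left; apply/eqP; field; rewrite gt_eqF.
  have -> : 2 * n%:R ^- 2 * ((M n).+1%:R ^+ 4 * (Num.sqrt (p n)%:R * (M n).+1%:R ^- 2 * tau) / n%:R * k) =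
      2 * n%:R ^- 2 * tau * ((M n).+1%:R ^+ 2 * Num.sqrt (p n)%:R / n%:R * k).
    by field; rewrite !gt_eqF.
  by rewrite ler_wpM2l// !mulr_ge0// invr_ge0 exprn_ge0// ltW.
have t4 : `|\tr (Omega (X n) n *m Omega (X n) n *m Omega (X n) n *m Omega (X n) n)| <=
    4 * clt ^+ 2 * tau ^+ 2.
  have B0 : 0 <= clt ^+ 2 / 4 * ((M n).+1%:R ^- 4 * tau ^+ 2).
    by rewrite !mulr_ge0 ?(ltW clt4) ?invr_ge0 ?exprn_ge0// ltW.
  have n0 : (0 < n)%N by rewrite -(ltr0n R).
  apply: le_trans (tr_Omega4_le (gaussianX n) (dependentX n) (meanX n) (autocovX n) n0 B0 t2n) _.
  have -> : 4 * clt ^+ 2 * tau ^+ 2 = (2 * (M n).+1%:R) ^+ 4 * (clt ^+ 2 / 4 * ((M n).+1%:R ^- 4 * tau ^+ 2)).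
    by field; rewrite gt_eqF.
  rewrite ler_wpM2r// lerXn2r ?nnegrE ?mulr_ge0 ?ler0n//.
  by rewrite -natrM ler_nat mul2n doubleS.
have pw := power_at (eta := eta) (rho := eta) (gaussianX n) (meanX n) nM
  z Ev vle' z01 ze e01 clt01 b1 eta0 t4 _ badn.
rewrite sub0r normrN; apply: le_trans (pw _) _; last by move: be ez zr etaE; lra.
move=> Q mQ cQ; apply: cdf => // s t; apply: le_trans (cQ s t) _.
by rewrite ler_wpM2r// addr_ge0// (exprM s 2 2) sqr_ge0.
Qed.
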